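(* With the labelling of simple roots, the order $0<1<\cdots<r-1$ on $I$, and the right-to-left lexicographic order on words described in the context, the dual canonical basis elements (root vectors) $b^*[\underline i]=b^*_{[\underline i]}$ attached to good Lyndon words $[\underline i]$ are as follows. (1) In type $A_r$: $b^*[i,\dots,j]=[i,\dots,j]$ for $0\le i\le j<r$. (2) In type $B_r$: $b^*[i,\dots,j]=[i,\dots,j]$ for $0\le i\le j<r$, and $b^*[j,\dots,0,0,\dots,k]=[2]_0\,[j,\dots,0,0,\dots,k]$ for $0\le j<k<r$. (3) In type $C_r$: $b^*[i,\dots,j]=[i,\dots,j]$ for $0\le i\le j<r$; $b^*[j,\dots,1,0,1,\dots,k]=[j,\dots,1,0,1,\dots,k]$ for $1\le j<k<r$; and $b^*[0,\dots,j,1,\dots,j]=q\,[0]\cdot([1,\dots,j]*[1,\dots,j])$ for $1\le j<r$. (4) In type $D_r$: $b^*[0]=[0]$; $b^*[0,2,\dots,i]=[0,2,\dots,i]$ for $2\le i<r$; $b^*[i,\dots,j]=[i,\dots,j]$ for $1\le i\le j<r$; $b^*[1,0,2,\dots,j]=[1,0,2,\dots,j]+[0,1,2,\dots,j]$ for $2\le j<r$; and $b^*[j,\dots,2,1,0,2,\dots,k]=[j,\dots,2,1,0,2,\dots,k]+[j,\dots,2,0,1,2,\dots,k]$ for $2\le j<k<r$.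
   Context: $\mathfrak g$ is a simple Lie algebra of the given classical type with simple roots $\alpha_i$, $i\in I=\{0,1,\dots,r-1\}$. Labelling: types $A_r,B_r,C_r$: chain $0-1-\cdots-(r-1)$; in $B_r$ the double edge joins $0,1$ and $\alpha_0$ is the short simple root; in $C_r$ the double edge joins $0,1$ and $\alpha_0$ is the long simple root. $D_r$: nodes $0$ and $1$ are both joined to $2$, followed by the chain $2-3-\cdots-(r-1)$. $(\cdot,\cdot)$ is the invariant form normalized so that short roots have $(\alpha,\alpha)=2$ (all roots in simply laced types); $d_i=(\alpha_i,\alpha_i)/2$, $q_i=q^{d_i}$, and $[k]_i=(q_i^k-q_i^{-k})/(q_i-q_i^{-1})$. (A bracket with a subscript is a $q$-integer; a bracket without subscript is a word.) $\mathcal F$ is the free associative $\mathbb Q(q)$-algebra on letters $[i]$, $i\in I$ (concatenation $\cdot$, words $[i_1,\dots,i_k]=[i_1]\cdots[i_k]$), graded by $|[i]|=\alpha_i$. The quantum shuffle product $*$ on $\mathcal F$ is the bilinear product with the empty word $[]$ as unit and, inductively, $(x\cdot[i])*(y\cdot[j])=(x*(y\cdot[j]))\cdot[i]+q^{-(|x|+\alpha_i,\alpha_j)}((x\cdot[i])*y)\cdot[j]$. $U_q=U_q(\mathfrak n)$ is the $\mathbb Q(q)$-algebra generated by $e_i$, $i\in I$, with the quantum Serre relations; $\Psi:U_q\to(\mathcal F,* )$ is the injective algebra homomorphism with $\Psi(e_i)=[i]$, and $\mathcal W=\Psi(U_q)$. Order $I$ by $0<1<\cdots<r-1$ and order words lexicographically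 from right to left: $[i]<[]$ for all $i$, and $[i_1,\dots,i_k]<[j_1,\dots,j_\ell]$ if $i_k<j_\ell$, or for some $m$, $i_{k-m}<j_{\ell-m}$ and $i_{k-s}=j_{\ell-s}$ for all $s<m$. For homogeneous $f\in\mathcal F$, $\min(f)$ is the smallest word occurring in $f$. A word is good if it equals $\min(w)$ for some homogeneous $w\in\mathcal W$, and Lyndon if it is larger than each of its proper left factors; the words inside $b^*[\cdot]$ in the claim are exactly the good Lyndon words. Dual canonical basis. Let $e_i'$ be the linear maps on $U_q$ with $e_i'(e_j)=\delta_{ij}$, $e_i'(uv)=e_i'(u)v+q^{-(\alpha_i,|u|)}u\,e_i'(v)$, and $(\cdot,\cdot)_K$ the symmetric bilinear form on $U_q$ with $(1,1)_K=1$, $(e_i'(u),v)_K=(u,e_iv)_K$. The dual canonical basis is the basis of $U_q$ adjoint with respect to $(\cdot,\cdot)_K$ to the canonical (lower global) basis. For a good word $g$, $b_g^*\in\mathcal W$ is the image under $\Psi$ of the unique dual canonical basis element with $\min(b_g^* )=g$. $[i,\dots,j]$ with $i\le j$ means $[i,i+1,\dots,j]$; descending segments descend by $1$ at each step. *)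

(* Defs.v *)
From HB Require Import structures.
From mathcomp Require Import all_boot all_order all_algebra.
From mathcomp Require Import finmap.
From mathcomp Require Import monalg.

Set Implicit Arguments.
Unset Strict Implicit.
Unset Printing Implicit Defensive.

Import Order.TTheory GRing.Theory Num.Theory.

Local Open Scope ring_scope.

(** * The field Q(q) *)

Notation Qq := {fraction {poly rat}}.

Definition q : Qq := tofrac 'X.

Definition regular0 (c : Qq) : Prop :=
  exists n d : {poly rat}, d.[0] != 0 /\ c = tofrac n / tofrac d.

Definition laurent (c : Qq) : Prop :=
  exists (p : {poly rat}) (m : nat), c = tofrac p / q ^+ m.

(** * Root data *)

Inductive classical_type := typeA | typeB | typeC | typeD.

(** Type D is allowed from rank 3 on, where the diagram (nodes 0 and 1 both
    joined to 2) is still connected. *)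
Definition valid_rank (ty : classical_type) (r : nat) : bool :=
  match ty with
  | typeA => (0 < r)%N
  | typeB | typeC => (1 < r)%N
  | typeD => (2 < r)%N
  end.

Definition chain_adj (i j : nat) : bool := (j == i.+1) || (i == j.+1).

Definition fork_adj (i j : nat) : bool :=
  [|| [&& (0 < i)%N, (0 < j)%N & chain_adj i j],
      (i == 0%N) && (j == 2%N) | (i == 2%N) && (j == 0%N)].

(** The form (alpha_i, alpha_j), with short roots of square length 2. *)
Definition sform (ty : classical_type) (i j : nat) : int :=
  match ty with
  | typeA => if i == j then 2 else if chain_adj i j then -1 else 0
  | typeB => if i == j then (if i == 0%N then 2 else 4)
             else if chain_adj i j then -2 else 0
  | typeC => if i == j then (if i == 0%N then 4 else 2)
             else if chain_adj i j
                  then (if (i == 0%N) || (j == 0%N) then -2 else -1)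
             else 0
  | typeD => if i == j then 2 else if fork_adj i j then -1 else 0
  end.

(** Both divisions below are exact. *)
Definition dsym (ty : classical_type) (i : nat) : int :=
  (sform ty i i %/ 2)%Z.

Definition cartan (ty : classical_type) (i j : nat) : int :=
  (sform ty i j %/ dsym ty i)%Z.

Definition qi (ty : classical_type) (i : nat) : Qq := q ^ dsym ty i.

Definition qint (ty : classical_type) (i k : nat) : Qq :=
  (qi ty i ^+ k - qi ty i ^- k) / (qi ty i - (qi ty i)^-1).

Definition qfact (ty : classical_type) (i n : nat) : Qq :=
  \prod_(1 <= k < n.+1) qint ty i k.

(** The divided power x^(n) with respect to q_i. *)
Definition divpow (ty : classical_type) (i : nat) (A : lalgType Qq)
    (x : A) (n : nat) : A :=
  (qfact ty i n)^-1 *: x ^+ n.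

(** * Words and the free algebra *)

(** The monoid algebra of the free monoid on the letters [i]: its ring
    multiplication is concatenation. *)
Notation freeAlg r := {malg Qq[{fmonom 'I_r}]}.

Definition wd (r : nat) (s : seq 'I_r) : freeAlg r := << FMonom s >>.

Definition coefw (r : nat) (f : freeAlg r) (s : seq 'I_r) : Qq :=
  mcoeff (FMonom s) f.

(** Elements of the positive part of the root lattice. *)
Definition weight (r : nat) := {ffun 'I_r -> nat}.

Definition wt (r : nat) (s : seq 'I_r) : weight r :=
  [ffun i => count_mem i s].

Definition wform (ty : classical_type) (r : nat) (b c : weight r) : int :=
  \sum_(i < r) \sum_(j < r) (b i)%:Z * (c j)%:Z * sform ty i j.

Definition homogF (r : nat) (b : weight r) (f : freeAlg r) : Prop :=
  forall s, coefw f s != 0 -> wt s = b.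

(** [rshuffle s t] is the quantum shuffle product of the words [rev s] and
    [rev t]; the recursion on last letters becomes a recursion on heads. *)
Fixpoint rshuffle (ty : classical_type) (r : nat) (s : seq 'I_r) :
    seq 'I_r -> freeAlg r :=
  fix aux (t : seq 'I_r) : freeAlg r :=
  match s, t with
  | [::], _ => wd (rev t)
  | _ :: _, [::] => wd (rev s)
  | i :: x, j :: y =>
      rshuffle ty x t * wd [:: i]
      + q ^ (- wform ty (wt (i :: x)) (wt [:: j])) *: (aux y * wd [:: j])
  end.

Definition qshuffle (ty : classical_type) (r : nat) (f g : freeAlg r) :
    freeAlg r :=
  \sum_(s <- msupp f) \sum_(t <- msupp g)
    (f@_s * g@_t) *: rshuffle ty (rev s) (rev t).

(** Right-to-left lexicographic order; a proper right factor of a word is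
    larger than the word, as forced by [i] < []. *)
Fixpoint rlt (s t : seq nat) : bool :=
  match s, t with
  | [::], _ => false
  | _ :: _, [::] => true
  | i :: s', j :: t' => (i < j)%N || (i == j) && rlt s' t'
  end.

Definition word_lt (r : nat) (s t : seq 'I_r) : bool :=
  rlt (rev (map val s)) (rev (map val t)).

Definition is_min (r : nat) (f : freeAlg r) (g : seq 'I_r) : Prop :=
  coefw f g != 0 /\ forall s, coefw f s != 0 -> s = g \/ word_lt g s.

Definition lyndon (r : nat) (g : seq 'I_r) : Prop :=
  g <> [::] /\
  forall u v, u <> [::] -> v <> [::] -> g = u ++ v -> word_lt u g.

(** * The algebra U_q *)

Definition serre (ty : classical_type) (r : nat) (i j : 'I_r) : freeAlg r :=
  let n := `|1 - cartan ty i j|%N in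
  \sum_(k < n.+1) (-1) ^+ k *:
    (divpow ty i (wd [:: i]) (n - k) * wd [:: j] * divpow ty i (wd [:: i]) k).

(** The two-sided ideal generated by the Serre elements. *)
Inductive serre_ideal (ty : classical_type) (r : nat) : freeAlg r -> Prop :=
  | serre_ideal0 : serre_ideal ty 0
  | serre_idealD (i j : 'I_r) (x y f : freeAlg r) :
      i != j -> serre_ideal ty f -> serre_ideal ty (x * serre ty i j * y + f).

Section Algebra.
Variables (ty : classical_type) (r : nat) (U : algType Qq) (e : 'I_r -> U).

Definition eval (f : freeAlg r) : U :=
  \sum_(s <- msupp f) f@_s *: \prod_(i <- (s : seq 'I_r)) e i.

(** U is the algebra presented by generators e_i and the Serre relations. *)
Definition is_Uq : Prop :=
  (forall u, exists f, u = eval f) /\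
  (forall f, eval f = 0 <-> serre_ideal ty f).

Definition homogU (b : weight r) (u : U) : Prop :=
  exists f, homogF b f /\ u = eval f.

Definition is_Psi (Psi : {linear U -> freeAlg r}) : Prop :=
  [/\ injective Psi,
      Psi 1 = wd [::],
      forall u v, Psi (u * v) = qshuffle ty (Psi u) (Psi v) &
      forall i, Psi (e i) = wd [:: i]].

Definition is_qderiv (d : 'I_r -> {linear U -> U}) : Prop :=
  (forall i j, d i (e j) = (i == j)%:R) /\
  (forall i b u v, homogU b u ->
     d i (u * v) = d i u * v + q ^ (- wform ty (wt [:: i]) b) *: (u * d i v)).

Definition is_formK (d : 'I_r -> {linear U -> U}) (K : U -> U -> Qq) : Prop :=
  [/\ forall u v, K u v = K v u,
      forall u (c : Qq) v w, K u (c *: v + w) = c * K u v + K u w,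
      K 1 1 = 1 &
      forall i u v, K (d i u) v = K u (e i * v)].

(** The bar involution: additivity and multiplicativity, together with
    these two clauses, make it semilinear for q |-> q^-1. *)
Definition is_bar (bar : {rmorphism U -> U}) : Prop :=
  (forall u, bar (q *: u) = q^-1 *: bar u) /\ (forall i, bar (e i) = e i).

(** * Lower global basis *)

(** The form over Q[q, q^-1] generated by the divided powers. *)
Inductive integral : U -> Prop :=
  | integral_scalar c : laurent c -> integral c%:A
  | integral_divpow (i : 'I_r) (n : nat) : integral (divpow ty i (e i) n)
  | integralD u v : integral u -> integral v -> integral (u + v)
  | integralM u v : integral u -> integral v -> integral (u * v).

Section Lattice.
Variables (d : 'I_r -> {linear U -> U}) (bar : {rmorphism U -> U}).

(** The Kashiwara operator, as the graph of the map sending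
    [\sum_k e_i^(k) x_k], where [e_i' x_k = 0], to [\sum_k e_i^(k+1) x_k]. *)
Definition ftilde (i : 'I_r) (u v : U) : Prop :=
  exists (n : nat) (x : nat -> U),
    [/\ forall k, d i (x k) = 0,
        u = \sum_(k < n) divpow ty i (e i) k * x k &
        v = \sum_(k < n) divpow ty i (e i) k.+1 * x k].

Inductive crystal_elt : U -> Prop :=
  | crystal1 : crystal_elt 1
  | crystalS i u v : crystal_elt u -> ftilde i u v -> crystal_elt v.

(** The lattice L(oo) over the functions regular at q = 0; the crystal B(oo)
    consists of the classes of [crystal_elt]s modulo q L(oo). *)
Inductive latticeL : U -> Prop :=
  | latticeL0 : latticeL 0
  | latticeLD c b u :
      regular0 c -> crystal_elt b -> latticeL u -> latticeL (c *: b + u).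

(** The elements of U_Q, L(oo) and its bar conjugate whose class modulo
    q L(oo) lies in the crystal. *)
Definition lower_global (b : U) : Prop :=
  [/\ integral b, latticeL b, exists2 u, latticeL u & b = bar u &
      exists c u, [/\ crystal_elt c, latticeL u & b = c + q *: u]].

Definition is_basis (G : U -> Prop) : Prop :=
  (forall u, exists (s : seq U) (c : U -> Qq),
     (forall b, b \in s -> G b) /\ u = \sum_(b <- s) c b *: b) /\
  (forall (s : seq U) (c : U -> Qq),
     uniq s -> (forall b, b \in s -> G b) ->
     \sum_(b <- s) c b *: b = 0 -> forall b, b \in s -> c b = 0).

Definition is_canonical_basis (G : U -> Prop) : Prop :=
  is_basis G /\ forall b, G b <-> lower_global b.

End Lattice.

Definition dual_canonical (G : U -> Prop) (K : U -> U -> Qq) (u : U) : Prop :=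
  exists2 b, G b & forall b', G b' -> K u b' = (b == b')%:R.

Definition good (Psi : U -> freeAlg r) (g : seq 'I_r) : Prop :=
  exists b u, homogF b (Psi u) /\ is_min (Psi u) g.

(** [w] is b_g^*. *)
Definition is_bstar (G : U -> Prop) (K : U -> U -> Qq) (Psi : U -> freeAlg r)
    (g : seq 'I_r) (w : freeAlg r) : Prop :=
  exists u,
    [/\ dual_canonical G K u, is_min (Psi u) g, Psi u = w &
        forall v, dual_canonical G K v -> is_min (Psi v) g -> v = u].

Definition is_root_vector (G : U -> Prop) (K : U -> U -> Qq)
    (Psi : U -> freeAlg r) (g : seq 'I_r) (w : freeAlg r) : Prop :=
  [/\ good Psi g, lyndon g & is_bstar G K Psi g w].

End Algebra.

(** * Explicit words *)

(** Only applied to sequences of numbers smaller than r, so that no letter is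
    dropped. *)
Definition letters (r : nat) (s : seq nat) : seq 'I_r := pmap insub s.

Definition up (i j : nat) : seq nat := iota i (j.+1 - i).

Definition down (j i : nat) : seq nat := rev (up i j).

(* Main.v *)
(** An element of U_q is determined by the coefficients of its image under Psi,
    and [e_i'] removes a last letter [i]; conversely a family of coefficients
    comes from an element as soon as it is annihilated by the Serre relations
    (nondegeneracy of the form on the words of a given length).  This yields all
    the vectors of the statement, together with their derivatives.

    That such a vector [u] is dual canonical is seen by induction on its length:
    [u] pairs into Q[q, q^-1] with the divided powers and has bar-invariant
    coefficients, and it remains to see that it pairs into [q A], A being the
    ring of functions regular at [q = 0], with all elements of the crystal but one,
    and into [1 + q A] with that one.  The adjoint of the Kashiwara operator f_i
    on a vector with [e_i'^3 u = 0] is [e_i' u - (1 - 1 / [2]_i) e_i e_i'^2 u].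
    Hence the induction step is immediate if [e_i'^2 u = 0]; if [e_i' u = [2]_i p]
    with [w = e_i' p], it needs [p - e_i w] small, which follows from the
    q-commutator [e_i w - q^2 w e_i = (1 - q^4) p].  Two dual canonical vectors
    that are proportional are equal, so uniqueness of [u] amounts to: a vector of
    the same weight none of whose words is smaller than the given one is a
    multiple of [u].  This follows by stripping letters from the right, the
    Serre relations between the [e_i'] leaving only one letter to strip (two for
    the branch of D_r, and [e_j'^2] for the long roots of C_r). *)

Require Import Defs.
From HB Require Import structures.
From mathcomp Require Import all_boot all_order all_algebra.
From mathcomp Require Import finmap generic_quotient.
From mathcomp Require Import monalg.
From mathcomp Require Import ring zify.

Set Implicit Arguments.
Unset Strict Implicit.
Unset Printing Implicit Defensive.

Import Order.TTheory GRing.Theory Num.Theory.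

Local Open Scope ring_scope.

(** As a hint, this lemma applies to every [_ != 0] and sends [done] computing
    with fractions. *)
Remove Hints denom_ratioP : core.

(** Orthonormality of the crystal modulo q is never established, and homogeneity of the canonical
    basis has to be derived; both facts shape the proof. Each vector u carries a witness C: a
    crystal element pairs with u into qA, or it pairs into 1 + qA and is congruent to C modulo q
    L(oo). A canonical basis element b is a crystal element modulo q L(oo), and K(u, b) lies in
    Q[q, q^-1], in A and, by bar invariance, in the conjugate of A. These three meet in Q, so K(u,
    b) is 0 or 1. Two elements of value 1 are both congruent to C; their difference is integral,
    lies in q L(oo) and in the conjugate lattice, and so vanishes. Homogeneity enters in the
    uniqueness of u, where a competing dual canonical vector is known only by its smallest word; it
    comes from automorphisms scaling one generator by 2. As to the scalars: e_j' produces 1 + q^-2 =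
    q^-1 [2] from the shuffle square of [1..j], which the factor q makes bar invariant, and [2]_0
    compensates the denominator of the divided square of e_0' on a prefix ending in 0,0. *)

Lemma q_neq0 : q != 0.
Proof. by rewrite /q tofrac_eq0 polyX_eq0. Qed.

Lemma qX_inj (m n : nat) : q ^+ m = q ^+ n -> m = n.
Proof.
rewrite /q -!tofracXn => /eqP; rewrite tofrac_eq.
by move=> /eqP/(congr1 (fun p : {poly rat} => size p)); rewrite !size_polyXn => -[].
Qed.

Lemma onesubqX_neq0 n : (0 < n)%N -> 1 - q ^+ n != 0.
Proof.
move=> n0; rewrite subr_eq0; apply/eqP => /esym h.
by have := @qX_inj n 0; rewrite expr0 => /(_ h) n00; rewrite n00 in n0.
Qed.

(** * Elements of Q(q) as quotients of polynomials *)

Section FracRepr.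
Import FracField.

Lemma frac_repr (c : Qq) : c = tofrac (\n_(repr c)) / tofrac (\d_(repr c)).
Proof.
have dn0 : tofrac (\d_(repr c)) != 0 by rewrite tofrac_eq0 denom_ratioP.
apply: (canRL (mulfK dn0)).
rewrite -{1}[c]reprK; move: (repr c) => x.
unlock tofrac; rewrite -[LHS]pi_mul.
apply/eqmodP; rewrite /= equivfE /mulf !numden_Ratio ?mulf_neq0 ?oner_neq0 ?denom_ratioP //.
by rewrite !mulr1 mulrC.
Qed.

End FracRepr.

Lemma fracP (c : Qq) : exists n d : {poly rat}, d != 0 /\ c = tofrac n / tofrac d.
Proof. by exists (\n_(repr c)), (\d_(repr c)); split; [apply: denom_ratioP | apply: frac_repr]. Qed.

(** * Conjugation *)

Definition Qinj : {rmorphism rat -> Qq} := @tofrac {poly rat} \o polyC.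

Definition evinv (p : {poly rat}) : Qq := (map_poly Qinj p).[q^-1].

Lemma evinvD p p' : evinv (p + p') = evinv p + evinv p'.
Proof. by rewrite /evinv rmorphD hornerD. Qed.

Lemma evinvM p p' : evinv (p * p') = evinv p * evinv p'.
Proof. by rewrite /evinv rmorphM hornerM. Qed.

Lemma evinvX : evinv 'X = q^-1.
Proof. by rewrite /evinv map_polyX hornerX. Qed.

Lemma evinvC a : evinv a%:P = Qinj a.
Proof. by rewrite /evinv map_polyC hornerC. Qed.

(** The reciprocal polynomial q^(n-1) p(1/q). It clears the powers of q^-1 in [evinv p], so that
    statements about [evinv] become statements about polynomials. *)
Definition revp (n : nat) (p : {poly rat}) : {poly rat} := \poly_(i < n) p`_(n.-1 - i).

Lemma evinv_rev n (p : {poly rat}) : (size p <= n)%N ->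
  evinv p * q ^+ n.-1 = tofrac (revp n p).
Proof.
move=> hs; rewrite /evinv (@horner_coef_wide _ n); last first.
  by rewrite size_map_poly.
rewrite /revp poly_def raddf_sum mulr_suml (reindex_inj rev_ord_inj) /=.
apply: eq_bigr => i _; rewrite coef_map /= -mul_polyC rmorphM rmorphXn /= -/q.
have -> : (n - i.+1)%N = (n.-1 - i)%N by lia.
rewrite exprVn -mulrA; congr (_ * _).
have {2}-> : (n.-1 = (n.-1 - i) + i)%N by have := ltn_ord i; lia.
by rewrite exprD mulKf // expf_neq0 // q_neq0.
Qed.

Lemma evinv_eq0 p : evinv p = 0 -> p = 0.
Proof.
move=> h; have := @evinv_rev (size p) p (leqnn _); rewrite h mul0r => /esym/eqP.
rewrite tofrac_eq0 => /eqP r0; apply/polyP => i; rewrite coef0.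
have [hi|hi] := ltnP i (size p); last by rewrite nth_default.
have := congr1 (fun x : {poly rat} => x`_((size p).-1 - i)) r0.
rewrite coef0 coef_poly.
have -> : ((size p).-1 - i < size p)%N by lia.
by have -> : ((size p).-1 - ((size p).-1 - i) = i)%N by lia.
Qed.

(** Bar conjugation of the scalars, read off a chosen representative. Independence of the choice,
    [conjqE], rests on the injectivity of [evinv], which keeps denominators nonzero. *)
Definition conjq (c : Qq) : Qq := evinv (\n_(repr c)) / evinv (\d_(repr c)).

Lemma evinv_neq0 p : p != 0 -> evinv p != 0.
Proof. by apply: contraNneq => /evinv_eq0 ->. Qed.

Lemma tofrac_neq0 (p : {poly rat}) : p != 0 -> tofrac p != 0.
Proof. by rewrite tofrac_eq0. Qed.

Lemma conjqE n d : d != 0 -> conjq (tofrac n / tofrac d) = evinv n / evinv d.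
Proof.
move=> d0; rewrite /conjq.
move: (frac_repr (tofrac n / tofrac d)); move: (repr _) => c /eqP.
have r0 : \d_c != 0 by apply: denom_ratioP.
rewrite eqr_div ?tofrac_neq0 // -!tofracM tofrac_eq => /eqP h.
apply/eqP; rewrite eqr_div ?evinv_neq0 // -!evinvM; apply/eqP; congr evinv.
by rewrite h.
Qed.

Lemma conjq_tofrac n : conjq (tofrac n) = evinv n.
Proof.
have := @conjqE n 1 (oner_neq0 _); rewrite tofrac1 !divr1 => ->.
by rewrite -[1]/(1%:P) evinvC rmorph1 divr1.
Qed.

Lemma conjqD a b : conjq (a + b) = conjq a + conjq b.
Proof.
have [n [d [d0 ->]]] := fracP a; have [n' [d' [d0' ->]]] := fracP b.
rewrite addf_div ?tofrac_neq0 // -!tofracM -tofracD !conjqE ?mulf_neq0 //.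
by rewrite addf_div ?evinv_neq0 // !evinvD !evinvM.
Qed.

Lemma conjqM a b : conjq (a * b) = conjq a * conjq b.
Proof.
have [n [d [d0 ->]]] := fracP a; have [n' [d' [d0' ->]]] := fracP b.
by rewrite mulf_div -!tofracM !conjqE ?mulf_neq0 // mulf_div !evinvM.
Qed.

Lemma conjqQ a : conjq (Qinj a) = Qinj a.
Proof. by rewrite conjq_tofrac evinvC. Qed.

Lemma conjq1 : conjq 1 = 1.
Proof. by rewrite -(rmorph1 Qinj) conjqQ. Qed.

Lemma conjq0 : conjq 0 = 0.
Proof. by rewrite -(rmorph0 Qinj) conjqQ. Qed.

Lemma conjqq : conjq q = q^-1.
Proof. by rewrite /q conjq_tofrac evinvX. Qed.

Lemma conjq_neq0 a : a != 0 -> conjq a != 0.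
Proof.
move=> a0; apply/eqP => h; have := conjqM a a^-1.
by rewrite divff // conjq1 h mul0r => /eqP; rewrite oner_eq0.
Qed.

Lemma conjqV a : conjq a^-1 = (conjq a)^-1.
Proof.
have [->|a0] := eqVneq a 0; first by rewrite !(invr0, conjq0).
apply: (mulfI (conjq_neq0 a0)).
by rewrite -conjqM (divff a0) (divff (conjq_neq0 a0)) conjq1.
Qed.

Lemma conjq_sum (I : Type) (s : seq I) (P : pred I) (F : I -> Qq) :
  conjq (\sum_(i <- s | P i) F i) = \sum_(i <- s | P i) conjq (F i).
Proof. exact: (big_morph _ conjqD conjq0). Qed.

Lemma conjqK : involutive conjq.
Proof.
move=> c; have [p [r [r0 ->]]] := fracP c.
have ev p' : conjq (evinv p') = tofrac p'.
  elim/poly_ind: p' => [|p' a IH].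
    by rewrite /evinv rmorph0 horner0 conjq0 tofrac0.
  rewrite evinvD evinvM evinvX evinvC conjqD conjqM IH conjqQ conjqV conjqq invrK.
  by rewrite tofracD tofracM.
by rewrite (conjqE _ r0) conjqM conjqV !ev.
Qed.

(** * Regular functions and Laurent polynomials *)

Lemma horner0_neq0 (d : {poly rat}) : d.[0] != 0 -> d != 0.
Proof. by apply: contraNneq => ->; rewrite horner0. Qed.

Lemma reg_tofrac n : regular0 (tofrac n).
Proof. by exists n, 1; rewrite hornerC oner_neq0 tofrac1 divr1. Qed.

Lemma regQ a : regular0 (Qinj a). Proof. exact: reg_tofrac. Qed.

Lemma reg0 : regular0 0. Proof. by rewrite -tofrac0; apply: reg_tofrac. Qed.

Lemma reg1 : regular0 1. Proof. by rewrite -tofrac1; apply: reg_tofrac. Qed.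

Lemma regq1 : regular0 q. Proof. exact: reg_tofrac. Qed.

Lemma regD a b : regular0 a -> regular0 b -> regular0 (a + b).
Proof.
move=> [n [d [d0 ->]]] [n' [d' [d0' ->]]].
exists (n * d' + n' * d), (d * d'); rewrite hornerM mulf_neq0 //; split => //.
by rewrite addf_div ?tofrac_neq0 ?horner0_neq0 // tofracD !tofracM.
Qed.

Lemma regM a b : regular0 a -> regular0 b -> regular0 (a * b).
Proof.
move=> [n [d [d0 ->]]] [n' [d' [d0' ->]]].
by exists (n * n'), (d * d'); rewrite hornerM mulf_neq0 // mulf_div !tofracM.
Qed.

Lemma regN a : regular0 a -> regular0 (- a).
Proof.
move=> ra; have -> : - a = Qinj (-1) * a by rewrite rmorphN rmorph1 mulN1r.
exact: regM (regQ _) ra.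
Qed.

Lemma regB a b : regular0 a -> regular0 b -> regular0 (a - b).
Proof. by move=> ra rb; apply: regD => //; apply: regN. Qed.

Lemma regX a n : regular0 a -> regular0 (a ^+ n).
Proof. by move=> ra; elim: n => [|n IH]; [apply: reg1 | rewrite exprS; apply: regM]. Qed.

(** The maximal ideal qA of A. *)
Definition small (c : Qq) : Prop := exists2 c', regular0 c' & c = q * c'.

Lemma small_reg a : small a -> regular0 a.
Proof. by move=> [c rc ->]; apply: regM => //; apply: regq1. Qed.

Lemma small0 : small 0. Proof. by exists 0; rewrite ?mulr0 //; apply: reg0. Qed.

Lemma smallD a b : small a -> small b -> small (a + b).
Proof. by move=> [c rc ->] [c' rc' ->]; exists (c + c'); rewrite ?mulrDr //; apply: regD. Qed.

Lemma smallMr a b : small a -> regular0 b -> small (a * b).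
Proof. by move=> [c rc ->] rb; exists (c * b); rewrite ?mulrA //; apply: regM. Qed.

Lemma smallN a : small a -> small (- a).
Proof. by move=> [c rc ->]; exists (- c); rewrite ?mulrN //; apply: regN. Qed.

Lemma smallB a b : small a -> small b -> small (a - b).
Proof. by move=> ra rb; apply: smallD => //; apply: smallN. Qed.

Lemma small_q : small q. Proof. by exists 1; rewrite ?mulr1 //; apply: reg1. Qed.

Lemma small_Q a : small (Qinj a) -> a = 0.
Proof.
move=> [c [n [d [d0 ->]]]].
rewrite mulrA => h.
have {h} : Qinj a * tofrac d = q * tofrac n.
  by rewrite h (divfK (tofrac_neq0 (horner0_neq0 d0))).
rewrite /q /= -!tofracM => /eqP; rewrite tofrac_eq.
move=> /eqP /(congr1 (fun p : {poly rat} => p.[0])).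
rewrite !hornerM hornerC hornerX mul0r => /eqP; rewrite mulf_eq0 (negPf d0) orbF.
by move/eqP.
Qed.

Lemma laurent_tofrac n : laurent (tofrac n).
Proof. by exists n, 0%N; rewrite expr0 divr1. Qed.

Lemma laurentQ a : laurent (Qinj a). Proof. exact: laurent_tofrac. Qed.

Lemma laurent0 : laurent 0. Proof. by rewrite -tofrac0; apply: laurent_tofrac. Qed.

Lemma laurent1 : laurent 1. Proof. by rewrite -tofrac1; apply: laurent_tofrac. Qed.

Lemma laurentq : laurent q. Proof. exact: laurent_tofrac. Qed.

Lemma laurentVq : laurent q^-1.
Proof. by exists 1, 1%N; rewrite expr1 tofrac1 mul1r. Qed.

Lemma laurentM a b : laurent a -> laurent b -> laurent (a * b).
Proof.
by move=> [n [m ->]] [n' [m' ->]]; exists (n * n'), (m + m')%N; rewrite mulf_div exprD tofracM.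
Qed.

Lemma laurentD a b : laurent a -> laurent b -> laurent (a + b).
Proof.
move=> [n [m ->]] [n' [m' ->]]; exists (n * 'X ^+ m' + n' * 'X ^+ m), (m + m')%N.
by rewrite addf_div ?expf_neq0 ?q_neq0 // exprD tofracD !tofracM !tofracXn.
Qed.

Lemma laurentX a n : laurent a -> laurent (a ^+ n).
Proof. by move=> ra; elim: n => [|n IH]; [apply: laurent1 | rewrite exprS; apply: laurentM]. Qed.

Lemma laurent_qz (z : int) : laurent (q ^ z).
Proof.
case: z => n; first exact: laurentX laurentq.
by rewrite NegzE -exprnN -exprVn; apply: laurentX laurentVq.
Qed.

(** A denominator that does not vanish at 0 is coprime to every power of q, so the power of q in the
    Laurent form must divide the numerator. *)
Lemma regular_laurent_poly c : laurent c -> regular0 c -> exists p, c = tofrac p.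
Proof.
move=> [p [m hc]] [n [d [d0 hc']]].
have: tofrac (p * d) = tofrac (n * 'X^m).
  have := hc'; rewrite {1}hc => /eqP.
  rewrite (eqr_div _ _ (expf_neq0 m q_neq0) (tofrac_neq0 (horner0_neq0 d0))).
  by rewrite /q -tofracXn -!tofracM => /eqP.
move=> /eqP; rewrite tofrac_eq => /eqP h.
have cop : coprimep 'X^m d.
  by rewrite coprimep_expl // coprimep_sym -['X]subr0 -polyC0 coprimep_XsubC.
have : 'X^m %| p by rewrite -(Gauss_dvdpl _ cop) h dvdp_mulIr.
move=> /dvdpP [p' hp]; exists p'; by rewrite hc hp tofracM tofracXn (mulfK (expf_neq0 m q_neq0)).
Qed.

(** By the previous lemma c is a polynomial p; if its degree were positive, p(1/q) would have a pole
    at 0. *)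
Lemma regular_conj_const c : laurent c -> regular0 c -> regular0 (conjq c) ->
  exists a, c = Qinj a.
Proof.
move=> lc rc; have [p ->] := regular_laurent_poly lc rc.
rewrite conjq_tofrac => -[n [d [d0 h]]].
have [p0|p0] := eqVneq p 0; first by exists 0; rewrite p0 tofrac0 rmorph0.
have hr := @evinv_rev (size p) p (leqnn _); rewrite h in hr.
have e : revp (size p) p * d = n * 'X^((size p).-1).
  apply/eqP; rewrite -tofrac_eq !tofracM tofracXn -hr -/q.
  by rewrite mulrAC (divfK (tofrac_neq0 (horner0_neq0 d0))).
(* The constant term of the reciprocal polynomial is the leading coefficient of p, whereas the
   right-hand side vanishes at 0 when the degree is positive. *)
have := congr1 (fun x : {poly rat} => x.[0]) e.
rewrite !hornerM hornerXn horner_coef0 coef_poly subn0.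
have -> : (0 < size p)%N by rewrite lt0n size_poly_eq0.
case: (posnP (size p).-1) => hsz.
  move=> _; exists p`_0; rewrite /Qinj /=; congr tofrac; apply: size1_polyC.
  by rewrite (leq_trans (leqSpred _)) ?hsz.
rewrite expr0n eqn0Ngt hsz mulr0 => /eqP.
by rewrite mulf_eq0 (negPf d0) orbF -lead_coefE lead_coef_eq0 (negPf p0).
Qed.

(** * Linear extension from words *)

Lemma linear_comb (V W : lmodType Qq) (a b : Qq) (f g : {linear V -> W}) :
  linear (fun x => a *: f x + b *: g x).
Proof.
move=> c x y; rewrite (linearP f) (linearP g) !scalerDr !scalerA (mulrC a) (mulrC b).
by rewrite addrACA.
Qed.

Lemma malg_scaleAr (M : monomType) (R : comNzRingType) c (f g : {malg R[M]}) :
  f * (c *: g) = c *: (f * g).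
Proof.
apply/malgP => k; rewrite mcoeffZ (mcoeffMlw _ (fsubset_refl _) (msuppZ_le c g)).
rewrite (mcoeffMlw _ (fsubset_refl _) (fsubset_refl _)) mulr_sumr; apply: eq_bigr => k1 _.
rewrite mulr_sumr; apply: eq_bigr => k2 _.
by rewrite mcoeffZ mulrCA mulrnAr.
Qed.

Section FreeAlgebra.
Variables (ty : classical_type) (r : nat).
Implicit Types (f g : freeAlg r) (s t : seq 'I_r).

Definition lext (V : lmodType Qq) (h : seq 'I_r -> V) f : V :=
  \sum_(s <- msupp f) f@_s *: h s.

Lemma lextEw (V : lmodType Qq) (h : seq 'I_r -> V) (A : {fset {fmonom 'I_r}}) f :
  (msupp f `<=` A)%fset -> lext h f = \sum_(s <- A) f@_s *: h s.
Proof.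
move=> le; rewrite [LHS](big_fset_incl _ le) => //= x xd /mcoeff_outdom ->.
by rewrite scale0r.
Qed.

Lemma lext_is_linear (V : lmodType Qq) (h : seq 'I_r -> V) : linear (lext h).
Proof.
move=> c f g.
pose A := (msupp f `|` msupp g `|` msupp (c *: f + g))%fset.
have hf : (msupp f `<=` A)%fset by apply/fsubsetP => x hx; rewrite !in_fsetU hx.
have hg : (msupp g `<=` A)%fset by apply/fsubsetP => x hx; rewrite !in_fsetU hx orbT.
have hfg : (msupp (c *: f + g) `<=` A)%fset.
  by apply/fsubsetP => x hx; rewrite !in_fsetU hx !orbT.
rewrite (lextEw _ hf) (lextEw _ hg) (lextEw _ hfg).
rewrite scaler_sumr -big_split /=; apply: eq_bigr => s _.
by rewrite mcoeffD mcoeffZ scalerDl scalerA.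
Qed.

HB.instance Definition _ (V : lmodType Qq) (h : seq 'I_r -> V) :=
  GRing.isLinear.Build Qq (freeAlg r) V _ (lext h) (lext_is_linear h).

Lemma lext_wd (V : lmodType Qq) (h : seq 'I_r -> V) s : lext h (wd s) = h s.
Proof.
by rewrite (@lextEw _ _ [fset FMonom s]%fset) ?msuppU_le // big_seq_fset1 mcoeffUU scale1r.
Qed.

Lemma lext_Zwd (V : lmodType Qq) (h : seq 'I_r -> V) c s : lext h (c *: wd s) = c *: h s.
Proof. by rewrite (linearZ_LR (lext h)) /= lext_wd. Qed.

Lemma freeAlgE f : f = lext (@wd r) f.
Proof.
rewrite {1}[f]monalgE; apply: eq_bigr => s _.
by apply/malgP => t; rewrite mcoeffZ !mcoeffU fmK; case: (s == t); rewrite ?mulr1 ?mulr0.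
Qed.

(** Bare functions with a proof of linearity are taken, so that the abstraction of one factor of a
    product can be tested on words directly. *)
Lemma linear_wordP (V : lmodType Qq) (h h' : freeAlg r -> V) :
  linear h -> linear h' -> (forall s, h (wd s) = h' (wd s)) -> h =1 h'.
Proof.
move=> lh lh' hh f.
pose H := HB.pack_for {linear freeAlg r -> V} h (GRing.isLinear.Build _ _ _ _ h lh).
pose H' := HB.pack_for {linear freeAlg r -> V} h' (GRing.isLinear.Build _ _ _ _ h' lh').
rewrite -[h f]/(H f) -[h' f]/(H' f) (freeAlgE f) /lext !linear_sum; apply: eq_bigr => s _.
by rewrite !linearZ /= hh.
Qed.

Lemma coefwD f g s : coefw (f + g) s = coefw f s + coefw g s.
Proof. exact: mcoeffD. Qed.

Lemma coefwZ c f s : coefw (c *: f) s = c * coefw f s.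
Proof. exact: mcoeffZ. Qed.

Lemma coefw0 s : coefw (0 : freeAlg r) s = 0.
Proof. exact: mcoeff0. Qed.

Lemma coefw_sum (I : Type) (A : seq I) (P : pred I) (F : I -> freeAlg r) s :
  coefw (\sum_(i <- A | P i) F i) s = \sum_(i <- A | P i) coefw (F i) s.
Proof. exact: (big_morph (fun f => coefw f s) (fun f g => coefwD f g s) (coefw0 s)). Qed.

Lemma coefw_wd s t : coefw (wd s) t = (s == t)%:R.
Proof. by rewrite /coefw /wd mcoeffU. Qed.

Lemma coefwP f g : (forall s, coefw f s = coefw g s) -> f = g.
Proof. by move=> h; apply/malgP => -[s]; apply: h. Qed.

Lemma wdM s t : wd s * wd t = wd (s ++ t).
Proof.
rewrite /wd malgM_def fgmulUU mulr1; congr << _ >>.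
by rewrite [LHS]fmmulE.
Qed.

Lemma wd1 : wd (r := r) [::] = 1.
Proof.
have e1 : FMonom [::] = mone :> {fmonom 'I_r} by rewrite -[RHS]fmK fm1.
by apply/malgP => t; rewrite mcoeff1 /wd e1 mcoeffU eq_sym.
Qed.

Lemma coefw_mulr f i s j :
  coefw (f * wd [:: i]) (rcons s j) = (i == j)%:R * coefw f s.
Proof.
apply: (@linear_wordP Qq^o (fun f => coefw (f * wd [:: i]) (rcons s j))
  (fun f => (i == j)%:R * coefw f s)).
- by move=> c x y; rewrite mulrDl -scalerAl coefwD coefwZ.
- by move=> c x y; rewrite coefwD coefwZ mulrDr mulrCA.
move=> t; rewrite wdM !coefw_wd cats1 eqseq_rcons andbC.
by case: (i == j); case: (t == s); rewrite ?mul1r ?mul0r ?mulr0.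
Qed.

Lemma coefw_mulr_nil f i : coefw (f * wd [:: i]) [::] = 0.
Proof.
rewrite (freeAlgE f) /lext mulr_suml.
rewrite coefw_sum.
apply: big1 => t _; rewrite -scalerAl coefwZ wdM coefw_wd cats1.
by case: (fmonom_val t) => //=; rewrite mulr0.
Qed.

(** The operator that e_l' becomes under [Psi], see [Psi_der]; words are reversed to expose the last
    letter. *)
Definition strip (l : 'I_r) : freeAlg r -> freeAlg r :=
  lext (fun t => if rev t is a :: t' then (a == l)%:R *: wd (rev t') else 0).

HB.instance Definition _ l := GRing.Linear.copy (strip l) (lext _).

Lemma strip_rcons l t a : strip l (wd (rcons t a)) = (a == l)%:R *: wd t.
Proof. by rewrite /strip lext_wd rev_rcons revK. Qed.

Lemma strip_nil l : strip l (wd [::]) = 0.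
Proof. by rewrite /strip lext_wd. Qed.

Lemma coefw_strip l f s : coefw (strip l f) s = coefw f (rcons s l).
Proof.
apply: (@linear_wordP Qq^o (fun f => coefw (strip l f) s) (fun f => coefw f (rcons s l))).
- by move=> c x y; rewrite linearP coefwD coefwZ.
- by move=> c x y; rewrite coefwD coefwZ.
move=> t; rewrite coefw_wd; case/lastP: t => [|t' a].
  by rewrite strip_nil coefw0; case: s.
by rewrite strip_rcons coefwZ coefw_wd eqseq_rcons andbC; case: (a == l); rewrite ?mul1r ?mul0r.
Qed.

Lemma strip_mulr l f i : strip l (f * wd [:: i]) = (i == l)%:R *: f.
Proof. by apply: coefwP => s; rewrite coefw_strip coefw_mulr coefwZ. Qed.

Lemma strip_comb l f g i j c :
  strip l (f * wd [:: i] + c *: (g * wd [:: j])) =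
  (i == l)%:R *: f + c *: ((j == l)%:R *: g).
Proof.
transitivity (strip l (f * wd [:: i]) + c *: strip l (g * wd [:: j])).
  exact: (etrans (linearD _ _ _) (congr1 (+%R _) (linearZ_LR _ _ _))).
exact: (congr2 +%R (strip_mulr l f i) (congr1 ( *:%R c) (strip_mulr l g j))).
Qed.

Lemma qshuffleE f g :
  qshuffle ty f g = lext (fun s => lext (fun t => rshuffle ty (rev s) (rev t)) g) f.
Proof.
rewrite /qshuffle /lext; apply: eq_bigr => s _; rewrite scaler_sumr.
by apply: eq_bigr => t _; rewrite scalerA.
Qed.

Lemma qshuffle_wdl s g :
  qshuffle ty (wd s) g = lext (fun t => rshuffle ty (rev s) (rev t)) g.
Proof. by rewrite qshuffleE lext_wd. Qed.

Lemma sform_sym i j : sform ty i j = sform ty j i.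
Proof.
have c : chain_adj i j = chain_adj j i by rewrite /chain_adj orbC.
have f : fork_adj i j = fork_adj j i.
  by rewrite /fork_adj c andbCA; congr (_ || _); rewrite orbC andbC [X in _ || X]andbC.
by rewrite /sform c f eq_sym; case: ty => //; have [->|//] := eqVneq j i; rewrite 1?[in RHS]orbC.
Qed.

Lemma wform_wt (b : weight r) (i : 'I_r) :
  wform ty (wt [:: i]) b = \sum_(j < r) (b j)%:Z * sform ty i j.
Proof.
rewrite /wform (bigD1 i) //= [X in _ + X]big1 ?addr0.
  by apply: eq_bigr => j _; rewrite ffunE /= eqxx mul1r.
by move=> j hj; apply: big1 => k _; rewrite ffunE /= eq_sym (negPf hj) !mul0r.
Qed.

Lemma wform_wts (i : 'I_r) s : wform ty (wt [:: i]) (wt s) = \sum_(j <- s) sform ty i j.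
Proof.
rewrite wform_wt; elim: s => [|a s IH].
  by rewrite big_nil big1 // => j _; rewrite ffunE mul0r.
rewrite big_cons -IH [in RHS](bigD1 a) //= [in LHS](bigD1 a) //= !ffunE /= eqxx PoszD.
rewrite mulrDl mul1r -addrA.
congr (_ + (_ + _)); apply: eq_bigr => j hj.
by rewrite !ffunE /= eq_sym (negPf hj).
Qed.

(** The shuffle recursion on last letters, with a single letter as left factor, is the twisted
    Leibniz rule of e_l'. This is why [Psi] intertwines e_l' with the removal of a last letter. *)
Lemma strip_shuffle1 l j f :
  strip l (qshuffle ty (wd [:: j]) f) =
  (j == l)%:R *: f + q ^ (- sform ty j l) *: qshuffle ty (wd [:: j]) (strip l f).
Proof.
rewrite !qshuffle_wdl /=.
pose h t : freeAlg r := rshuffle ty [:: j] (rev t).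
pose L : freeAlg r -> freeAlg r := fun f => strip l (lext h f).
pose R : freeAlg r -> freeAlg r :=
  fun f => (j == l)%:R *: f + q ^ (- sform ty j l) *: lext h (strip l f).
have lL : linear L by exact: linearP (strip l \o lext h).
have lR : linear R.
  exact: (linear_comb (j == l)%:R (q ^ (- sform ty j l)) idfun (lext h \o strip l)).
apply: (linear_wordP lL lR) => t; rewrite /L /R.
case/lastP: t => [|t a].
  by rewrite strip_nil linear0 scaler0 addr0 lext_wd /h /= -[wd [:: j]]/(wd (rcons [::] j)) strip_rcons.
rewrite strip_rcons lext_wd /h rev_rcons.
have -> : rshuffle ty [:: j] (a :: rev t) =
  wd (rcons t a) * wd [:: j]
  + q ^ (- wform ty (wt [:: j]) (wt [:: a])) *: (rshuffle ty [:: j] (rev t) * wd [:: a]).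
  by rewrite /= -[a :: rev t]rev_rcons revK.
rewrite strip_comb wform_wts big_seq1.
rewrite lext_Zwd /h; have [->|_] := eqVneq a l; last by rewrite !scale0r !scaler0.
by rewrite !scale1r.
Qed.

Lemma shuffle1_nil j f : coefw (qshuffle ty (wd [:: j]) f) [::] = 0.
Proof.
rewrite qshuffle_wdl /lext coefw_sum.
apply: big1 => t _; rewrite coefwZ.
case/lastP: (fmonom_val t) => [|t' a] /=; first by rewrite coefw_wd mulr0.
rewrite rev_rcons /= coefwD coefwZ.
rewrite [X in _ * (X + _)]coefw_mulr_nil [X in _ * (_ + _ * X)]coefw_mulr_nil.
by rewrite mulr0 addr0 mulr0.
Qed.

End FreeAlgebra.

(** * The algebra U_q *)

(** The rank is written [n.+1], so that numbers can be read as letters by [inord]. *)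
Record qsetup (ty : classical_type) (n : nat) := QSetup {
  carrier :> algType Qq;
  gen : 'I_n.+1 -> carrier;
  gen_ok : is_Uq ty gen;
  Psi : {linear carrier -> freeAlg n.+1};
  Psi_ok : is_Psi ty gen Psi;
  der : 'I_n.+1 -> {linear carrier -> carrier};
  der_ok : is_qderiv ty gen der;
  form : carrier -> carrier -> Qq;
  form_ok : is_formK gen der form;
  bar : {rmorphism carrier -> carrier};
  bar_ok : is_bar gen bar;
  cbasis : carrier -> Prop;
  cbasis_ok : is_canonical_basis ty gen der bar cbasis
}.

Section Basics.
Variables (ty : classical_type) (n : nat) (S : qsetup ty n).
Local Notation e := (@gen _ _ S).
Local Notation d := (@der _ _ S).
Local Notation K := (@form _ _ S).
Implicit Types (u v x y : S) (s t : seq 'I_n.+1) (i j : 'I_n.+1).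

Definition mon s : S := \prod_(i <- s) e i.

Definition cf u s : Qq := coefw (@Psi _ _ S u) s.

Lemma mon_nil : mon [::] = 1. Proof. by rewrite /mon big_nil. Qed.
Lemma mon_cons i s : mon (i :: s) = e i * mon s. Proof. by rewrite /mon big_cons. Qed.
Lemma mon_cat s t : mon (s ++ t) = mon s * mon t. Proof. by rewrite /mon big_cat. Qed.

Lemma evalE f : eval e f = lext mon f. Proof. by []. Qed.

Lemma eval_wd s : eval e (wd s) = mon s. Proof. exact: lext_wd. Qed.

Lemma evalD f g : eval e (f + g) = eval e f + eval e g.
Proof. by rewrite !evalE; exact: (linearD (lext mon)). Qed.

Lemma evalZ c f : eval e (c *: f) = c *: eval e f.
Proof. by rewrite !evalE; exact: (linearZ_LR (lext mon)). Qed.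

Lemma eval_sum (I : Type) (A : seq I) (P : pred I) (F : I -> freeAlg n.+1) :
  eval e (\sum_(i <- A | P i) F i) = \sum_(i <- A | P i) eval e (F i).
Proof. by rewrite evalE (linear_sum (lext mon)). Qed.

Lemma evalM f g : eval e (f * g) = eval e f * eval e g.
Proof.
apply: (@linear_wordP _ _ (fun f => eval e (f * g)) (fun f => eval e f * eval e g)).
- move=> c x y; rewrite mulrDl evalD; congr (_ + _).
  by rewrite -scalerAl evalZ.
- by move=> c x y; rewrite evalD evalZ mulrDl scalerAl.
move=> s; apply: (@linear_wordP _ _ (fun g => eval e (wd s * g)) (fun g => eval e (wd s) * eval e g)).
- move=> c x y; rewrite mulrDr evalD; congr (_ + _).
  by rewrite malg_scaleAr evalZ.
- by move=> c x y; rewrite evalD evalZ mulrDr scalerAr.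
by move=> t; rewrite wdM !eval_wd mon_cat.
Qed.

Lemma gen_span u : exists f, u = lext mon f.
Proof. by have [+ _] := gen_ok S => /(_ u). Qed.

Lemma linear_monP (V : lmodType Qq) (h h' : S -> V) :
  linear h -> linear h' -> (forall s, h (mon s) = h' (mon s)) -> h =1 h'.
Proof.
move=> lh lh' hh u; have [f ->] := gen_span u.
apply: (@linear_wordP _ _ (fun f => h (lext mon f)) (fun f => h' (lext mon f))).
- by move=> c x y; rewrite (linearP (lext mon)) lh.
- by move=> c x y; rewrite (linearP (lext mon)) lh'.
by move=> s; rewrite lext_wd.
Qed.

Lemma cfD u v s : cf (u + v) s = cf u s + cf v s.
Proof. by rewrite /cf linearD coefwD. Qed.

Lemma cfZ c u s : cf (c *: u) s = c * cf u s.
Proof. by rewrite /cf linearZ_LR coefwZ. Qed.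

Lemma cf0 s : cf 0 s = 0.
Proof. by rewrite /cf linear0 coefw0. Qed.

Lemma cfN u s : cf (- u) s = - cf u s.
Proof. by rewrite -scaleN1r cfZ mulN1r. Qed.

Lemma cfB u v s : cf (u - v) s = cf u s - cf v s.
Proof. by rewrite cfD cfN. Qed.

Lemma cf_inj u v : (forall s, cf u s = cf v s) -> u = v.
Proof. by have [inj _ _ _] := Psi_ok S => h; apply/inj/coefwP. Qed.

Lemma cf1 s : cf 1 s = (s == [::])%:R.
Proof. by rewrite /cf; have [_ -> _ _] := Psi_ok S; rewrite coefw_wd eq_sym. Qed.

Lemma Psi_gen_mul j x : @Psi _ _ S (e j * x) = qshuffle ty (wd [:: j]) (@Psi _ _ S x).
Proof. by have [_ _ -> ->] := Psi_ok S. Qed.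

Lemma cf_gen_mul_nil j x : cf (e j * x) [::] = 0.
Proof. by rewrite /cf Psi_gen_mul shuffle1_nil. Qed.

Lemma homogU_gen j : homogU e (wt [:: j]) (e j).
Proof.
exists (wd [:: j]); split; last by rewrite eval_wd /mon big_seq1.
move=> s; rewrite coefw_wd; case: ([:: j] =P s) => [<- //|_].
by rewrite eqxx.
Qed.

Lemma homogU1 : homogU e (wt [::]) 1.
Proof.
exists (wd [::]); split; last by rewrite eval_wd mon_nil.
by move=> s; rewrite coefw_wd; case: ([::] =P s) => [<- //|_]; rewrite eqxx.
Qed.

Lemma wform_gen i j : wform ty (wt [:: i]) (wt [:: j]) = sform ty i j.
Proof. by rewrite wform_wts big_seq1. Qed.

Lemma der_gen i j : d i (e j) = (i == j)%:R.
Proof. by have [-> _] := der_ok S. Qed.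

Lemma der_mul i b u v : homogU e b u ->
  d i (u * v) = d i u * v + q ^ (- wform ty (wt [:: i]) b) *: (u * d i v).
Proof. by have [_ +] := der_ok S; apply. Qed.

Lemma der_genM i j x :
  d i (e j * x) = (i == j)%:R *: x + q ^ (- sform ty i j) *: (e j * d i x).
Proof.
rewrite (der_mul _ _ (homogU_gen j)) der_gen wform_gen.
by congr (_ + _); case: (i == j); rewrite ?mul1r ?scale1r ?mul0r ?scale0r.
Qed.

Lemma der1 i : d i 1 = 0.
Proof.
have := der_mul i 1 homogU1; rewrite wform_wts big_nil oppr0 expr0z scale1r !mulr1 mul1r.
by move/eqP; rewrite addrC -subr_eq subrr eq_sym => /eqP.
Qed.

Lemma Psi_der i u : @Psi _ _ S (d i u) = strip i (@Psi _ _ S u).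
Proof.
apply: (@linear_monP _ (fun u => @Psi _ _ S (d i u)) (fun u => strip i (@Psi _ _ S u))).
- by move=> c x y; rewrite linearP (linearP (@Psi _ _ S)).
- by move=> c x y; rewrite linearP (linearP (strip i)).
elim=> [|j s IH].
  rewrite mon_nil der1 linear0; have [_ -> _ _] := Psi_ok S.
  by rewrite strip_nil.
rewrite mon_cons der_genM Psi_gen_mul strip_shuffle1 -IH -Psi_gen_mul.
by rewrite linearD !linearZ_LR eq_sym sform_sym.
Qed.

Lemma cf_der i u s : cf (d i u) s = cf u (rcons s i).
Proof. by rewrite /cf Psi_der coefw_strip. Qed.

Lemma der_inj u v : cf u [::] = cf v [::] -> (forall i, d i u = d i v) -> u = v.
Proof.
move=> h0 h; apply: cf_inj; elim/last_ind => [//|s i _].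
by rewrite -!cf_der h.
Qed.

Lemma KC u v : K u v = K v u. Proof. by have [h _ _ _] := form_ok S. Qed.

Lemma K_lin u (c : Qq) v w : K u (c *: v + w) = c * K u v + K u w.
Proof. by have [_ h _ _] := form_ok S. Qed.

Lemma K0r u : K u 0 = 0.
Proof.
have := K_lin u 1 0 0; rewrite scaler0 addr0 mul1r => /eqP.
by rewrite addrC -subr_eq subrr eq_sym => /eqP.
Qed.

Lemma KZr u c v : K u (c *: v) = c * K u v.
Proof. by rewrite -[c *: v]addr0 K_lin K0r addr0. Qed.

Lemma KDr u v w : K u (v + w) = K u v + K u w.
Proof. by rewrite -[v]scale1r K_lin mul1r scale1r. Qed.

Lemma KZl u c v : K (c *: u) v = c * K u v.
Proof. by rewrite KC KZr KC. Qed.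

Lemma KDl u v w : K (u + v) w = K u w + K v w.
Proof. by rewrite !(KC _ w) KDr. Qed.

Lemma K0l u : K 0 u = 0.
Proof. by rewrite KC K0r. Qed.

Lemma KNl u v : K (- u) v = - K u v.
Proof. by rewrite -scaleN1r KZl mulN1r. Qed.

Lemma KBl u v w : K (u - v) w = K u w - K v w.
Proof. by rewrite KDl KNl. Qed.

Lemma Ksumr u (I : Type) (A : seq I) (P : pred I) (F : I -> S) :
  K u (\sum_(i <- A | P i) F i) = \sum_(i <- A | P i) K u (F i).
Proof. exact: (big_morph (K u) (fun v w => KDr u v w) (K0r u)). Qed.

Lemma Ksuml u (I : Type) (A : seq I) (P : pred I) (F : I -> S) :
  K (\sum_(i <- A | P i) F i) u = \sum_(i <- A | P i) K (F i) u.
Proof. by rewrite KC Ksumr; apply: eq_bigr => i _; rewrite KC. Qed.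

Lemma K_der i u v : K (d i u) v = K u (e i * v).
Proof. by have [_ _ _ h] := form_ok S. Qed.

(** Since e_i' is adjoint to left multiplication by e_i and strips a last letter, the monomial
    consumes the word from its right end: hence the reversal. *)
Lemma K_mon u s : K u (mon s) = cf u (rev s).
Proof.
elim: s u => [|i s IH] u; last by rewrite mon_cons -K_der IH rev_cons cf_der.
rewrite mon_nil; move: u; apply: (@linear_monP Qq^o (fun u => K u 1) (fun u => cf u [::])).
- by move=> c x y; rewrite KDl KZl.
- by move=> c x y; rewrite cfD cfZ.
case=> [|j s]; first by rewrite mon_nil cf1; have [_ _ -> _] := form_ok S.
by rewrite mon_cons cf_gen_mul_nil KC -K_der der1 KC K0r.
Qed.

Lemma K1 u : K u 1 = cf u [::].
Proof. by rewrite -mon_nil K_mon. Qed.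

Lemma K_nondeg u : (forall v, K u v = 0) -> u = 0.
Proof. by move=> h; apply: cf_inj => s; rewrite -[s]revK -K_mon h cf0. Qed.

(** * Weights *)

(** A weight is represented by any word having it, so that stripping a letter is removing a head up
    to permutation. Only coefficients are involved, no preimage in the free algebra as in
    [homogU]. *)
Definition wtU s u := forall t, ~~ perm_eq t s -> cf u t = 0.

Lemma wtUD s u v : wtU s u -> wtU s v -> wtU s (u + v).
Proof. by move=> hu hv t ht; rewrite cfD hu // hv // addr0. Qed.

Lemma wtUZ s c u : wtU s u -> wtU s (c *: u).
Proof. by move=> hu t ht; rewrite cfZ hu // mulr0. Qed.

Lemma wtUN s u : wtU s u -> wtU s (- u).
Proof. by move=> hu t ht; rewrite cfN hu // oppr0. Qed.

Lemma wtUB s u v : wtU s u -> wtU s v -> wtU s (u - v).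
Proof. by move=> hu hv; apply: wtUD => //; apply: wtUN. Qed.

Lemma wtU0 s : wtU s 0.
Proof. by move=> t _; rewrite cf0. Qed.

Lemma wtU1 : wtU [::] 1.
Proof. by move=> t ht; rewrite cf1; case: t ht. Qed.

Lemma wtU_perm s t u : perm_eq s t -> wtU s u -> wtU t u.
Proof. by move=> st hu w hw; apply: hu; rewrite (permPr st). Qed.

Lemma wtU_der i s u : wtU (i :: s) u -> wtU s (d i u).
Proof.
by move=> hu t ht; rewrite cf_der hu // perm_rcons perm_cons.
Qed.

Lemma wtU_der_notin i s u : i \notin s -> wtU s u -> d i u = 0.
Proof.
move=> his hu; apply: cf_inj => t; rewrite cf_der cf0 hu //.
by apply: contra his => /perm_mem <-; rewrite mem_rcons mem_head.
Qed.

Lemma wtU_intro s u : (s != [::] -> cf u [::] = 0) -> (s = [::] -> forall i, d i u = 0) ->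
  (forall i, i \notin s -> d i u = 0) ->
  (forall i t, perm_eq (i :: t) s -> wtU t (d i u)) -> wtU s u.
Proof.
move=> h0 h1 h2 h3 t; case/lastP: t => [|t i] ht.
  by apply: h0; apply: contra ht => /eqP ->.
rewrite -cf_der; case: (boolP (i \in s)) => his; last by rewrite h2 // cf0.
apply: (h3 i (rem i s)); first by rewrite perm_sym perm_to_rem.
by apply: contra ht; rewrite perm_rcons (permPr (perm_to_rem his)) perm_cons.
Qed.

Lemma wtU_genM i s u : wtU s u -> wtU (i :: s) (e i * u).
Proof.
elim: {s}(size s) {-2}s (leqnn (size s)) u => [|k IH] s hs u hu; apply: wtU_intro => //;
  try by move=> _; apply: cf_gen_mul_nil.
- move=> j; rewrite inE negb_or => /andP[ji js].
  by rewrite der_genM (negPf ji) scale0r add0r (wtU_der_notin js hu) mulr0 scaler0.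
- move=> j t ht; rewrite der_genM; apply: wtUD.
    have [ji|_] := eqVneq j i; last by rewrite scale0r; apply: wtU0.
    by rewrite scale1r; apply: wtU_perm hu; rewrite ji perm_cons perm_sym in ht.
  case: (boolP (j \in s)) => js; last first.
    by rewrite (wtU_der_notin js hu) mulr0 scaler0; apply: wtU0.
  by case: s hs js {hu ht}.
- move=> j; rewrite inE negb_or => /andP[ji js].
  by rewrite der_genM (negPf ji) scale0r add0r (wtU_der_notin js hu) mulr0 scaler0.
move=> j t ht; rewrite der_genM; apply: wtUD.
  have [ji|_] := eqVneq j i; last by rewrite scale0r; apply: wtU0.
  by rewrite scale1r; apply: wtU_perm hu; rewrite ji perm_cons perm_sym in ht.
apply: wtUZ.
case: (boolP (j \in s)) => js; last first.
  by rewrite (wtU_der_notin js hu) mulr0; apply: wtU0.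
have hr := perm_to_rem js.
apply: (@wtU_perm (i :: rem j s)); last first.
  apply: IH; first by rewrite size_rem //; case: (s) hs js.
  by apply: wtU_der; apply: wtU_perm hu.
rewrite -(perm_cons j) perm_sym; apply: (perm_trans ht).
by rewrite (perm_trans (y := i :: j :: rem j s)) ?perm_cons //; apply/permP => p /=; rewrite addnCA.
Qed.

Lemma wtU_mon s : wtU s (mon s).
Proof.
by elim: s => [|i s IH]; rewrite ?mon_nil ?mon_cons; [apply: wtU1 | apply: wtU_genM].
Qed.

Lemma wt_perm s t : (wt s == wt t) = perm_eq s t.
Proof.
apply/eqP/idP => [h|h].
  by apply/allP => i _ /=; have := congr1 (fun w : weight n.+1 => w i) h; rewrite !ffunE => ->.
by apply/ffunP => i; rewrite !ffunE; apply/permP.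
Qed.

(** Only the words of weight [s] are kept in a representative of [u]. The discarded part involves
    other weights only, yet it equals [u] minus an element of weight [s], so all its coefficients
    vanish. *)
Lemma wtU_homogU s u : wtU s u -> homogU e (wt s) u.
Proof.
move=> hu; have [f hf] := gen_span u.
pose g : freeAlg n.+1 := \sum_(t <- msupp f | perm_eq (t : seq _) s) f@_t *: wd t.
have hg : lext mon g = \sum_(t <- msupp f | perm_eq (t : seq _) s) f@_t *: mon t.
  by rewrite /g (linear_sum (lext mon)); apply: eq_bigr => t _; exact: lext_Zwd.
exists g; split.
  move=> t; rewrite /g coefw_sum => h; apply/eqP; rewrite wt_perm.
  apply: contraNT h => h; rewrite big1 // => w hw; rewrite coefwZ coefw_wd.
  by case: ((w : seq _) =P t) hw h => [-> -> //|_ _ _]; rewrite mulr0.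
rewrite evalE hg hf /lext (bigID (fun t : {fmonom 'I_n.+1} => perm_eq (t : seq _) s)) /=.
rewrite -[RHS]addr0; congr (_ + _).
set w := \sum_(_ <- _ | ~~ _) _; have ew : w = u - lext mon g.
  by rewrite hg hf /lext (bigID (fun t : {fmonom 'I_n.+1} => perm_eq (t : seq _) s)) /= addrC addrK.
apply: cf_inj => t; rewrite cf0.
case: (boolP (perm_eq t s)) => ht; last first.
  rewrite ew cfB hu // hg sub0r; apply/eqP; rewrite oppr_eq0; apply/eqP.
  rewrite -[t]revK -K_mon Ksuml big1 // => a ha.
  rewrite KZl K_mon revK wtU_mon ?mulr0 //.
  by rewrite (permPr ha).
rewrite -[t]revK -K_mon /w Ksuml big1 // => a ha.
rewrite KZl K_mon revK wtU_mon ?mulr0 //.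
by apply: contra ha => h; rewrite -(permPr ht) perm_sym.
Qed.

Lemma der_wtM i s u v : wtU s u ->
  d i (u * v) = d i u * v + q ^ (- \sum_(j <- s) sform ty i j) *: (u * d i v).
Proof. by move=> hu; rewrite (der_mul i v (wtU_homogU hu)) wform_wts. Qed.

Lemma der_Mgen i j s u : wtU s u ->
  d i (u * e j) = d i u * e j + (i == j)%:R *: (q ^ (- \sum_(k <- s) sform ty i k) *: u).
Proof.
move=> hu; rewrite (der_wtM i _ hu) der_gen; congr (_ + _).
by case: (i == j); rewrite ?mulr1 ?scale1r // mulr0 scaler0 scale0r.
Qed.

End Basics.

(** * Quantum integers *)

Section FieldIdentities.
Variables (F : fieldType) (x : F).
Hypothesis x0 : x != 0.

Lemma field_subV : x - x^-1 = - (x^-1 * (1 - x ^+ 2)).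
Proof. by field; exact: x0. Qed.

Lemma field_sqrV : (x + x^-1) * (x - x^-1) = x ^+ 2 - x ^- 2.
Proof. by field; exact: x0. Qed.

Lemma field_qint k : x - x^-1 != 0 ->
  1 + x ^- 2 * (x^-1 ^+ k * ((x ^+ k.+1 - x ^- k.+1) / (x - x^-1))) =
  x^-1 ^+ k.+1 * ((x ^+ k.+2 - x ^- k.+2) / (x - x^-1)).
Proof.
move=> h; have y0 : x ^+ k != 0 by rewrite expf_neq0.
have h' : x ^+ 2 - 1 != 0.
  have e : x - x^-1 = x^-1 * (x ^+ 2 - 1) by field; exact: x0.
  by move: h; rewrite e mulf_eq0 negb_or => /andP[].
rewrite !exprVn !exprS; move: (x ^+ k) y0 => z z0.
by field; rewrite x0 z0 -expr2 h'.
Qed.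

End FieldIdentities.

Section QuantumIntegers.
Variable ty : classical_type.

Lemma dsymE i : dsym ty i = 1 \/ dsym ty i = 2.
Proof.
by rewrite /dsym /sform; case: ty; rewrite eqxx; [left | case: eqP; [left | right]
  | case: eqP; [right | left] | left].
Qed.

Lemma sform_diag i : sform ty i i = dsym ty i *+ 2.
Proof. by rewrite /dsym /sform; case: ty; rewrite eqxx //; case: eqP. Qed.

Lemma qiE i : exists2 m, (0 < m)%N & qi ty i = q ^+ m.
Proof. by rewrite /qi; case: (dsymE i) => ->; [exists 1%N | exists 2%N]. Qed.

Lemma qi_neq0 i : qi ty i != 0.
Proof. by have [m _ ->] := qiE i; apply: expf_neq0 q_neq0. Qed.

Lemma onesub_qiX_neq0 i k : 1 - qi ty i ^+ k.+1 != 0.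
Proof.
have [m m0 ->] := qiE i; rewrite -exprM; apply: onesubqX_neq0.
by rewrite muln_gt0 m0.
Qed.

Lemma qi_sub_neq0 i k : qi ty i ^+ k.+1 - qi ty i ^- k.+1 != 0.
Proof.
rewrite field_subV; last exact: expf_neq0 (qi_neq0 i).
rewrite -exprM oppr_eq0; apply: mulf_neq0; last exact: onesub_qiX_neq0.
by rewrite invr_eq0; exact: expf_neq0 (qi_neq0 i).
Qed.

Lemma qint_neq0 i k : qint ty i k.+1 != 0.
Proof.
rewrite /qint; apply: mulf_neq0; first exact: qi_sub_neq0.
by have := qi_sub_neq0 i 0; rewrite !expr1 invr_eq0.
Qed.

Lemma qint1 i : qint ty i 1 = 1.
Proof. by rewrite /qint !expr1; apply: divff; have := qi_sub_neq0 i 0; rewrite !expr1. Qed.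

Lemma qint2 i : qint ty i 2 = qi ty i + (qi ty i)^-1.
Proof.
have h := qi_sub_neq0 i 0; rewrite !expr1 in h.
by apply: (mulIf h); rewrite /qint (divfK h) (field_sqrV (qi_neq0 i)).
Qed.

Lemma qfact0 i : qfact ty i 0 = 1.
Proof. by rewrite /qfact big_geq. Qed.

Lemma qfactS i k : qfact ty i k.+1 = qfact ty i k * qint ty i k.+1.
Proof. by rewrite /qfact big_nat_recr. Qed.

Lemma qfact1 i : qfact ty i 1 = 1.
Proof. by rewrite qfactS qfact0 qint1 mulr1. Qed.

Lemma qfact2 i : qfact ty i 2 = qint ty i 2.
Proof. by rewrite qfactS qfact1 mul1r. Qed.

Lemma qi_diag i : q ^ (- sform ty i i) = qi ty i ^- 2.
Proof. rewrite sform_diag /qi exprnN exprz_exp; congr (q ^ _).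
by rewrite mulrN -mulr_natr natz. Qed.

Lemma qint_rec i k :
  1 + qi ty i ^- 2 * ((qi ty i)^-1 ^+ k * qint ty i k.+1) = (qi ty i)^-1 ^+ k.+1 * qint ty i k.+2.
Proof.
have h := qi_sub_neq0 i 0; rewrite !expr1 in h.
exact: field_qint (qi_neq0 i) k h.
Qed.

End QuantumIntegers.

(** * Serre relations for generators and for derivations *)

Section Serre.
Variables (ty : classical_type) (n : nat) (S : qsetup ty n).
Local Notation e := (@gen _ _ S).
Local Notation d := (@der _ _ S).
Local Notation K := (@form _ _ S).
Implicit Types (u v x y : S) (s t : seq 'I_n.+1) (i j : 'I_n.+1).

Lemma evalX f k : eval e (f ^+ k) = eval e f ^+ k.
Proof.
elim: k => [|k IH]; first by rewrite !expr0 -wd1 eval_wd mon_nil.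
by rewrite !exprS evalM IH.
Qed.

Lemma eval_gen i : eval e (wd [:: i]) = e i.
Proof. by rewrite eval_wd /mon big_seq1. Qed.

Lemma eval_divpow i k : eval e (divpow ty i (wd [:: i]) k) = divpow ty i (e i) k.
Proof. by rewrite /divpow evalZ evalX eval_gen. Qed.

Lemma serreU i j (m := `|1 - cartan ty i j|%N) : i != j ->
  \sum_(k < m.+1) (-1) ^+ k *: (divpow ty i (e i) (m - k) * e j * divpow ty i (e i) k) = 0.
Proof.
move=> ij; have : eval e (serre ty i j) = 0.
  have [_ h] := gen_ok S; apply/h.
  have := serre_idealD 1 1 ij (serre_ideal0 ty n.+1).
  by rewrite mul1r mulr1 addr0.
rewrite /serre eval_sum => h; rewrite -{}[RHS]h; apply: eq_bigr => k _.
rewrite evalZ; congr (_ *: _); symmetry.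
rewrite [LHS]evalM [X in X * _]evalM.
by rewrite [X in X * _ * _]eval_divpow [X in _ * X * _]eval_gen [X in _ * X]eval_divpow.
Qed.

Lemma divpow0 i (x : S) : divpow ty i x 0 = 1.
Proof. by rewrite /divpow qfact0 invr1 scale1r expr0. Qed.

Lemma divpow1 i (x : S) : divpow ty i x 1 = x.
Proof. by rewrite /divpow qfact1 invr1 scale1r expr1. Qed.

Lemma divpow2 i (x : S) : divpow ty i x 2 = (qint ty i 2)^-1 *: (x * x).
Proof. by rewrite /divpow qfact2 expr2. Qed.

Lemma serreU0 i j : i != j -> cartan ty i j = 0 -> e i * e j = e j * e i.
Proof.
move=> ij c; have := serreU ij; rewrite c /= !big_ord_recl big_ord0 /= addr0.
rewrite !divpow0 !divpow1 expr0 expr1 scale1r scaleN1r mulr1 mul1r => /eqP.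
by rewrite subr_eq0 => /eqP.
Qed.

Lemma serreU1 i j : i != j -> cartan ty i j = -1 ->
  e i * e i * e j + e j * e i * e i = qint ty i 2 *: (e i * e j * e i).
Proof.
move=> ij c; have := serreU ij; rewrite c /= !big_ord_recl big_ord0 /= addr0.
rewrite !divpow0 !divpow1 !divpow2 expr0 expr1 expr2 mulrNN mul1r !scale1r scaleN1r mulr1 mul1r.
move=> h; have := congr1 ( *:%R (qint ty i 2)) h.
rewrite scaler0 !scalerDr -!scalerAl -scalerAr !scalerA (divff (qint_neq0 ty i 1)) !scale1r scalerN.
rewrite mulr1 (divff (qint_neq0 ty i 1)) scale1r addrCA addrC => /eqP.
by rewrite subr_eq0 mulrA => /eqP.
Qed.

Lemma serreD0 i j u : i != j -> cartan ty i j = 0 -> d i (d j u) = d j (d i u).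
Proof.
move=> ij c; apply/eqP; rewrite -subr_eq0; apply/eqP/K_nondeg => v.
by rewrite KBl !K_der !mulrA (serreU0 ij c) subrr.
Qed.

(** Under the form e_i' is the transpose of left multiplication by e_i, so nondegeneracy turns a
    relation between generators into the reversed relation between derivations; the cubic relation
    is its own reverse. *)
Lemma serreD1 i j u : i != j -> cartan ty i j = -1 ->
  d i (d i (d j u)) + d j (d i (d i u)) = qint ty i 2 *: d i (d j (d i u)).
Proof.
move=> ij c; apply/eqP; rewrite -subr_eq0; apply/eqP/K_nondeg => v.
rewrite KBl KDl KZl !K_der !mulrA -KDr -mulrDl addrC -KZr scalerAl -(serreU1 ij c).
by rewrite [e j * e i * e i + _]addrC addNr.
Qed.

Lemma der_divpow i k x : d i x = 0 ->
  d i (divpow ty i (e i) k.+1 * x) = (qi ty i)^-1 ^+ k *: (divpow ty i (e i) k * x).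
Proof.
move=> dx.
have main m : d i (e i ^+ m.+1 * x) = ((qi ty i)^-1 ^+ m * qint ty i m.+1) *: (e i ^+ m * x).
  elim: m => [|m IH].
    by rewrite expr1 !expr0 qint1 mulr1 der_genM eqxx dx mulr0 scaler0 addr0 mul1r.
  rewrite exprS -mulrA der_genM eqxx IH qi_diag -scalerAr scalerA (mulrA (e i)) -exprS.
  by rewrite scale1r -[X in X + _]scale1r -scalerDl qint_rec.
rewrite /divpow -!scalerAl linearZ_LR main !scalerA; congr (_ *: _).
rewrite qfactS invfM [RHS]mulrC -!mulrA; congr (_ * _).
by rewrite mulrCA (mulVf (qint_neq0 ty i k)) mulr1.
Qed.

(** * Kashiwara operators *)

(** The decomposition of [u] into i-strings. Requiring [x] to vanish from [k] on allows
    decompositions of different lengths to be added. *)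
Definition decomp i u (k : nat) (x : nat -> S) : Prop :=
  [/\ forall m, d i (x m) = 0, forall m, (k <= m)%N -> x m = 0 &
      u = \sum_(m < k) divpow ty i (e i) m * x m].

Lemma decomp_widen i u k l (x : nat -> S) : (k <= l)%N -> decomp i u k x -> decomp i u l x.
Proof.
move=> kl [h1 h2 h3]; split=> // [m lm|]; first by apply: h2; apply: leq_trans lm.
rewrite h3 -(big_mkord xpredT (fun m => divpow ty i (e i) m * x m)).
rewrite -(big_mkord xpredT (fun m => divpow ty i (e i) m * x m)) [RHS](big_cat_nat (n := k)) //=.
rewrite [X in _ + X]big_nat_cond [X in _ + X]big1 ?addr0 // => m /andP[/andP[km _] _].
by rewrite h2 // mulr0.
Qed.

Lemma decompD i c u u' k k' (x x' : nat -> S) : decomp i u k x -> decomp i u' k' x' ->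
  decomp i (c *: u + u') (maxn k k') (fun m => c *: x m + x' m).
Proof.
move=> /(decomp_widen (leq_maxl k k')) [h1 h2 h3] /(decomp_widen (leq_maxr k k')) [g1 g2 g3].
split=> [m|m hm|]; first by rewrite linearP h1 g1 scaler0 addr0.
  by rewrite h2 // g2 // scaler0 addr0.
rewrite h3 g3 scaler_sumr -big_split /=; apply: eq_bigr => m _.
by rewrite mulrDr scalerAr.
Qed.

Lemma iter_lin i k c u v : iter k (d i) (c *: u + v) = c *: iter k (d i) u + iter k (d i) v.
Proof. by elim: k => //= k ->; rewrite linearP. Qed.

Lemma iter0 i k : iter k (d i) 0 = 0.
Proof. by elim: k => //= k ->; rewrite linear0. Qed.

Lemma cf_iter i k u s : cf (iter k (d i) u) s = cf u (s ++ nseq k i).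
Proof.
elim: k s => [|k IH] s /=; first by rewrite cats0.
by rewrite cf_der IH -cats1 -catA.
Qed.

Lemma der_nilpotent i u : exists k, iter k (d i) u = 0.
Proof.
have [f ->] := gen_span u; rewrite /lext.
elim/big_ind: _ => [|x y [k hk] [l hl]|s _]; first by exists 0%N.
  exists (k + l)%N; rewrite -[x]scale1r iter_lin [iter _ _ y]iterD hl iter0 addnC iterD hk iter0.
  by rewrite scaler0 addr0.
exists (size s).+1; apply: cf_inj => t; rewrite cf_iter cfZ cf0 (wtU_mon S) ?mulr0 //.
apply/negP => /perm_size; rewrite size_cat size_nseq => h.
have : (size (s : seq 'I_n.+1) < size (s : seq 'I_n.+1))%N by rewrite -[X in (_ < X)%N]h leq_addl.
by rewrite ltnn.
Qed.

Lemma iter_der_divpow i k x : d i x = 0 ->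
  exists2 c, c != 0 & iter k (d i) (divpow ty i (e i) k * x) = c *: x.
Proof.
move=> dx; elim: k => [|k [c c0 IH]].
  by exists 1; rewrite ?oner_neq0 //= divpow0 mul1r scale1r.
exists ((qi ty i)^-1 ^+ k * c).
  by apply: mulf_neq0 c0; apply: expf_neq0; rewrite invr_eq0; exact: qi_neq0.
rewrite iterSr der_divpow // -[X in iter _ _ X]addr0 iter_lin IH iter0 addr0.
by rewrite scalerA.
Qed.

(** Induction on the order of nilpotency of e_i' on [u]: the highest derivative e_i'^N u is killed
    by e_i', and subtracting a multiple of e_i^(N) times it lowers the order. *)
Lemma decomp_exists i u : exists k (x : nat -> S), decomp i u k x.
Proof.
have [N] := der_nilpotent i u; elim: N u => [|N IH] u hN.
  by exists 0%N, (fun=> 0); split; rewrite ?big_ord0 // => m; rewrite linear0.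
have dw : d i (iter N (d i) u) = 0 by [].
have [c c0 hc] := iter_der_divpow N dw.
pose t := divpow ty i (e i) N * (c^-1 *: iter N (d i) u).
have [k [x hx]] : exists k (x : nat -> S), decomp i (u - t) k x.
  apply: IH; rewrite -scaleN1r addrC iter_lin /t -scalerAr.
  rewrite -[c^-1 *: _]addr0 iter_lin hc iter0 addr0 (scalerA c^-1) (mulVf c0).
  by rewrite scale1r scaleN1r addNr.
have ht : decomp i t N.+1 (fun m => if m == N then c^-1 *: iter N (d i) u else 0).
  split=> [m|m hm|]; first by case: eqP => _; rewrite ?linear0 // linearZ_LR dw scaler0.
    by case: eqP hm => // ->; rewrite ltnn.
  rewrite big_ord_recr /= eqxx big1 ?add0r // => m _.
  by rewrite (ltn_eqF (ltn_ord m)) mulr0.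
exists (maxn N.+1 k), (fun m => 1 *: (if m == N then c^-1 *: iter N (d i) u else 0) + x m).
by have := decompD 1 ht hx; rewrite scale1r addrCA subrr addr0.
Qed.

(** Applying e_i' shifts the decomposition by one step, up to nonzero scalars. By induction all
    [x m.+1] vanish, and then [x 0] is the whole sum. *)
Lemma decomp0 i k (x : nat -> S) : decomp i 0 k x -> forall m, x m = 0.
Proof.
elim: k x => [|k IH] x [h1 h2 h3] m; first exact: h2.
have hS : forall m, x m.+1 = 0.
  move=> l; have /(IH _) h : decomp i 0 k (fun m => (qi ty i)^-1 ^+ m *: x m.+1).
    split=> [p|p hp|]; first by rewrite linearZ_LR h1 scaler0.
      by rewrite h2 ?scaler0.
    have := congr1 (d i) h3; rewrite linear0 big_ord_recl linearD linear_sum.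
    rewrite divpow0 mul1r h1 add0r => h; apply: (etrans h); apply: eq_bigr => p _.
    by rewrite lift0 der_divpow // scalerAr.
  have := h l => /eqP; rewrite scaler_eq0 => /orP[/eqP h0|/eqP //].
  have := expf_neq0 l (qi_neq0 ty i); rewrite -invr_eq0 -exprVn h0 eqxx => //.
case: m => // ; move: h3; rewrite big_ord_recl divpow0 mul1r big1 ?addr0 // => p _.
by rewrite hS mulr0.
Qed.

Definition fsum i k (x : nat -> S) : S := \sum_(m < k) divpow ty i (e i) m.+1 * x m.

Lemma decomp_ftilde i u k (x : nat -> S) : decomp i u k x -> ftilde ty e d i u (fsum i k x).
Proof. by move=> [h1 h2 h3]; exists k, x. Qed.

Lemma ftilde_decomp i u v : ftilde ty e d i u v ->
  exists k (x : nat -> S), decomp i u k x /\ v = fsum i k x.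
Proof.
move=> [k [x [h1 h2 h3]]]; exists k, (fun m => if (m < k)%N then x m else 0).
split; first split=> [m|m hm|].
- by case: ifP => _; rewrite ?linear0.
- by rewrite ltnNge hm.
- by rewrite h2; apply: eq_bigr => m _; rewrite ltn_ord.
by rewrite h3; apply: eq_bigr => m _; rewrite ltn_ord.
Qed.

Lemma ftilde_total i u : exists v, ftilde ty e d i u v.
Proof. by have [k [x /decomp_ftilde h]] := decomp_exists i u; exists (fsum i k x). Qed.

Lemma fsum_widen i u k l (x : nat -> S) : (k <= l)%N -> decomp i u k x -> fsum i k x = fsum i l x.
Proof.
move=> kl [_ h2 _]; rewrite /fsum -(big_mkord xpredT (fun m => divpow ty i (e i) m.+1 * x m)).
rewrite -(big_mkord xpredT (fun m => divpow ty i (e i) m.+1 * x m)) [RHS](big_cat_nat (n := k)) //=.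
rewrite [X in _ + X]big_nat_cond [X in _ + X]big1 ?addr0 // => m /andP[/andP[km _] _].
by rewrite h2 // mulr0.
Qed.

Lemma ftilde_lin i c u u' v v' : ftilde ty e d i u v -> ftilde ty e d i u' v' ->
  ftilde ty e d i (c *: u + u') (c *: v + v').
Proof.
move=> /ftilde_decomp [k [x [hx ->]]] /ftilde_decomp [k' [x' [hx' ->]]].
have := decomp_ftilde (decompD c hx hx').
rewrite (fsum_widen (leq_maxl k k') hx) (fsum_widen (leq_maxr k k') hx').
congr ftilde; rewrite /fsum scaler_sumr -big_split /=; apply: eq_bigr => m _.
by rewrite mulrDr scalerAr.
Qed.

Lemma ftilde0 i v : ftilde ty e d i 0 v -> v = 0.
Proof.
move=> /ftilde_decomp [k [x [hx ->]]].
by apply: big1 => m _; rewrite (decomp0 hx) mulr0.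
Qed.

Lemma ftilde_fun i u v v' : ftilde ty e d i u v -> ftilde ty e d i u v' -> v = v'.
Proof.
move=> h h'; have := ftilde_lin (-1) h h'.
by rewrite !scaleN1r addNr => /ftilde0 /eqP; rewrite addrC subr_eq0 => /eqP.
Qed.

Lemma ftilde_gen i x : d i x = 0 -> ftilde ty e d i x (e i * x).
Proof.
move=> dx; exists 1%N, (fun=> x).
by split; rewrite ?big_ord_recl ?big_ord0 ?divpow0 ?divpow1 ?mul1r ?addr0.
Qed.

Lemma ftilde_gen2 i x : d i x = 0 ->
  ftilde ty e d i (e i * x) (divpow ty i (e i) 2 * x).
Proof.
move=> dx; exists 2%N, (fun m => if m is 1%N then x else 0); split.
- by case=> [|[|m]]; rewrite ?linear0.
- by rewrite !big_ord_recl big_ord0 /= mulr0 add0r addr0 divpow1.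
by rewrite !big_ord_recl big_ord0 /= mulr0 add0r addr0.
Qed.

(** * The adjoint of a Kashiwara operator *)

Lemma K_iter i k u v : K (iter k (d i) u) v = K u (e i ^+ k * v).
Proof.
elim: k v => [|k IH] v; first by rewrite expr0 mul1r.
by rewrite /= K_der IH mulrA -exprSr.
Qed.

Lemma K_divpow i k u v :
  K u (divpow ty i (e i) k * v) = (qfact ty i k)^-1 * K (iter k (d i) u) v.
Proof. by rewrite /divpow -scalerAl KZr K_iter. Qed.

(** As e_i'^3 u = 0, only [x 0] and [x 1] contribute. The term of [x 1] carries 1 / [2]_i in
    [K u w], from the divided square, but 1 in [K (d i u) v]; the pairing of [e i * d i (d i u)]
    with [v] isolates this term and gives the correction. *)
Lemma K_ftilde i u v w : d i (d i (d i u)) = 0 -> ftilde ty e d i v w ->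
  K u w = K (d i u) v - (1 - (qint ty i 2)^-1) * K (e i * d i (d i u)) v.
Proof.
move=> d3 /ftilde_decomp [k [x [hx ->]]].
(* Length at least 2 makes the terms [x 0] and [x 1] appear explicitly. *)
have [h1 _ hv] := decomp_widen (leq_addl 2 k) hx.
rewrite (fsum_widen (leq_addl 2 k) hx).
have it3 m : iter m.+3 (d i) u = 0 by rewrite -addn3 iterD /= d3 iter0.
have e1 : K u (fsum i (2 + k) x) = K (d i u) (x 0%N) + (qint ty i 2)^-1 * K (d i (d i u)) (x 1%N).
  rewrite /fsum Ksumr !big_ord_recl big1 => [|m _]; last by rewrite K_divpow it3 K0l mulr0.
  by rewrite addr0 !K_divpow /= qfact1 qfact2 invr1 mul1r.
have e2 : K (d i u) v = K (d i u) (x 0%N) + K (d i (d i u)) (x 1%N).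
  rewrite hv Ksumr !big_ord_recl big1 => [|m _].
    by rewrite addr0 !K_divpow /= qfact0 qfact1 invr1 !mul1r.
  by rewrite K_divpow -iterSr it3 K0l mulr0.
have e3 : K (e i * d i (d i u)) v = K (d i (d i u)) (x 1%N).
  rewrite KC -K_der KC hv linear_sum Ksumr !big_ord_recl big1 => [|m _].
    by rewrite /= divpow0 mul1r h1 K0r add0r addr0 der_divpow // expr0 scale1r divpow0 mul1r.
  by rewrite der_divpow // KZr K_divpow -!iterSr it3 K0l !mulr0.
by rewrite e1 e2 e3 mulrBl mul1r opprB addrA addrAC addrK.
Qed.

End Serre.

(** * The crystal lattice *)

Section Lattice.
Variables (ty : classical_type) (n : nat) (S : qsetup ty n).
Local Notation e := (@gen _ _ S).
Local Notation d := (@der _ _ S).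
Local Notation K := (@form _ _ S).
Local Notation bar := (@bar _ _ S).
Local Notation G := (@cbasis _ _ S).
Local Notation L := (latticeL ty e d).
Local Notation crystal := (crystal_elt ty e d).
Local Notation ft := (ftilde ty e d).
Implicit Types (u v x y C : S) (s t : seq 'I_n.+1) (i j : 'I_n.+1).

Lemma latticeD u v : L u -> L v -> L (u + v).
Proof.
move=> hu hv; elim: hu => [|c b w rc hb hw IH]; first by rewrite add0r.
by rewrite -addrA; apply: latticeLD.
Qed.

Lemma latticeZ c u : regular0 c -> L u -> L (c *: u).
Proof.
move=> rc; elim=> [|c' b w rc' hb hw IH]; first by rewrite scaler0; apply: latticeL0.
by rewrite scalerDr scalerA; apply: latticeLD => //; apply: regM.
Qed.

Lemma lattice_crystal b : crystal b -> L b.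
Proof.
move=> hb; rewrite -[b]scale1r -[1 *: b]addr0.
by apply: latticeLD => //; [apply: reg1 | apply: latticeL0].
Qed.

Lemma latticeN u : L u -> L (- u).
Proof.
move=> hu; rewrite -scaleN1r; apply: latticeZ => //.
by rewrite -(rmorph1 Qinj) -rmorphN; apply: regQ.
Qed.

Lemma latticeB u v : L u -> L v -> L (u - v).
Proof. by move=> hu hv; apply: latticeD => //; apply: latticeN. Qed.

Lemma lattice_ft i u v : L u -> ft i u v -> L v.
Proof.
move=> hu; elim: hu v => [|c b w rc hb hw IH] v.
  by move/ftilde0 => ->; apply: latticeL0.
have [fb hfb] := ftilde_total i b; have [fw hfw] := ftilde_total i w.
move=> /(ftilde_fun (ftilde_lin c hfb hfw)) <-.
by apply: latticeLD => //; [apply: crystalS hfb | apply: IH].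
Qed.

Definition qL u : Prop := exists2 l, L l & u = q *: l.

Lemma qL0 : qL 0.
Proof. by exists 0; [apply: latticeL0 | rewrite scaler0]. Qed.

Lemma qLD u v : qL u -> qL v -> qL (u + v).
Proof.
by move=> [l hl ->] [l' hl' ->]; exists (l + l'); [apply: latticeD | rewrite scalerDr].
Qed.

Lemma qLN u : qL u -> qL (- u).
Proof. by move=> [l hl ->]; exists (- l); [apply: latticeN | rewrite scalerN]. Qed.

Lemma qLB u v : qL u -> qL v -> qL (u - v).
Proof. by move=> hu hv; apply: qLD => //; apply: qLN. Qed.

Lemma qL_small c u : small c -> L u -> qL (c *: u).
Proof.
by move=> [c' rc ->] hu; exists (c' *: u); [apply: latticeZ | rewrite scalerA].
Qed.

Lemma qL_ft i u v : qL u -> ft i u v -> qL v.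
Proof.
move=> [l hl ->] h; have [fl hfl] := ftilde_total i l.
exists fl; first exact: lattice_ft hfl.
apply: (ftilde_fun h); have [f0 hf0] := ftilde_total i (0 : S).
have := ftilde_lin q hfl hf0; by rewrite (ftilde0 hf0) !addr0.
Qed.

(** * The dual lattice *)

Definition dreg u := forall c, crystal c -> regular0 (K u c).
Definition dsmall u := forall c, crystal c -> small (K u c).

Lemma dreg_lattice u l : dreg u -> L l -> regular0 (K u l).
Proof.
move=> hu; elim=> [|c b w rc hb hw IH]; first by rewrite K0r; apply: reg0.
by rewrite KDr KZr; apply: regD => //; apply: regM => //; apply: hu.
Qed.

Lemma dsmallZ c u : small c -> dreg u -> dsmall (c *: u).
Proof. by move=> hc hu b hb; rewrite KZl; apply: smallMr => //; apply: hu. Qed.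

Lemma dsmallD u v : dsmall u -> dsmall v -> dsmall (u + v).
Proof. by move=> hu hv b hb; rewrite KDl; apply: smallD; [apply: hu | apply: hv]. Qed.

Lemma dsmall0 : dsmall 0.
Proof. by move=> b hb; rewrite K0l; apply: small0. Qed.

Definition adj i u : S := d i u - (1 - (qint ty i 2)^-1) *: (e i * d i (d i u)).

Lemma K_adj i u v w : d i (d i (d i u)) = 0 -> ft i v w -> K u w = K (adj i u) v.
Proof. by move=> d3 h; rewrite (K_ftilde d3 h) /adj KBl KZl. Qed.

Lemma adj0 i u : d i u = 0 -> adj i u = 0.
Proof. by move=> h; rewrite /adj h linear0 mulr0 scaler0 subr0. Qed.

Lemma adj1 i u : d i (d i u) = 0 -> adj i u = d i u.
Proof. by move=> h; rewrite /adj h mulr0 scaler0 subr0. Qed.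

(** Modulo q, [u] acts on the crystal as the coordinate function of the class of [C]. *)
Definition nice u C := forall c, crystal c ->
  small (K u c) \/ small (K u c - 1) /\ qL (c - C).

Lemma nice_dreg u C : nice u C -> dreg u.
Proof.
move=> hu c /hu [|[h _]]; first exact: small_reg.
by rewrite -[K u c](subrK 1); apply: regD; [apply: small_reg | apply: reg1].
Qed.

Lemma nice1 : nice 1 1.
Proof.
move=> c [|i u v hu h].
  right; rewrite K1 cf1 eqxx !subrr; split; [exact: small0 | exact: qL0].
have d3 : d i (d i (d i (1 : S))) = 0 by rewrite der1 !linear0.
by left; rewrite (K_adj d3 h) adj0 ?der1 // K0l; apply: small0.
Qed.

(** A crystal element other than 1 is f_i of a shorter one, and the adjoint of f_i moves the pairing
    to [adj i u]. This is small, or agrees with [u'] up to a small vector; in the latter case f_i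
    preserves q L(oo) and carries the class of [C'] to that of [C]. *)
Lemma nice_step u C : cf u [::] = 0 -> (forall i, d i (d i (d i u)) = 0) ->
  (forall i, dsmall (adj i u) \/
     exists u' C' C'', [/\ dsmall (adj i u - u'), nice u' C', ft i C' C'' & qL (C'' - C)]) ->
  nice u C.
Proof.
move=> h0 h3 hi c [|i v w hv h].
  by left; rewrite K1 h0; apply: small0.
rewrite (K_adj (h3 i) h); case: (hi i) => [hs|[u' [C' [C'' [hs hn hf hC]]]]].
  by left; apply: hs.
have -> : K (adj i u) v = K (adj i u - u') v + K u' v by rewrite KBl subrK.
case: (hn v hv) => [h1|[h1 h2]]; [left | right].
  by apply: smallD => //; apply: hs.
split; first by rewrite -addrA; apply: smallD => //; apply: hs.
have -> : w - C = (w - C'') + (C'' - C) by rewrite addrA subrK.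
apply: qLD => //; apply: (qL_ft (i := i) h2).
have := ftilde_lin (-1) hf h; by rewrite !scaleN1r !(addrC (- _)).
Qed.

(** * Pairing with the integral form *)

Definition dpmon (m : seq ('I_n.+1 * nat)) : S :=
  \prod_(p <- m) divpow ty p.1 (e p.1) p.2.

Definition intdual u := forall m, laurent (K u (dpmon m)).

Lemma dpmon_cons i k m : dpmon ((i, k) :: m) = divpow ty i (e i) k * dpmon m.
Proof. by rewrite /dpmon big_cons. Qed.

Lemma intdualZ c u : laurent c -> intdual u -> intdual (c *: u).
Proof. by move=> hc hu m; rewrite KZl; apply: laurentM. Qed.

Lemma intdualD u v : intdual u -> intdual v -> intdual (u + v).
Proof. by move=> hu hv m; rewrite KDl; apply: laurentD. Qed.

Lemma intdual0 : intdual 0.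
Proof. by move=> m; rewrite K0l; apply: laurent0. Qed.

(** The induction on integrality runs over adjoints of left multiplications, because these compose
    along products while values of the pairing do not. *)
Lemma integral_adjoint x : integral ty e x -> forall u, intdual u ->
  exists2 u', intdual u' & forall y, K u (x * y) = K u' y.
Proof.
elim=> {x} [c hc|i k|x y _ IHx _ IHy|x y _ IHx _ IHy] u hu.
- by exists (c *: u); [apply: intdualZ | move=> y; rewrite -scalerAl mul1r KZl KZr].
- exists ((qfact ty i k)^-1 *: iter k (d i) u); last by move=> y; rewrite K_divpow KZl.
  by move=> m; rewrite KZl -K_divpow -dpmon_cons; apply: hu.
- have [u1 h1 e1] := IHx u hu; have [u2 h2 e2] := IHy u hu.
  by exists (u1 + u2); [apply: intdualD | move=> z; rewrite mulrDl KDr KDl e1 e2].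
have [u1 h1 e1] := IHx u hu; have [u2 h2 e2] := IHy u1 h1.
by exists u2 => // z; rewrite -mulrA e1 e2.
Qed.

Lemma intdual_integral u x : intdual u -> integral ty e x -> laurent (K u x).
Proof.
move=> hu /integral_adjoint /(_ u hu) [u' hu' h].
by rewrite -[x]mulr1 h; have := hu' [::]; rewrite /dpmon big_nil.
Qed.

Lemma intdual_step u : laurent (cf u [::]) ->
  (forall i, [/\ d i (d i (d i u)) = 0, intdual (d i u) &
     intdual ((qint ty i 2)^-1 *: d i (d i u))]) -> intdual u.
Proof.
move=> h0 hi; elim=> [|[i k] m IH]; first by rewrite /dpmon big_nil K1.
have [d3 h1 h2] := hi i.
rewrite dpmon_cons K_divpow; case: k => [|[|[|k]]].
- by rewrite qfact0 invr1 mul1r.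
- by rewrite qfact1 invr1 mul1r; apply: h1.
- by rewrite qfact2 -KZl; apply: h2.
by rewrite -addn3 iterD /= d3 iter0 K0l mulr0; apply: laurent0.
Qed.

(** * The bar involution *)

(** Only additivity, multiplicativity and semilinearity in q are given for [bar]. Rational scalars
    are reached by clearing the denominator, additive maps being compatible with integer
    multiples. *)
Lemma barQ a x : bar (Qinj a *: x) = Qinj a *: bar x.
Proof.
have h (y : S) : (denq a)%:~R *: (Qinj a *: y) = y *~ numq a.
  rewrite scalerA -(rmorph_int Qinj) -rmorphM mulrC -numqE rmorph_int.
  by rewrite scaler_int.
have D0 : ((denq a)%:~R : Qq) != 0.
  have := denq_neq0 a; rewrite -(intr_eq0 rat) -(fmorph_eq0 Qinj) rmorph_int.
  by move=> D0; exact: D0.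
have hb : (denq a)%:~R *: bar (Qinj a *: x) = bar x *~ numq a.
  by rewrite scaler_int -raddfMz -scaler_int h raddfMz.
move: hb; rewrite -h; move: (_%:~R) D0 => D D0; exact: scalerI.
Qed.

Lemma bar_tofrac p x : bar (tofrac p *: x) = evinv p *: bar x.
Proof.
have [hq _] := bar_ok S.
elim/poly_ind: p x => [|p a IH] x.
  by rewrite tofrac0 /evinv rmorph0 horner0 !scale0r rmorph0.
rewrite evinvD evinvM evinvX evinvC tofracD tofracM -/q.
rewrite (mulrC _ q) (mulrC _ q^-1) !scalerDl rmorphD /= -!scalerA hq IH.
by congr (_ + _); exact: barQ.
Qed.

Lemma barZ c x : bar (c *: x) = conjq c *: bar x.
Proof.
have [p [r [r0 ->]]] := fracP c; rewrite (conjqE _ r0).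
have R0 := evinv_neq0 r0; have T0 := tofrac_neq0 r0.
apply: (scalerI R0); rewrite -bar_tofrac !scalerA mulrC (divfK T0).
by rewrite [evinv r * _]mulrC (divfK R0) bar_tofrac.
Qed.

Lemma bar_mon s : bar (mon S s) = mon S s.
Proof.
by rewrite /mon rmorph_prod; apply: eq_bigr => i _; have [_ ->] := bar_ok S.
Qed.

Lemma bar_lext f : bar (lext (mon S) f) = \sum_(s <- msupp f) conjq f@_s *: mon S s.
Proof. by rewrite /lext rmorph_sum; apply: eq_bigr => s _; rewrite barZ bar_mon. Qed.

Definition barinv u := forall s, conjq (cf u s) = cf u s.

Lemma K_bar u x : barinv u -> K u (bar x) = conjq (K u x).
Proof.
move=> hu; have [f ->] := gen_span x.
rewrite bar_lext /lext !Ksumr conjq_sum; apply: eq_bigr => s _.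
by rewrite !KZr conjqM K_mon hu.
Qed.

Lemma barinv_step u : conjq (cf u [::]) = cf u [::] -> (forall i, barinv (d i u)) -> barinv u.
Proof. by move=> h0 hi s; case/lastP: s => // s i; rewrite -cf_der hi. Qed.

Lemma barinvZ c u : conjq c = c -> barinv u -> barinv (c *: u).
Proof. by move=> hc hu s; rewrite cfZ conjqM hc hu. Qed.

Lemma barinv0 : barinv 0.
Proof. by move=> s; rewrite cf0 conjq0. Qed.

Lemma conjq_qint2 i : conjq (qint ty i 2) = qint ty i 2.
Proof.
have h : conjq (qi ty i) = (qi ty i)^-1.
  have [m _ ->] := qiE ty i; elim: m => [|m IH]; first by rewrite expr0 invr1 conjq1.
  by rewrite exprS conjqM IH conjqq invfM.
by rewrite qint2 conjqD conjqV h invrK addrC.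
Qed.

(** * The canonical basis *)

Lemma integral_scale c x : laurent c -> integral ty e x -> integral ty e (c *: x).
Proof.
by move=> hc hx; rewrite -[x]mul1r scalerAl; apply: integralM => //; apply: integral_scalar.
Qed.

Lemma integralN x : integral ty e x -> integral ty e (- x).
Proof.
move=> hx; rewrite -scaleN1r; apply: integral_scale => //.
by rewrite -(rmorph1 Qinj) -rmorphN; apply: laurentQ.
Qed.

Lemma lower_global_add b x : lower_global ty e d bar b -> integral ty e x -> L x ->
  (exists2 l, L l & x = bar l) -> qL x -> lower_global ty e d bar (b + x).
Proof.
move=> [h1 h2 [u hu hb] [c [w [hc hw hbc]]]] i1 i2 [l hl hx] [l' hl' hx'].
split; first exact: integralD.
- exact: latticeD.
- by exists (u + l); [apply: latticeD | rewrite rmorphD -hb -hx].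
exists c, (w + l'); split=> //; first exact: latticeD.
by rewrite {1}hbc {1}hx' scalerDr addrA.
Qed.

(** A nonzero [x] would make [b], [b + x] and [b + 2 x] three linearly dependent
    members of the canonical basis. *)
Lemma lower_global_small x : integral ty e x -> L x ->
  (exists2 l, L l & x = bar l) -> qL x -> x = 0.
Proof.
move=> i1 i2 i3 i4; apply/eqP; case: (x =P 0) => // x0.
have [[span indep] gl] := cbasis_ok S.
have [b Gb] : exists b, G b.
  have [[|b s] [c [h1 h2]]] := span 1; last by exists b; apply: h1; rewrite mem_head.
  by move: h2; rewrite big_nil => /eqP; rewrite oner_eq0.
have hb : lower_global ty e d bar b by apply/gl.
have h1 := lower_global_add hb i1 i2 i3 i4; have h2 := lower_global_add h1 i1 i2 i3 i4.
have two0 : (2%:R : Qq) != 0.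
  by rewrite -(rmorph_nat Qinj) fmorph_eq0.
have x2 : x + x <> 0.
  rewrite -mulr2n -scaler_nat => /eqP; rewrite scaler_eq0 (negPf two0) /=.
  by move/eqP.
have n1 : (b == b + x) = false.
  by apply/eqP => h; apply: x0; apply: (addrI b); rewrite addr0 -h.
have n2 : (b == b + x + x) = false.
  by apply/eqP => h; apply: x2; apply: (addrI b); rewrite addr0 addrA -h.
have n3 : (b + x == b + x + x) = false.
  by apply/eqP => h; apply: x0; apply: (addrI (b + x)); rewrite addr0 -h.
pose c y : Qq := if y == b + x then - 2%:R else 1.
have cb : c b = 1 by rewrite /c n1.
have := indep [:: b; b + x; b + x + x] c _ _ _ b (mem_head _ _).
rewrite cb => h; exfalso; suff : (1 : Qq) = 0 by move/eqP; rewrite oner_eq0.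
apply: h.
- by rewrite /= !inE n1 n2 n3.
- by move=> y; rewrite !inE => /or3P[] /eqP ->; apply/gl.
rewrite !big_cons big_nil addr0 cb /c eqxx eq_sym n3 !scale1r scaleNr scaler_nat mulr2n.
by rewrite addrCA (addrCA b) addNr.
Qed.

Lemma dual_canonical_intro u C : nice u C -> intdual u -> barinv u ->
  (exists s, cf u s <> 0) -> dual_canonical G K u.
Proof.
move=> hn hi hb [s hs].
have [[span indep] gl] := cbasis_ok S.
have val b : G b -> K u b = 0 \/ K u b = 1 /\ qL (b - C).
  move=> /gl [i1 i2 [l hl bl] [c [w [hc hw hbc]]]].
  have ru := nice_dreg hn.
  have [|||a ha] := @regular_conj_const (K u b).
  - exact: intdual_integral.
  - exact: dreg_lattice.
  (* As b is the conjugate of the lattice element [l], the conjugate of K(u, b) is K(u, l), which is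
     regular. *)
  - by rewrite bl (K_bar _ hb) conjqK; apply: dreg_lattice.
  have sm : small (K u b - K u c).
    by rewrite hbc KDr addrC addKr KZr; apply: smallMr; [apply: small_q | apply: dreg_lattice].
  case: (hn c hc) => [h|[h1 h2]].
    left; have := smallD sm h; rewrite subrK ha => /small_Q ->.
    by rewrite rmorph0.
  right; split; last by rewrite hbc addrAC; apply: qLD => //; exists w.
  have := smallD sm h1; rewrite addrA subrK ha -(rmorph1 Qinj) -rmorphB => /small_Q /eqP.
  by rewrite subr_eq0 => /eqP ->.
have uniq b b' : G b -> G b' -> K u b = 1 -> K u b' = 1 -> b = b'.
  move=> Gb Gb' k k'.
  have hC : qL (b - b').
    have [h0|[_ h]] := val b Gb; first by move: k; rewrite h0 => /esym/eqP; rewrite oner_eq0.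
    have [h0|[_ h']] := val b' Gb'; first by move: k'; rewrite h0 => /esym/eqP; rewrite oner_eq0.
    by have := qLB h h'; rewrite opprB addrA subrK.
  have [i1 i2 [l hl bl] _] := (gl b).1 Gb; have [i1' i2' [l' hl' bl'] _] := (gl b').1 Gb'.
  apply/eqP; rewrite -subr_eq0; apply/eqP; apply: lower_global_small hC.
  - by apply: integralD => //; apply: integralN.
  - exact: latticeB.
  by exists (l - l'); [apply: latticeB | rewrite rmorphB -bl -bl'].
(* The nonzero coefficient at [s] is a pairing with a monomial, so some basis element in the
   expansion of that monomial pairs to a nonzero value. *)
have [b Gb kb] : exists2 b, G b & K u b = 1.
  have [t [c [ht hc]]] := span (mon S (rev s)).
  have hK : K u (mon S (rev s)) = cf u s by rewrite K_mon revK.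
  case: (boolP (has (fun b => K u b != 0) t)) => [/hasP [b bt kb]|/hasPn h].
    exists b; first exact: ht.
    have [h0|[//]] := val b (ht b bt).
    by rewrite h0 eqxx in kb.
  case: hs; rewrite -hK hc Ksumr big_seq big1 // => b bt.
  by move: (h b bt); rewrite negbK => /eqP kb; rewrite KZr kb mulr0.
exists b => // b' Gb'; case: (b =P b') => [<- //|bb'].
by have [|[kb' _]] := val b' Gb'; [|case: bb'; apply: uniq].
Qed.

End Lattice.

(** * Induction on the length for dual canonical vectors *)

Section DualVectors.
Variables (ty : classical_type) (n : nat) (S : qsetup ty n).
Local Notation e := (@gen _ _ S).
Local Notation d := (@der _ _ S).
Local Notation K := (@form _ _ S).
Local Notation bar := (@bar _ _ S).
Local Notation G := (@cbasis _ _ S).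
Local Notation L := (latticeL ty e d).
Local Notation crystal := (crystal_elt ty e d).
Local Notation ft := (ftilde ty e d).
Local Notation mon := (mon S).
Implicit Types (u v x y C : S) (s t : seq 'I_n.+1) (i j : 'I_n.+1).

Lemma derZ i c u : d i (c *: u) = c *: d i u.
Proof. exact: linearZ_LR. Qed.

Definition dualvec u C : Prop := [/\ nice u C, intdual u & barinv u].

Lemma dualvec1 : dualvec 1 1.
Proof.
have d1 i : d i (1 : S) = 0 by exact: der1.
split; first exact: nice1.
  apply: intdual_step => [|i]; first by rewrite cf1; apply: laurent1.
  by rewrite !d1 !linear0; split=> //; apply: intdual0.
apply: barinv_step => [|i]; first by rewrite cf1 conjq1.
by rewrite d1; apply: barinv0.
Qed.

(** In the last case [adj i u - p] equals ([2]_i - 1)(p - e_i w). The factor stays in the hypothesis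
    because [2]_i has a pole at q = 0, so that smallness of p - e_i w alone would not suffice. *)
Variant dualvec_spec u C i : Prop :=
  | DualvecKill of d i u = 0
  | DualvecSimple C' C'' of dualvec (d i u) C' & d i (d i u) = 0
      & ft i C' C'' & qL (C'' - C)
  | DualvecDouble p w C' C'' of dualvec p C' & d i u = qint ty i 2 *: p
      & d i p = w & d i w = 0 & intdual w
      & dsmall ((qint ty i 2 - 1) *: (p - e i * w)) & ft i C' C'' & qL (C'' - C).

Lemma laurent_qint2 i : laurent (qint ty i 2).
Proof.
have h : laurent (qi ty i) by apply: laurent_qz.
rewrite qint2; apply: laurentD => //; rewrite -[(qi ty i)^-1]expr1 exprVn expr1.
by rewrite /qi invr_expz; apply: laurent_qz.
Qed.

Lemma dualvec_step u C : cf u [::] = 0 -> (forall i, dualvec_spec u C i) -> dualvec u C.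
Proof.
move=> h0 hi; have q2 i := qint_neq0 ty i 1.
have d3 i : d i (d i (d i u)) = 0.
  case: (hi i) => [->|C' C'' _ -> _ _|p w C' C'' _ -> dp dw _ _ _ _]; rewrite ?linear0 //.
  by rewrite !linearZ_LR /= dp dw scaler0.
split.
- apply: nice_step => // i.
  case: (hi i) => [h|C' C'' [h _ _] h2 hf hC|p w C' C'' [h _ _] h1 hp hw _ hs hf hC].
  + by left; rewrite adj0 //; apply: dsmall0.
  + right; exists (d i u), C', C''; split=> //.
    by rewrite adj1 // subrr; apply: dsmall0.
  right; exists p, C', C''; split=> //.
  have -> : adj i u - p = (qint ty i 2 - 1) *: (p - e i * w); last exact: hs.
  rewrite /adj h1 derZ hp -scalerAr scalerA mulrBl mul1r (mulVf (q2 i)).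
  by rewrite scalerBr [X in _ = X - _]scalerBl scale1r addrAC.
- apply: intdual_step => [|i]; first by rewrite h0; apply: laurent0.
  have := d3 i; case: (hi i) => [->|C' C'' [_ h _] -> _ _|p w C' C'' [_ h _] -> hp _ hw _ _ _] d3i.
  + by rewrite !linear0; split=> //; apply: intdual0.
  + by split; rewrite ?scaler0 ?linear0 //; apply: intdual0.
  split=> //; first by apply: intdualZ => //; apply: laurent_qint2.
  by rewrite derZ hp scalerA (mulVf (q2 i)) scale1r.
apply: barinv_step => [|i]; first by rewrite h0 conjq0.
case: (hi i) => [->|C' C'' [_ _ h] _ _ _|p w C' C'' [_ _ h] -> _ _ _ _ _ _] //.
  exact: barinv0.
by apply: barinvZ => //; apply: conjq_qint2.
Qed.

(** * Right multiplication by a new letter *)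

Lemma cf_Mgen_nil u j : cf (u * e j) [::] = 0.
Proof.
move: u; apply: (@linear_monP _ _ S Qq^o (fun u => cf (u * e j) [::]) (fun=> 0)).
- by move=> c x y; rewrite mulrDl -scalerAl cfD cfZ.
- by move=> c x y; rewrite scaler0 addr0.
move=> s; have -> : mon s * e j = mon (rcons s j).
  by rewrite -cats1 mon_cat mon_cons mon_nil mulr1.
by apply: wtU_mon; apply/negP => /perm_size; rewrite size_rcons.
Qed.

Lemma sform_le0 (i j : nat) : i != j -> sform ty i j <= 0.
Proof.
move=> ij; rewrite /sform; case: ty; rewrite (negPf ij) //; case: ifP => //.
by case: ifP.
Qed.

Lemma der_count0 s i u : (count_mem i s <= 2)%N -> wtU s u -> d i (d i (d i u)) = 0.
Proof.
move=> hs hu; apply: cf_inj => t; rewrite !cf_der cf0 hu //.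
apply/negP => /permP /(_ (pred1 i)) h; move: hs; rewrite -h -!cats1 !count_cat /= eqxx.
lia.
Qed.

Lemma adj_wtU i s u : wtU (i :: s) u -> wtU s (adj i u).
Proof.
move=> hu; apply: wtUB; first exact: wtU_der.
apply: wtUZ; case: (boolP (i \in s)) => his; last first.
  by rewrite (wtU_der_notin his (wtU_der hu)) mulr0; apply: wtU0.
apply: (@wtU_perm _ _ _ (i :: rem i s)); first by rewrite perm_sym perm_to_rem.
apply: wtU_genM; apply: wtU_der; apply: wtU_perm (wtU_der hu).
exact: perm_to_rem.
Qed.

Lemma reg_qz (z : int) : 0 <= z -> regular0 (q ^ z).
Proof. by case: z => // k _; apply: regX; apply: regq1. Qed.

(** Induction along the path of f_i leading to a crystal element. For i different from j the adjoint
    of f_i commutes with right multiplication by e_j; for i = j it returns [x] times a power of q,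
    whose exponent is nonnegative because distinct simple roots have nonpositive products. *)
Lemma dreg_Mgen x s j : dreg x -> wtU s x -> (forall i, count_mem i s <= 2)%N ->
  j \notin s -> dreg (x * e j).
Proof.
move=> hx hw hc hj c hcr; elim: hcr x s hx hw hc hj => [|i v w hv IH h] x s hx hw hc hj.
  by rewrite K1 cf_Mgen_nil; apply: reg0.
have [ij|ij] := eqVneq i j.
  have dx : d j x = 0 by apply: wtU_der_notin hw.
  have dxe : d j (x * e j) = q ^ (- \sum_(k <- s) sform ty j k) *: x.
    by rewrite (der_Mgen _ _ hw) dx mul0r add0r eqxx scale1r.
  have dxe2 : d j (d j (x * e j)) = 0 by rewrite dxe derZ dx scaler0.
  rewrite ij in h; rewrite (K_adj _ h) ?dxe2 ?linear0 // adj1 // dxe KZl.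
  apply: regM; last exact: hx.
  apply: reg_qz; rewrite oppr_ge0 big_seq; elim/big_ind: _ => // [a b ha hb|k hk].
    by rewrite -oppr_ge0 opprD addr_ge0 ?oppr_ge0.
  apply: sform_le0; apply: contraNneq hj => jk.
  by rewrite (ord_inj jk).
have dM y (hy : wtU s y) : d i (y * e j) = d i y * e j.
  by rewrite (der_Mgen _ _ hy) (negPf ij) scale0r addr0.
have d1 := dM x hw.
case: (boolP (i \in s)) => his; last first.
  have dx0 : d i (x * e j) = 0 by rewrite d1 (wtU_der_notin his hw) mul0r.
  by rewrite (K_adj _ h) ?dx0 ?linear0 // adj0 // K0l; apply: reg0.
have ps := perm_to_rem his; set s' := rem i s in ps *.
have hwi : wtU (i :: s') x by apply: wtU_perm hw.
have dM' t y : wtU t y -> d i (y * e j) = d i y * e j.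
  by move=> hy; rewrite (der_Mgen _ _ hy) (negPf ij) scale0r addr0.
have d2 : d i (d i (x * e j)) = d i (d i x) * e j by rewrite d1 (dM' _ _ (wtU_der hwi)).
have d3 : d i (d i (d i x)) = 0 by apply: der_count0 hw.
have d3' : d i (d i (d i (x * e j))) = 0.
  rewrite d2; case: (boolP (i \in s')) => his'; last first.
    by rewrite (wtU_der_notin his' (wtU_der hwi)) mul0r linear0.
  have h2 : wtU (rem i s') (d i (d i x)).
    by apply: wtU_der; apply: wtU_perm (wtU_der hwi); apply: perm_to_rem.
  by rewrite (dM' _ _ h2) d3 mul0r.
rewrite (K_adj d3' h).
have -> : adj i (x * e j) = adj i x * e j.
  by rewrite /adj d2 d1 mulrBl -scalerAl mulrA.
apply: (IH _ s') => //.
- move=> c' hc'; have [w' hw'] := ftilde_total i c'.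
  by rewrite -(K_adj d3 hw'); apply: hx; apply: crystalS hw'.
- exact: adj_wtU.
- move=> k; have := hc k; rewrite (permP ps) /=.
  exact: leq_trans (leq_addl _ _).
by apply: contra hj; rewrite (perm_mem ps) inE => ->; rewrite orbT.
Qed.

(** * Homogeneity of the dual canonical basis *)

Lemma repr_exists u : exists f : freeAlg n.+1, u == lext mon f.
Proof. by have [f ->] := gen_span u; exists f. Qed.

(** A scalar with distinct powers, fixed by conjugation, regular at 0 and Laurent: scaling by it
    respects all the structures, and the exponent of an eigenvalue recovers a multiplicity. *)
Definition two : Qq := Qinj 2.

(** The automorphism scaling [e i] by 2; being semisimple with integral
    eigenvectors, it detects the [i]-component of the weight. *)
Definition tau i u : S :=
  \sum_(s <- msupp (xchoose (repr_exists u)))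
    ((xchoose (repr_exists u))@_s * two ^+ count_mem i (s : seq _)) *: mon s.

(** A monomial contributes only to words with the same letters, and these have the same number of
    [i]. Hence the representative chosen in [tau] is immaterial. *)
Lemma cf_tau i u s : cf (tau i u) s = two ^+ count_mem i s * cf u s.
Proof.
rewrite {2}(eqP (xchooseP (repr_exists u))) /tau; move: (xchoose _) => f.
rewrite -[s]revK -!K_mon /lext !Ksuml mulr_sumr; apply: eq_bigr => t _.
rewrite !KZl !K_mon !revK; case: (boolP (perm_eq s t)) => st.
  by rewrite (permP st) mulrAC mulrC.
by rewrite (wtU_mon S st) !mulr0.
Qed.

Lemma tau_mon i s : tau i (mon s) = two ^+ count_mem i s *: mon s.
Proof.
apply: cf_inj => t; rewrite cf_tau cfZ.
case: (boolP (perm_eq t s)) => st; first by rewrite (permP st).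
by rewrite (wtU_mon S st) !mulr0.
Qed.

Lemma tauZ i c u : tau i (c *: u) = c *: tau i u.
Proof. by apply: cf_inj => s; rewrite !(cf_tau, cfZ) mulrCA. Qed.

Lemma tauD i u v : tau i (u + v) = tau i u + tau i v.
Proof. by apply: cf_inj => s; rewrite !(cf_tau, cfD) mulrDr. Qed.

Lemma tau0 i : tau i 0 = 0.
Proof. by apply: cf_inj => s; rewrite !(cf_tau, cf0) mulr0. Qed.

Lemma tau_sum i (I : Type) (A : seq I) (P : pred I) (F : I -> S) :
  tau i (\sum_(k <- A | P k) F k) = \sum_(k <- A | P k) tau i (F k).
Proof. exact: (big_morph (tau i) (tauD i) (tau0 i)). Qed.

Lemma tauM i u v : tau i (u * v) = tau i u * tau i v.
Proof.
move: u; apply: (@linear_monP _ _ S S (fun u => tau i (u * v)) (fun u => tau i u * tau i v)).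
- by move=> c x y; rewrite mulrDl -scalerAl tauD tauZ.
- by move=> c x y; rewrite tauD tauZ mulrDl scalerAl.
move=> s; move: v.
apply: (@linear_monP _ _ S S (fun v => tau i (mon s * v)) (fun v => tau i (mon s) * tau i v)).
- by move=> c x y; rewrite mulrDr -scalerAr tauD tauZ.
- by move=> c x y; rewrite tauD tauZ mulrDr scalerAr.
move=> t; rewrite -mon_cat !tau_mon count_cat exprD mon_cat.
by rewrite -scalerAl -scalerAr scalerA.
Qed.

Lemma tau_gen i j : tau i (e j) = two ^+ (j == i) *: e j.
Proof.
have -> : e j = mon [:: j] by rewrite mon_cons mon_nil mulr1.
by rewrite tau_mon /= addn0.
Qed.

Lemma tauX i u c k : tau i u = c *: u -> tau i (u ^+ k) = c ^+ k *: u ^+ k.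
Proof.
move=> h; elim: k => [|k IH]; first by rewrite !expr0 scale1r -(mon_nil S) tau_mon scale1r.
by rewrite !exprS tauM h IH -scalerAl -scalerAr scalerA.
Qed.

Lemma tau_divpow i j k :
  tau i (divpow ty j (e j) k) = two ^+ (j == i) ^+ k *: divpow ty j (e j) k.
Proof. by rewrite /divpow tauZ (tauX _ (tau_gen i j)) !scalerA mulrC. Qed.

Lemma tau_der_eq0 i j u : d j u = 0 -> d j (tau i u) = 0.
Proof.
move=> h; apply: cf_inj => s; rewrite cf_der cf_tau cf0 -cf_der h cf0 mulr0 //.
Qed.

(** Since [tau i] rescales e_j^(p) by a power of 2 and preserves the kernel of e_j', it maps
    j-strings to j-strings. As f_j is a function, eigenvectors go to eigenvectors, with a further
    factor 2 when j = i. *)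
Lemma tau_crystal i c : crystal c -> exists k, tau i c = two ^+ k *: c.
Proof.
elim=> [|j u v hu [k IH] h]; first by exists 0%N; rewrite -(mon_nil S) tau_mon.
exists (k + (j == i))%N.
have [m [x [h1 h2 h3]]] := h.
pose y p : S := two ^+ (j == i) ^+ p *: tau i (x p).
have hy : ft j (tau i u) (\sum_(p < m) divpow ty j (e j) p.+1 * y p).
  exists m, y; split=> // [p|]; first by rewrite derZ tau_der_eq0 // scaler0.
  rewrite h2 tau_sum; apply: eq_bigr => p _.
  by rewrite tauM tau_divpow -scalerAl scalerAr.
have hz : ft j (tau i u) (two ^+ k *: v).
  have := ftilde_lin (two ^+ k) h (decomp_ftilde (i := j) (u := 0) (k := 0) (x := fun=> 0) _).
  rewrite IH /fsum big_ord0 !addr0; apply.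
  by split=> [p|//|]; rewrite ?linear0 ?big_ord0.
have := ftilde_fun hy hz => E.
rewrite exprD mulrC -scalerA -E h3 tau_sum scaler_sumr; apply: eq_bigr => p _.
by rewrite tauM tau_divpow -scalerAl exprS -scalerA !scalerAr.
Qed.

Lemma tau_lattice i u : L u -> L (tau i u).
Proof.
elim=> [|c b w rc hb hw IH]; first by rewrite tau0; apply: latticeL0.
rewrite tauD tauZ; have [k ->] := tau_crystal i hb.
rewrite scalerA; apply: latticeLD => //; apply: regM => //.
by rewrite -rmorphXn; apply: regQ.
Qed.

Lemma tau_integral i u : integral ty e u -> integral ty e (tau i u).
Proof.
elim=> {u} [c hc|j k|x y _ IHx _ IHy|x y _ IHx _ IHy].
- by rewrite tauZ -(mon_nil S) tau_mon mon_nil scale1r; apply: integral_scalar.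
- rewrite tau_divpow -exprM; apply: integral_scale; last exact: integral_divpow.
  by rewrite -rmorphXn; apply: laurentQ.
- by rewrite tauD; apply: integralD.
by rewrite tauM; apply: integralM.
Qed.

Lemma tau_bar i u : tau i (bar u) = bar (tau i u).
Proof.
have [f ->] := gen_span u; rewrite bar_lext /lext !tau_sum rmorph_sum; apply: eq_bigr => s _.
rewrite !tauZ tau_mon barZ barZ bar_mon; congr (_ *: (_ *: _)).
by rewrite -rmorphXn conjqQ.
Qed.

(** Take 2^k to be the eigenvalue of the crystal element congruent to [b]. Then
    [tau i b - two ^+ k *: b] is integral, lies in q L(oo) and in the conjugate lattice, and so is
    0. *)
Lemma tau_cbasis i b : G b -> exists k, tau i b = two ^+ k *: b.
Proof.
have [_ gl] := cbasis_ok S; move=> /gl [h1 h2 [l hl bl] [c [w [hc hw hbc]]]].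
have [k hk] := tau_crystal i hc; exists k.
have lt : laurent (two ^+ k) by rewrite -rmorphXn; apply: laurentQ.
have rt : regular0 (two ^+ k) by rewrite -rmorphXn; apply: regQ.
apply/eqP; rewrite -subr_eq0; apply/eqP; apply: lower_global_small.
- by apply: integralD; [apply: tau_integral | apply: integralN; apply: integral_scale].
- by apply: latticeB; [apply: tau_lattice | apply: latticeZ].
- exists (tau i l - two ^+ k *: l); first by apply: latticeB; [apply: tau_lattice | apply: latticeZ].
  rewrite rmorphB /= -tau_bar -bl barZ -bl; congr (_ - _ *: _).
  by rewrite -rmorphXn conjqQ.
exists (tau i w - two ^+ k *: w); first by apply: latticeB; [apply: tau_lattice | apply: latticeZ].
rewrite hbc tauD tauZ hk scalerDr opprD addrACA subrr add0r scalerBr.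
by rewrite !scalerA mulrC.
Qed.

Lemma K_tau i u x : K (tau i u) x = K u (tau i x).
Proof.
move: x; apply: (@linear_monP _ _ S Qq^o (fun x => K (tau i u) x) (fun x => K u (tau i x))).
- by move=> c x y; rewrite KDr KZr.
- by move=> c x y; rewrite tauD tauZ KDr KZr.
by move=> s; rewrite tau_mon KZr !K_mon cf_tau count_rev.
Qed.

Lemma two_inj a b : two ^+ a = two ^+ b -> a = b.
Proof.
move=> h; apply: (@ieexprIn rat 2) => //; apply: (fmorph_inj Qinj).
by rewrite !rmorphXn; exact: h.
Qed.

(** The map [tau i] is self-adjoint and diagonal on the canonical basis, hence also on the dual
    basis. All words of [v] thus contain [i] equally often, for every [i]. *)
Lemma dual_canonical_homog v g : dual_canonical G K v -> cf v g <> 0 -> wtU g v.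
Proof.
move=> [b Gb hb] hg t ht; apply/eqP; case: (cf v t =P 0) => // h0; exfalso.
move/negP: ht; apply; apply/allP => i _ /=; apply/eqP.
have [k hk] := tau_cbasis i Gb; have [[span _] _] := cbasis_ok S.
have tv : tau i v = two ^+ k *: v.
  apply/eqP; rewrite -subr_eq0; apply/eqP/K_nondeg => x.
  have [s [c [hs ->]]] := span x; rewrite Ksumr big_seq big1 // => b' b's.
  have Gb' := hs b' b's; rewrite KZr KBl K_tau KZl.
  case: (b =P b') => [<-|bb']; first by rewrite hk KZr subrr mulr0.
  have [k' ->] := tau_cbasis i Gb'; rewrite KZr hb //.
  by move/eqP/negPf: bb' => ->; rewrite !mulr0 subrr mulr0.
have cnt s : cf v s <> 0 -> count_mem i s = k.
  move=> hs; apply: two_inj; have := congr1 (fun u => cf u s) tv.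
  rewrite cf_tau cfZ; apply: mulIf; exact/eqP.
by rewrite !cnt.
Qed.

End DualVectors.

(** * Elements with prescribed derivatives *)

Section Extension.
Variables (ty : classical_type) (n : nat) (S : qsetup ty n).
Local Notation e := (@gen _ _ S).
Local Notation d := (@der _ _ S).
Local Notation K := (@form _ _ S).
Local Notation mon := (mon S).
Implicit Types (u v x y : S) (s t a b : seq 'I_n.+1) (i j l : 'I_n.+1).

Definition serre_len i j := `|1 - cartan ty i j|%N.

Definition serre_coef i m k : Qq :=
  (-1) ^+ k * ((qfact ty i (m - k))^-1 * (qfact ty i k)^-1).

Definition serre_word i j m k : seq 'I_n.+1 := nseq (m - k) i ++ j :: nseq k i.

Lemma wd_nseq i k : wd [:: i] ^+ k = wd (nseq k i) :> freeAlg n.+1.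
Proof. by elim: k => [|k IH]; rewrite ?expr0 ?wd1 // exprS IH wdM. Qed.

Lemma serre_words i j : serre ty i j =
  \sum_(k < (serre_len i j).+1) serre_coef i (serre_len i j) k *: wd (serre_word i j (serre_len i j) k).
Proof.
apply: eq_bigr => k _; rewrite /divpow !wd_nseq /serre_coef -!scalerA; congr (_ *: _).
move: (_^-1) (_^-1) => c c'.
rewrite -[X in X * _]scalerAl [LHS]malg_scaleAr -[X in _ *: X]scalerAl [RHS]scalerA mulrC -scalerA.
congr (_ *: (_ *: _)).
by rewrite [X in X * _]wdM [LHS]wdM /serre_word -catA.
Qed.

Lemma serre_mon i j (m := serre_len i j) : i != j ->
  \sum_(k < m.+1) serre_coef i m k *: mon (serre_word i j m k) = 0.
Proof.
move=> ij; have := serreU S ij; rewrite -/m => h; rewrite -[RHS]h; apply: eq_bigr => k _.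
have mon_nseq p : mon (nseq p i) = e i ^+ p.
  by elim: p => [|p IH]; rewrite ?mon_nil ?expr0 //= mon_cons IH exprS.
rewrite /serre_word mon_cat mon_cons !mon_nseq /divpow /serre_coef -!scalerA; congr (_ *: _).
by rewrite -!scalerAl -scalerAr !scalerA mulrA.
Qed.

Lemma linear_word0 (h : freeAlg n.+1 -> Qq) :
  (forall c f g, h (c *: f + g) = c * h f + h g) -> (forall s, h (wd s) = 0) ->
  forall f, h f = 0.
Proof.
move=> lh h0; apply: (@linear_wordP n.+1 Qq^o h (fun=> 0)) => // c x y.
by rewrite scaler0 addr0.
Qed.

(** Linear algebra on the words of length N: [phi] lies in the row space of the Gram matrix of
    monomials exactly when it vanishes on the cokernel, and the cokernel consists of linear
    relations between monomials. *)
Lemma realize (N : nat) (phi : seq 'I_n.+1 -> Qq) :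
  (forall s, size s != N -> phi s = 0) ->
  (forall a b i j, i != j -> \sum_(k < (serre_len i j).+1)
     serre_coef i (serre_len i j) k * phi (rev (a ++ serre_word i j (serre_len i j) k ++ b)) = 0) ->
  exists u, forall s, cf u s = phi s.
Proof.
move=> phiN phiS.
pose psi (f : freeAlg n.+1) : Qq := lext (fun t => phi (rev t) : Qq^o) f.
have psiP c f g : psi (c *: f + g) = c * psi f + psi g.
  exact: (lext_is_linear (fun t => phi (rev t) : Qq^o) c f g).
have psi_serre i j (x y : freeAlg n.+1) : i != j -> psi (x * serre ty i j * y) = 0.
  move=> ij; move: x; apply: linear_word0.
    move=> c f g; rewrite -psiP; congr psi.
    by rewrite !mulrDl -!scalerAl.
  move=> a; move: y; apply: linear_word0.
    move=> c f g; rewrite -psiP; congr psi.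
    by rewrite mulrDr; congr (_ + _); exact: malg_scaleAr.
  move=> b; rewrite -[RHS](phiS a b i j ij) serre_words.
  rewrite mulr_sumr mulr_suml /psi (linear_sum (lext _)); apply: eq_bigr => k _.
  have -> : wd a * (serre_coef i (serre_len i j) k *: wd (serre_word i j (serre_len i j) k)) * wd b =
    serre_coef i (serre_len i j) k *: wd (a ++ serre_word i j (serre_len i j) k ++ b).
    rewrite [X in X * _]malg_scaleAr -[LHS]scalerAl; congr (_ *: _).
    by rewrite [X in X * _]wdM [LHS]wdM -catA.
  exact: (lext_Zwd (fun t => phi (rev t) : Qq^o)).
have psi0 (g : freeAlg n.+1) : serre_ideal ty g -> psi g = 0.
  elim=> [|i j x y f ij _ IH]; first exact: (linear0 (lext (fun t => phi (rev t) : Qq^o))).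
  have -> : psi (x * serre ty i j * y + f) = psi (x * serre ty i j * y) + psi f.
    exact: (linearD (lext (fun t => phi (rev t) : Qq^o))).
  by rewrite IH (psi_serre _ _ _ _ ij) addr0.
pose T := N.-tuple 'I_n.+1.
pose w (p : 'I_#|{: T}|) : seq 'I_n.+1 := @enum_val T xpredT p.
have wN p : size (w p) = N by rewrite size_tuple.
have w_onto s : size s = N -> exists p, w p = s.
  move=> hs; exists (enum_rank (tcast hs (in_tuple s))).
  by rewrite /w enum_rankK val_tcast.
pose M := \matrix_(p < #|{: T}|, p' < #|{: T}|) K (mon (w p)) (mon (w p')).
pose f := \row_(p < #|{: T}|) phi (rev (w p)).
have : (f <= M)%MS.
  rewrite submxE; apply/eqP/rowP => c; rewrite mxE [RHS]mxE.
  pose g : freeAlg n.+1 := \sum_p (cokermx M) p c *: wd (w p).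
  transitivity (psi g).
    rewrite /psi /g (linear_sum (lext _)); apply: eq_bigr => p _.
    by rewrite mxE mulrC; symmetry; exact: (lext_Zwd (fun t => phi (rev t) : Qq^o)).
  (* A column of the cokernel gives an element of U_q orthogonal to all monomials, hence 0 by
     nondegeneracy; its lift to the free algebra lies in the Serre ideal, where [psi] vanishes. *)
  apply: psi0; have [_ h] := gen_ok S; apply/h.
  have eg : eval e g = \sum_p (cokermx M) p c *: mon (w p).
    by rewrite eval_sum; apply: eq_bigr => p _; rewrite evalZ eval_wd.
  apply: K_nondeg => v; rewrite eg; move: v.
  apply: (@linear_monP _ _ S Qq^o (K _) (fun=> 0)) => [c' x y|c' x y|s].
  - by rewrite KDr KZr.
  - by rewrite scaler0 addr0.
  case: (size s =P N) => hs; last first.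
    rewrite Ksuml big1 // => p _; rewrite KZl K_mon (wtU_mon S) ?mulr0 //.
    by apply/negP => /perm_size; rewrite size_rev wN.
  have [p0 <-] := w_onto s hs.
  have := congr1 (fun A : 'M_(_, _) => A p0 c) (mulmx_coker M); rewrite !mxE => <-.
  by rewrite Ksuml; apply: eq_bigr => p _; rewrite KZl mxE mulrC [M _ _]mxE KC.
case/submxP => D hD; exists (\sum_p D 0 p *: mon (w p)) => s.
case: (size s =P N) => hs; last first.
  rewrite phiN; last exact/eqP.
  rewrite -[s]revK -K_mon Ksuml big1 // => p _; rewrite KZl K_mon (wtU_mon S) ?mulr0 //.
  by apply/negP => /perm_size; rewrite revK wN.
have [p0 hp0] := w_onto (rev s) (etrans (size_rev s) hs).
have := congr1 (fun A : 'M_(_, _) => A 0 p0) hD; rewrite !mxE hp0 revK => ->.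
rewrite -{1}[s]revK -K_mon Ksuml; apply: eq_bigr => p _.
by rewrite KZl mxE hp0.
Qed.

(** The word i^(m-k) j i^k acting on an element whose derivatives are prescribed by [w]. Its first
    letter is absorbed by [w]: this is i if k < m, and j if k = m. *)
Definition serre_term (w : 'I_n.+1 -> S) i j m k : S :=
  if (k < m)%N then iter k (d i) (d j (iter (m - k).-1 (d i) (w i)))
  else iter m (d i) (w j).

Lemma K_nseq u i (k : nat) b : K u (mon (nseq k i ++ b)) = K (iter k (d i) u) (mon b).
Proof.
by elim: k u => [//|k IH] u; rewrite /= mon_cons -K_der IH -iterSr.
Qed.

Lemma K_serre_word u i (k : nat) j (p : nat) b :
  K u (mon (nseq k i ++ j :: nseq p i ++ b)) = K (iter p (d i) (d j (iter k (d i) u))) (mon b).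
Proof. by rewrite K_nseq mon_cons -K_der K_nseq. Qed.

Variable N : nat.

Lemma extend (w : 'I_n.+1 -> S) :
  (forall i s, size s != N -> cf (w i) s = 0) ->
  (forall i j, i != j -> \sum_(k < (serre_len i j).+1)
     serre_coef i (serre_len i j) k *: serre_term w i j (serre_len i j) k = 0) ->
  exists u, cf u [::] = 0 /\ forall i, d i u = w i.
Proof.
move=> wN wS.
pose phi (s : seq 'I_n.+1) : Qq := if rev s is i :: t then cf (w i) (rev t) else 0.
have phi_rcons s i : phi (rcons s i) = cf (w i) s by rewrite /phi rev_rcons revK.
suff [u hu] : exists u, forall s, cf u s = phi s.
  exists u; split; first by rewrite hu.
  by move=> i; apply: cf_inj => s; rewrite cf_der hu phi_rcons.
apply: (realize (N := N.+1)) => [s|a b i j ij].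
  case/lastP: s => [//|s i]; rewrite size_rcons eqSS phi_rcons; exact: wN.
case: a => [|l a].
  rewrite -[RHS](K0l (mon b)) -(wS i j ij) Ksuml; apply: eq_bigr => k _; rewrite KZl; congr (_ * _).
  rewrite /serre_term /serre_word; case: ltnP => hk.
    have -> : (serre_len i j - k = (serre_len i j - k).-1.+1)%N by lia.
    by rewrite /= rev_cons phi_rcons -K_mon -catA cat_cons K_serre_word.
  have -> : (serre_len i j - k = 0)%N by apply/eqP; rewrite subn_eq0.
  have -> : k = serre_len i j :> nat by apply/eqP; rewrite eqn_leq hk -ltnS ltn_ord.
  by rewrite /= rev_cons phi_rcons -K_mon K_nseq.
have hz : mon a * (\sum_(k < (serre_len i j).+1)
    serre_coef i (serre_len i j) k *: mon (serre_word i j (serre_len i j) k)) * mon b = 0.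
  by rewrite (serre_mon ij) mulr0 mul0r.
rewrite -[RHS](K0r (w l)) -hz mulr_sumr mulr_suml Ksumr; apply: eq_bigr => k _.
rewrite -scalerAr -scalerAl KZr -!mon_cat K_mon; congr (_ * _).
by rewrite cat_cons rev_cons phi_rcons catA.
Qed.

Definition only u i := forall j, j != i -> d j u = 0.

(** The only nonzero prescribed derivative is that at [b], so a term of a Serre sum involves [x]
    only if its word starts with [b]; the hypotheses annihilate these terms one by one. *)
Lemma append1 x (b : 'I_n.+1) : (forall s, size s != N -> cf x s = 0) ->
  (forall l, l != b -> iter (serre_len l b) (d l) x = 0) ->
  (forall l k, l != b -> (k < serre_len b l)%N ->
     iter k (d b) (d l (iter (serre_len b l - k).-1 (d b) x)) = 0) ->
  exists y, [/\ cf y [::] = 0, only y b & d b y = x].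
Proof.
move=> xN h1 h2; have [|i j ij|u [u0 hu]] := @extend (fun i => if i == b then x else 0).
- by move=> i s hs; case: ifP => _; [apply: xN | rewrite cf0].
- apply: big1 => k _; rewrite /serre_term; case: ltnP => hk.
    have [ib|ib] := eqVneq i b; last by rewrite iter0 linear0 iter0 scaler0.
    by subst i; rewrite h2 ?scaler0 // eq_sym.
  have [jb|jb] := eqVneq j b; last by rewrite iter0 scaler0.
  by subst j; rewrite h1 ?scaler0.
exists u; split=> // [j jb|]; rewrite hu; first by rewrite (negPf jb).
by rewrite eqxx.
Qed.

End Extension.

(** * Words as elements of U_q *)

Section CartanEntries.
Implicit Types i j : nat.

Lemma cartanA i j : i != j -> cartan typeA i j = if chain_adj i j then -1 else 0.
Proof.
by move=> ij; rewrite /cartan /dsym /sform eqxx (negPf ij); case: chain_adj.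
Qed.

Lemma cartanB i j : i != j ->
  cartan typeB i j = if chain_adj i j then (if i == 0%N then -2 else -1) else 0.
Proof.
move=> ij; rewrite /cartan /dsym /sform eqxx (negPf ij).
by case: chain_adj; case: (i == 0%N).
Qed.

Lemma cartanC i j : i != j ->
  cartan typeC i j = if chain_adj i j then (if j == 0%N then -2 else -1) else 0.
Proof.
move=> ij; rewrite /cartan /dsym /sform eqxx (negPf ij).
have [i0|i0] := eqVneq i 0%N; case: chain_adj; have [j0|j0] := eqVneq j 0%N => //.
by rewrite i0 j0 in ij.
Qed.

Lemma cartanD i j : i != j -> cartan typeD i j = if fork_adj i j then -1 else 0.
Proof.
by move=> ij; rewrite /cartan /dsym /sform eqxx (negPf ij); case: fork_adj.
Qed.

End CartanEntries.

Section WordElements.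
Variables (ty : classical_type) (n : nat) (S : qsetup ty n).
Implicit Types (u v x y : S) (g h : seq nat) (k l b c : nat).

(** Numbers above [n] all become the letter 0, hence the bounds in the lemmas below. *)
Definition ix k : 'I_n.+1 := inord k.
Local Notation D k := (@der _ _ S (ix k)).
Local Notation E k := (@gen _ _ S (ix k)).
Local Notation ft k := (ftilde ty (@gen _ _ S) (@der _ _ S) (ix k)).
Local Notation a := (cartan ty).

Definition W g : seq 'I_n.+1 := map ix g.
Definition small_letters g := all (fun k => k <= n)%N g.

Lemma small_rev g : small_letters (rev g) = small_letters g.
Proof. exact: all_rev. Qed.

Lemma small_perm g h : perm_eq g h -> small_letters g = small_letters h.
Proof. exact: perm_all. Qed.

Lemma small_cat g h : small_letters (g ++ h) = small_letters g && small_letters h.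
Proof. exact: all_cat. Qed.

Lemma ixK k : (k <= n)%N -> ix k = k :> nat.
Proof. by move=> hk; apply: inordK. Qed.

Lemma ix_ord (i : 'I_n.+1) : ix i = i.
Proof. exact: inord_val. Qed.

Lemma ix_eq k l : (k <= n)%N -> (l <= n)%N -> (ix k == ix l) = (k == l).
Proof. by move=> hk hl; rewrite -(inj_eq val_inj) /= !ixK. Qed.

Lemma forall_ix (P : 'I_n.+1 -> Prop) : (forall k, (k <= n)%N -> P (ix k)) -> forall i, P i.
Proof. by move=> h i; rewrite -(ix_ord i); apply: h; rewrite -ltnS. Qed.

Lemma W_cat g h : W (g ++ h) = W g ++ W h.
Proof. exact: map_cat. Qed.

Lemma W_rcons g k : W (rcons g k) = rcons (W g) (ix k).
Proof. exact: map_rcons. Qed.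

Lemma mem_W g k : (k <= n)%N -> small_letters g -> (ix k \in W g) = (k \in g).
Proof.
move=> hk; elim: g => //= l g IH /andP[hl hg].
by rewrite !inE ix_eq // IH.
Qed.

Lemma count_W g k : (k <= n)%N -> small_letters g -> count_mem (ix k) (W g) = count_mem k g.
Proof.
move=> hk; elim: g => //= l g IH /andP[hl hg].
by rewrite ix_eq // IH.
Qed.

Lemma D_comm k l u : (k <= n)%N -> (l <= n)%N -> k != l -> a k l = 0 -> D k (D l u) = D l (D k u).
Proof. by move=> hk hl kl c; apply: serreD0; rewrite ?ix_eq // /= !ixK. Qed.

Lemma D_serre1 k l u : (k <= n)%N -> (l <= n)%N -> k != l -> a k l = -1 ->
  D k (D k (D l u)) + D l (D k (D k u)) = qint ty (ix k) 2 *: D k (D l (D k u)).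
Proof. by move=> hk hl kl c; apply: serreD1; rewrite ?ix_eq // /= !ixK. Qed.

Definition sole u k := forall l, (l <= n)%N -> l != k -> D l u = 0.

Lemma D_inj u v : cf u [::] = cf v [::] -> (forall k, (k <= n)%N -> D k u = D k v) -> u = v.
Proof. by move=> h0 h; apply: der_inj => //; apply: forall_ix. Qed.

Lemma D_inj_sole u v k : cf u [::] = cf v [::] -> sole u k -> sole v k -> D k u = D k v -> u = v.
Proof.
move=> h0 hu hv h; apply: D_inj => // l hl.
by have [->//|lk] := eqVneq l k; rewrite hu // hv.
Qed.

Lemma wtU_D g k u : wtU (W (k :: g)) u -> wtU (W g) (D k u).
Proof. exact: wtU_der. Qed.

Lemma wtU_Dr g k u : wtU (W (rcons g k)) u -> wtU (W g) (D k u).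
Proof. by move=> hu; apply: wtU_der; apply: wtU_perm hu; rewrite W_rcons perm_rcons. Qed.

Lemma wtU_D_notin g k u : (k <= n)%N -> small_letters g -> k \notin g -> wtU (W g) u -> D k u = 0.
Proof. by move=> hk hg hkg; apply: wtU_der_notin; rewrite mem_W. Qed.

Lemma wtU_size s u t : wtU s u -> size t != size s -> cf u t = 0.
Proof. by move=> h ht; apply: h; apply: contra ht => /perm_size ->. Qed.

Lemma wtU_nil s u : wtU s u -> (0 < size s)%N -> cf u [::] = 0.
Proof. by move=> h hs; apply: (wtU_size h); rewrite neq_ltn hs. Qed.

Definition isword g u : Prop := forall s, cf u s = (s == W g)%:R.

Lemma isword_nil : isword [::] 1.
Proof. exact: cf1. Qed.

Lemma isword_uniq g u v : isword g u -> isword g v -> u = v.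
Proof. by move=> hu hv; apply: cf_inj => s; rewrite hu hv. Qed.

Lemma isword_wt g u : isword g u -> wtU (W g) u.
Proof. by move=> hu t ht; rewrite hu; case: eqP ht => // ->; rewrite perm_refl. Qed.

Lemma isword_D g k u : isword (rcons g k) u -> isword g (D k u).
Proof. by move=> hu s; rewrite cf_der hu W_rcons eqseq_rcons eqxx andbT. Qed.

Lemma isword_sole g k u : (k <= n)%N -> isword (rcons g k) u -> sole u k.
Proof.
move=> hk hu l hl lk; apply: cf_inj => s.
by rewrite cf_der hu W_rcons eqseq_rcons ix_eq // (negPf lk) andbF cf0.
Qed.

Lemma isword_nil_cf g k u : isword (rcons g k) u -> cf u [::] = 0.
Proof. by move=> ->; rewrite W_rcons; case: (W g). Qed.

Lemma isword_cons g k u : isword g (D k u) -> cf u [::] = 0 -> (k <= n)%N -> sole u k ->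
  isword (rcons g k) u.
Proof.
move=> hd h0 hk hs s; case/lastP: s => [|s i]; rewrite W_rcons.
  by rewrite h0; case: (W g).
rewrite eqseq_rcons -cf_der; move: i; apply: forall_ix => l hl.
have [->|lk] := eqVneq l k; first by rewrite eqxx andbT hd.
by rewrite hs // cf0 ix_eq // (negPf lk) andbF.
Qed.

Lemma iter_isword g u p l : (l <= n)%N -> small_letters g -> isword g u ->
  iter p (@der _ _ S (ix l)) u <> 0 ->
  exists2 h, g = h ++ nseq p l & isword h (iter p (@der _ _ S (ix l)) u).
Proof.
move=> hl; elim: p g u => [|p IH] g u hg hu hne; first by exists g; rewrite ?cats0.
rewrite iterSr in hne *.
case/lastP: g hu hg => [|g c] hu hg.
  case: hne; have -> : u = 1 by apply: isword_uniq hu isword_nil.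
  by rewrite der1 iter0.
have hc : (c <= n)%N by move: hg; rewrite /small_letters all_rcons => /andP[].
have [cl|cl] := eqVneq l c; last by case: hne; rewrite (isword_sole hc hu hl cl) iter0.
rewrite -cl in hu *; have [|h e1 e2] := IH g _ _ (isword_D hu) hne.
  by move: hg; rewrite /small_letters all_rcons => /andP[].
by exists h => //; rewrite e1 -cats1 -catA -[[:: l]]/(nseq 1 l) -nseqD addn1.
Qed.

Definition slen k l := `|1 - a k l|%N.

(** The excluded endings are those that occur, followed by [b], in a Serre relation
    between [b] and another letter. *)
Lemma word_append g b : small_letters g -> (b <= n)%N ->
  (forall l h, (l <= n)%N -> l != b -> g <> h ++ nseq (slen l b) l) ->
  (forall l k h, (l <= n)%N -> l != b -> (k < slen b l)%N ->
     g <> h ++ nseq k b ++ l :: nseq (slen b l - k).-1 b) ->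
  (exists x, isword g x) -> exists y, isword (rcons g b) y.
Proof.
move=> hg hb h1 h2 [x hx].
have [|i ib|i k ib hk|y [y0 yo yd]] := @append1 _ _ S (size (W g)) x (ix b).
- by move=> s hs; rewrite hx; case: (s =P W g) hs => // ->; rewrite eqxx.
- move: i ib; apply: forall_ix => l hl; rewrite ix_eq // => lb; apply/eqP.
  case: (iter _ _ x =P 0) => // hne; have [h hh _] := iter_isword hl hg hx hne.
  by case: (h1 l h hl lb); rewrite hh /serre_len /slen /= !ixK.
- move: i ib hk; apply: forall_ix => l hl; rewrite ix_eq // => lb.
  rewrite /serre_len !ixK // -/(slen b l) => hk; apply/eqP.
  case: (_ =P 0) => // hne.
  have hne1 : iter (slen b l - k).-1 (@der _ _ S (ix b)) x <> 0.
    by move=> h; apply: hne; rewrite h linear0 iter0.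
  have [h hh hw] := iter_isword hb hg hx hne1.
  have hg1 : small_letters h by move: hg; rewrite hh /small_letters all_cat => /andP[].
  case/lastP: h hh hw hg1 => [|h c] hh hw hg1.
    by case: hne; rewrite (isword_uniq hw isword_nil) der1 iter0.
  have hc : (c <= n)%N by move: hg1; rewrite /small_letters all_rcons => /andP[].
  have [lc|lc] := eqVneq l c; last by case: hne; rewrite (isword_sole hc hw hl lc) iter0.
  rewrite -lc in hh hw hg1.
  have hg2 : small_letters h by move: hg1; rewrite /small_letters all_rcons => /andP[].
  have [h' hh' _] := iter_isword hb hg2 (isword_D hw) hne.
  by case: (h2 l k h' hl lb hk); rewrite hh hh' -cats1 -!catA.
exists y; apply: isword_cons => //; first by rewrite yd.
by move=> l hl lb; apply: yo; rewrite ix_eq.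
Qed.

Lemma last_rcons_cat g c h l p : rcons g c = h ++ nseq p.+1 l -> c = l /\ g = h ++ nseq p l.
Proof.
by rewrite -addn1 nseqD catA cats1 => /rcons_inj [-> ->].
Qed.

Lemma slenE k l : k != l ->
  [\/ a k l = 0 /\ slen k l = 1%N, a k l = -1 /\ slen k l = 2%N | a k l = -2 /\ slen k l = 3%N].
Proof.
move=> kl; rewrite /slen; case: ty.
- by rewrite cartanA //; case: chain_adj; [constructor 2 | constructor 1].
- rewrite cartanB //; case: chain_adj; last by constructor 1.
  by case: (k == 0%N); [constructor 3 | constructor 2].
- rewrite cartanC //; case: chain_adj; last by constructor 1.
  by case: (l == 0%N); [constructor 3 | constructor 2].
by rewrite cartanD //; case: fork_adj; [constructor 2 | constructor 1].
Qed.

Lemma slen_gt0 k l : k != l -> (0 < slen k l)%N.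
Proof. by move=> /slenE [] [_ ->]. Qed.

(** As the last letter c differs from b, only two excluded endings are left: a full power of c, or c
    preceded by all but one of the letters b of the relation. *)
Lemma word_append_adj g c b : small_letters (rcons g c) -> (b <= n)%N -> c != b ->
  (forall h, g <> h ++ nseq (slen c b).-1 c) ->
  (forall h, g <> h ++ nseq (slen b c).-1 b) ->
  (exists x, isword (rcons g c) x) -> exists y, isword (rcons (rcons g c) b) y.
Proof.
move=> hg hb cb h1 h2; apply: word_append => // [l h hl lb|l k h hl lb hk].
  rewrite -(prednK (slen_gt0 lb)) => /last_rcons_cat [cl hh].
  by rewrite cl in h1; case: (h1 h).
have := ltn_predK hk; case hq: (slen b l - k)%N => [|q]; first by move: hk hq; lia.
case: q hq => [|q] hq _ /=.
  rewrite catA cats1 => /rcons_inj [hh cl].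
  case: (h2 h); rewrite cl hh; congr (_ ++ nseq _ _); lia.
rewrite catA -[l :: _]/([:: l] ++ _) catA => /(@last_rcons_cat _ _ (_ ++ [:: l]) b q) [cb' _].
by rewrite cb' eqxx in cb.
Qed.

(** * Dual vectors of words *)

Lemma dualvec_sole u C' k : (k <= n)%N -> sole u k -> cf u [::] = 0 -> D k (D k u) = 0 ->
  dualvec (D k u) C' -> exists C, dualvec u C.
Proof.
move=> hk hs h0 h2 hd; have [C hC] := ftilde_total (ix k) C'.
exists C; apply: dualvec_step => //; apply: forall_ix => l hl.
have [->|lk] := eqVneq l k; last by constructor 1; apply: hs.
by apply: (DualvecSimple hd h2 hC); rewrite subrr; apply: qL0.
Qed.

Lemma dualvec_sole_gen u C' k : (k <= n)%N -> sole u k -> cf u [::] = 0 -> D k (D k u) = 0 ->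
  dualvec (D k u) C' -> D k C' = 0 -> dualvec u (E k * C').
Proof.
move=> hk hs h0 h2 hd hC; apply: dualvec_step => //; apply: forall_ix => l hl.
have [->|lk] := eqVneq l k; last by constructor 1; apply: hs.
by apply: (DualvecSimple hd h2 (ftilde_gen hC)); rewrite subrr; apply: qL0.
Qed.

Lemma isword_D2 g c k u : (k <= n)%N -> (c <= n)%N -> c != k -> isword (rcons (rcons g c) k) u ->
  D k (D k u) = 0.
Proof. by move=> hk hc ck hu; apply: (isword_sole hc (isword_D hu)) => //; rewrite eq_sym. Qed.

(** With distinct letters, each f_k acts on a vector killed by e_k', where it is multiplication by
    e_k; so the witness is a monomial. *)
Lemma isword_dualvec_uniq g u : small_letters g -> uniq g -> isword g u ->
  dualvec u (mon S (W (rev g))).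
Proof.
elim/last_ind: g u => [|g k IH] u hg hr hu.
  by rewrite mon_nil (isword_uniq hu isword_nil); apply: dualvec1.
have [hk hg'] : (k <= n)%N /\ small_letters g.
  by move: hg; rewrite /small_letters all_rcons => /andP[].
move: hr; rewrite rcons_uniq => /andP[kg ug].
rewrite rev_rcons /= mon_cons.
have hu0 := isword_nil_cf hu.
apply: (dualvec_sole_gen hk (isword_sole hk hu) hu0 _ (IH _ hg' ug (isword_D hu))).
  apply: (wtU_D_notin hk hg' kg); exact: isword_wt (isword_D hu).
apply: (@wtU_der_notin _ _ S _ (W (rev g))); last exact: wtU_mon.
by rewrite mem_W ?mem_rev // /small_letters all_rev.
Qed.

End WordElements.

(** * Root vectors *)

Section RootVectors.
Variables (ty : classical_type) (n : nat) (S : qsetup ty n).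
Implicit Types (u v x y : S) (g h : seq nat) (k l : nat).
Local Notation D k := (@der _ _ S (ix n k)).
Local Notation E k := (@gen _ _ S (ix n k)).
Local Notation a := (cartan ty).
Local Notation W := (W n).
Local Notation small_letters := (small_letters n).
Local Notation Ps := (@Psi _ _ S).

Definition prime_vector g u : Prop :=
  is_root_vector (@cbasis _ _ S) (@form _ _ S) Ps (W g) (Ps u).

Lemma map_val_W g : small_letters g -> map val (W g) = g.
Proof.
by elim: g => //= k g IH /andP[hk hg]; rewrite IH // inordK.
Qed.

Lemma small_rcons g k : small_letters (rcons g k) = (k <= n)%N && small_letters g.
Proof. exact: all_rcons. Qed.

Lemma is_min_cf u s : is_min (Ps u) s -> cf u s <> 0.
Proof. by move=> [h _]; apply/eqP. Qed.

Lemma is_min_lt u s t : is_min (Ps u) s -> t <> s -> ~~ word_lt s t -> cf u t = 0.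
Proof.
move=> [_ h] ts st; apply/eqP; case: (cf u t =P 0) => // /eqP/h [//|lt].
by rewrite lt in st.
Qed.

Lemma is_min_isword (c : Qq) g u : c <> 0 -> isword g u -> is_min (Ps (c *: u)) (W g).
Proof.
move=> c0 hu; split.
  by rewrite -/(cf _ _) cfZ hu eqxx mulr1; apply/eqP.
move=> s; rewrite -/(cf _ _) cfZ hu; case: (s =P W g) => [->|_]; first by left.
by rewrite mulr0 eqxx.
Qed.

Lemma root_vector_intro g u C : dualvec u C -> wtU (W g) u -> is_min (Ps u) (W g) ->
  lyndon (W g) ->
  (forall v, wtU (W g) v -> is_min (Ps v) (W g) -> exists c, v = c *: u) ->
  prime_vector g u.
Proof.
move=> [hn hi hb] hw hm hl hp; have hne := is_min_cf hm.
have hd : dual_canonical (@cbasis _ _ S) (@form _ _ S) u.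
  by apply: (dual_canonical_intro hn hi hb); exists (W g).
split=> //.
  exists (wt (W g)), u; split=> // s hs; apply/eqP; rewrite wt_perm.
  by apply: contraNT hs => hs; rewrite -/(cf _ _) hw.
exists u; split=> // v hv hmv.
(* Both vectors pair to 1 with their own basis element. Proportionality forces these elements to
   coincide, and then the factor is 1. *)
have [c vc] := hp v (dual_canonical_homog hv (is_min_cf hmv)) hmv.
have [b Gb kb] := hd; have [b' Gb' kb'] := hv.
have := kb' b' Gb'; rewrite eqxx vc KZl kb //.
case: (b =P b') => _; last by rewrite mulr0 => /esym/eqP; rewrite oner_eq0.
by rewrite mulr1 => ->; rewrite scale1r.
Qed.

Lemma rlt_irr (s : seq nat) : ~~ rlt s s.
Proof. by elim: s => //= i s IH; rewrite ltnn eqxx. Qed.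

(** A proper left factor ends in a letter below [k], and words are compared from the right. *)
Lemma lyndon_last g k : small_letters (rcons g k) -> all (fun l => l < k)%N g ->
  lyndon (W (rcons g k)).
Proof.
move=> hs hg; split; first by rewrite W_rcons; case: (W g).
move=> u v u0 v0 huv.
case/lastP: v v0 huv => // v i _; case/lastP: u u0 => // u j _ huv.
rewrite /word_lt huv !map_rcons !map_cat !map_rcons rev_rcons rev_cat !rev_rcons /=.
move: huv; rewrite W_rcons -rcons_cat => /rcons_inj [hg' <-].
rewrite ixK; last by move: hs; rewrite small_rcons => /andP[].
suff -> : (j < k)%N by [].
have hj : val j \in g.
  rewrite -(map_val_W (g := g)); last by move: hs; rewrite small_rcons => /andP[].
  by apply: map_f; rewrite hg' mem_cat mem_rcons mem_head.
exact: (allP hg).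
Qed.

(** A smaller last letter would give a word below the minimal one, and a larger letter does not
    occur in the weight. *)
Lemma min_sole g k v : small_letters (rcons g k) -> all (fun l => l <= k)%N g ->
  wtU (W (rcons g k)) v -> is_min (Ps v) (W (rcons g k)) -> sole v k.
Proof.
move=> hs hg hv hm l hl lk; have [hkl|hkl] := ltnP k l.
  apply: (wtU_D_notin hl hs _ hv); rewrite mem_rcons inE (negPf lk) /=.
  by apply/negP => /(allP hg); rewrite leqNgt hkl.
have {}hkl : (l < k)%N by rewrite ltn_neqAle lk.
have hk : (k <= n)%N by move: hs; rewrite small_rcons => /andP[].
apply: cf_inj => s; rewrite cf_der cf0; apply: (is_min_lt hm).
  by rewrite W_rcons => /rcons_inj [_ /eqP]; rewrite ix_eq // (negPf lk).
rewrite /word_lt W_rcons !map_rcons !rev_rcons /= !ixK // ltnNge (ltnW hkl) /=.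
by rewrite gtn_eqF.
Qed.

Lemma root_vector_last g k u C : small_letters (rcons g k) -> all (fun l => l < k)%N g ->
  dualvec u C -> wtU (W (rcons g k)) u -> is_min (Ps u) (W (rcons g k)) ->
  (forall v, wtU (W (rcons g k)) v -> sole v k -> exists c, v = c *: u) ->
  prime_vector (rcons g k) u.
Proof.
move=> hs hg hd hw hm hp; apply: (root_vector_intro hd hw hm).
  exact: lyndon_last.
move=> v hv hmv; apply: hp => //; apply: min_sole hv hmv => //.
by apply: sub_all hg => l; apply: ltnW.
Qed.

(** * Chains *)

Lemma prop_sole u v k c : cf u [::] = 0 -> cf v [::] = 0 -> sole u k -> sole v k ->
  D k v = c *: D k u -> v = c *: u.
Proof.
move=> hu hv su sv h; apply: (D_inj_sole (k := k)) => //.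
- by rewrite cfZ hu hv mulr0.
- by move=> l hl lk; rewrite derZ su // scaler0.
by rewrite derZ.
Qed.

Lemma wtU_nilE v : wtU (W [::]) v -> v = cf v [::] *: 1.
Proof.
move=> hv; apply: cf_inj => s; rewrite cfZ cf1; case: s => [|i s]; first by rewrite eqxx mulr1.
by rewrite (wtU_size hv) // mulr0.
Qed.

Lemma cartan_eq0 k l : k != l -> a k l = 0 -> a l k = 0.
Proof.
move=> kl; have lk : l != k by rewrite eq_sym.
have cs : chain_adj l k = chain_adj k l by rewrite /chain_adj orbC.
have fs : fork_adj l k = fork_adj k l.
  by rewrite /fork_adj cs andbCA; congr (_ || _); rewrite orbC andbC [X in _ || X]andbC.
case: ty.
- by rewrite !cartanA // cs; case: chain_adj.
- by rewrite !cartanB // cs; case: chain_adj => //; case: (k == 0%N).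
- by rewrite !cartanC // cs; case: chain_adj => //; case: (l == 0%N).
by rewrite !cartanD // fs; case: fork_adj.
Qed.

(** Chains are listed from their last letter, the direction in which derivations
    remove letters. *)
Fixpoint pathlike (r : seq nat) : bool :=
  if r is k :: r' then
    (if r' is c :: r'' then (a c k != 0) && all (fun l => a k l == 0) r'' else true)
    && pathlike r'
  else true.

(** Between adjacent letters every excluded ending contains a repeated letter, which distinctness
    rules out. *)
Lemma pathlike_isword r : small_letters r -> uniq r -> pathlike r -> exists u, isword (S := S) (rev r) u.
Proof.
elim: r => [|k [|c r] IH]; first by exists 1; apply: isword_nil.
  move=> /= hk _ _; apply: (@word_append _ _ _ [::]) => //; last by exists 1; apply: isword_nil.
  - by rewrite andbT in hk.
  - by move=> l h hl lk; have := slen_gt0 ty lk; case: (slen ty l k) => //; case: h.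
  by move=> l p h hl lk hp; case: h; case: (p).
move=> hs hu /andP[/andP[ack hr] hp].
have hs' := hs; rewrite /= in hs'; case/andP: hs' => hk hs'.
have hu' := hu; rewrite /= in hu'; case/andP: hu'; rewrite inE negb_or => /andP[kc kr] hu'.
have := IH hs' hu' hp; rewrite !rev_cons.
case/andP: hu' => cr _.
apply: word_append_adj => //.
- by rewrite -rev_cons /small_letters all_rev.
- by rewrite eq_sym.
- move=> h hh; move: cr; rewrite -mem_rev hh mem_cat mem_nseq eqxx andbT.
  have ck : c != k by rewrite eq_sym.
  by case: (slenE ty ck) ack => -[-> ->]; rewrite ?orbT.
move=> h hh; move: kr; rewrite -mem_rev hh mem_cat mem_nseq eqxx andbT.
have akc : a k c != 0 by apply: contra ack => /eqP h0; rewrite (cartan_eq0 kc h0).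
by case: (slenE ty kc) akc => -[-> ->]; rewrite ?orbT.
Qed.

(** After [k] is stripped only its neighbour can be stripped: any other remaining letter commutes
    with [k], and could have been stripped before it. *)
Lemma pathlike_prop r u v : small_letters r -> uniq r -> pathlike r -> isword (rev r) u ->
  wtU (W (rev r)) v -> (if r is k :: _ then sole v k else True) -> exists c, v = c *: u.
Proof.
elim: r u v => [|k r IH] u v hs hu hp hw hv hsole.
  by exists (cf v [::]); rewrite (isword_uniq hw (isword_nil S)); apply: wtU_nilE.
rewrite rev_cons in hw hv.
have [hk hs'] : (k <= n)%N /\ small_letters r by move: hs => /andP.
have [kr hu'] : k \notin r /\ uniq r by move: hu => /andP.
have hD : wtU (W (rev r)) (D k v) := wtU_Dr hv.
have hs'' : small_letters (rev r) by rewrite /small_letters all_rev.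
have [||c hc] := IH (D k u) (D k v) hs' hu' _ (isword_D hw) hD.
- by move: hp => /andP[].
- case: r {IH hs hu} hs' hu' kr hp hw hv hD hs'' => //.
  move=> c r hs' hu' kr /andP[/andP[_ ar] _] hw hv hD hs'' l hl lc.
  case: (boolP (l \in c :: r)) => hlr; last by apply: (wtU_D_notin hl hs'' _ hD); rewrite mem_rev.
  have lk : l != k by apply: contraNneq kr => <-.
  have lr : l \in r by move: hlr; rewrite inE (negPf lc).
  have akl : a k l = 0 by apply/eqP; apply: (allP ar).
  by rewrite -(D_comm _ hk hl) 1?eq_sym // hsole // linear0.
exists c; apply: prop_sole hc => //.
- exact: isword_nil_cf hw.
- by apply: wtU_nil hv _; rewrite W_rcons size_rcons.
exact: isword_sole hw.
Qed.

Lemma root_vector_chain g k : small_letters (rcons g k) -> all (fun l => l < k)%N g ->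
  uniq (rcons g k) -> pathlike (rev (rcons g k)) ->
  is_root_vector (@cbasis _ _ S) (@form _ _ S) Ps (W (rcons g k)) (wd (W (rcons g k))).
Proof.
move=> hs hg hu hp.
have hs' : small_letters (rev (rcons g k)) by rewrite /small_letters all_rev.
have hu' : uniq (rev (rcons g k)) by rewrite rev_uniq.
have [u] := pathlike_isword hs' hu' hp; rewrite revK => hw.
have -> : wd (W (rcons g k)) = Ps u.
  by apply: coefwP => s; rewrite coefw_wd -/(cf u s) hw eq_sym.
have hm : is_min (Ps u) (W (rcons g k)).
  by rewrite -[u]scale1r; apply: is_min_isword hw; apply/eqP; apply: oner_neq0.
apply: (root_vector_last hs hg (isword_dualvec_uniq hs hu hw) (isword_wt hw) hm).
move=> v hv hsv; apply: (pathlike_prop hs' hu' hp); rewrite ?revK //.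
by rewrite rev_rcons.
Qed.

(** * Descending along a chain *)

Definition chain_node m : Prop :=
  [/\ a m m.+1 = -1, a m.+1 m = -1 &
      forall l, l != m -> l != m.+1 -> l != m.+2 -> a m.+1 l = 0].

(** Uniqueness for words with repeated letters. The two vanishing conditions take the place of
    distinctness, and are the ones that reproduce themselves when a letter is stripped. *)
Definition descends g u m : Prop := forall x, wtU (W g) x -> sole x m ->
  D m (D m x) = 0 -> ((m < n)%N -> D m.+1 (D m x) = 0) -> exists c, x = c *: u.

(** For x' = e_(m+1)' x the conditions come from the cubic relations at x: e_m' x = 0 yields e_m'^2
    x' = 0, and together with e_(m+1)'^2 x = 0 it yields e_(m+1)' e_m' x' = 0. *)
Lemma descendsS g u m : (m < n)%N -> chain_node m -> (0 < size g)%N ->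
  cf u [::] = 0 -> sole u m.+1 ->
  descends g (D m.+1 u) m -> descends (rcons g m.+1) u m.+1.
Proof.
move=> mn [am am' an] hg u0 us hd x hx xs x2 xp.
have mn' := ltnW mn; have mm : m != m.+1 by rewrite neq_ltn leqnn.
have mm' : m.+1 != m by rewrite eq_sym.
have xm : D m x = 0 by apply: xs.
have [|||c hc] := hd (D m.+1 x) (wtU_Dr hx).
- move=> l hl lm; have [->//|lm1] := eqVneq l m.+1.
  have [lm2|lm2] := eqVneq l m.+2; first by rewrite lm2 xp // -lm2.
  by rewrite -(D_comm _ mn hl) 1?eq_sym ?an // xs // linear0.
- by have := D_serre1 x mn' mn mm am; rewrite xm !linear0 addr0.
- move=> _; have := D_serre1 x mn mn' mm' am'; rewrite xm x2 !linear0 addr0 => /esym/eqP.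
  rewrite scaler_eq0 (negPf (qint_neq0 ty _ 1)) /= => /eqP.
  by [].
exists c; apply: prop_sole hc => //.
by apply: wtU_nil hx _; rewrite W_rcons size_rcons.
Qed.

Lemma descends_root g u m v : (m <= n)%N -> small_letters g -> all (fun l => l < m)%N g ->
  descends (rcons g m) u m -> wtU (W (rcons g m)) v -> sole v m -> exists c, v = c *: u.
Proof.
move=> mn hs hg hd hv hsv; apply: hd => //.
  apply: (wtU_D_notin mn hs _ (wtU_Dr hv)).
  by apply/negP => /(allP hg); rewrite ltnn.
move=> mn'; apply: (wtU_D_notin mn' hs _ (wtU_Dr hv)).
by apply/negP => /(allP hg); rewrite ltnNge leqnSn.
Qed.

End RootVectors.

(** * Segments *)

Section Segments.
Implicit Types (i j k l m : nat).

Lemma up_rcons i j : (i <= j.+1)%N -> up i j.+1 = rcons (up i j) j.+1.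
Proof.
move=> ij; rewrite /up subSn // -addn1 iotaD cats1 /=.
by congr rcons; lia.
Qed.

Lemma up_cons i j : (i <= j)%N -> up i j = i :: up i.+1 j.
Proof. by move=> ij; rewrite /up subSn //= subSS. Qed.

Lemma up_nil i j : (j < i)%N -> up i j = [::].
Proof. by move=> ij; rewrite /up; have -> : (j.+1 - i = 0)%N by lia. Qed.

Lemma mem_up i j k : (k \in up i j) = (i <= k <= j)%N.
Proof. by rewrite mem_iota; lia. Qed.

Lemma uniq_up i j : uniq (up i j).
Proof. exact: iota_uniq. Qed.

Lemma down_rcons i j : (i <= j)%N -> down j i = rcons (down j i.+1) i.
Proof. by move=> ij; rewrite /down up_cons // rev_cons. Qed.

Lemma up_last i j : (i <= j)%N -> exists2 g, up i j = rcons g j & all (fun l => l < j)%N g.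
Proof.
case: j => [|j] ij; first by exists [::] => //; have -> : i = 0%N by lia.
by exists (up i j); [exact: up_rcons | apply/allP => l; rewrite mem_up => /andP[]].
Qed.

Lemma small_up n i j : (j <= n)%N -> small_letters n (up i j).
Proof. by move=> jn; apply/allP => k; rewrite mem_up => /andP[_ kj]; apply: leq_trans jn. Qed.

Lemma small_down n i j : (j <= n)%N -> small_letters n (down j i).
Proof. by move=> jn; rewrite /small_letters all_rev; apply: small_up. Qed.

Variable ty : classical_type.
Local Notation a := (cartan ty).

Lemma pathlike_rcons r k c : pathlike ty (rcons r k) -> a c k != 0 ->
  all (fun l => a l c == 0) r -> pathlike ty (rcons (rcons r k) c).
Proof.
elim: r => [|l r IH] /=; first by move=> _ -> _.
move=> /andP[h1 h2] hc /andP[hl hr]; rewrite IH // andbT.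
by case: r h1 {IH h2 hr} => [|l' r] /= /andP[-> h] /=; rewrite ?hl // all_rcons hl.
Qed.

Lemma pathlike_rev_up i j :
  (forall k, (i <= k)%N -> a k k.+1 != 0) ->
  (forall k l, (i <= l < k)%N -> a k.+1 l = 0) -> pathlike ty (rev (up i j)).
Proof.
have [k] := ubnP (j.+1 - i); elim: k i => // k IH i hk h1 h2.
have [ij|ij] := leqP i j; last by rewrite up_nil.
have h : pathlike ty (rev (up i.+1 j)).
  by apply: IH => [|l hl|l l' hl]; [lia | apply: h1; lia | apply: h2; lia].
rewrite up_cons // rev_cons; have [ij'|ij'] := leqP i.+1 j; last by rewrite up_nil.
move: h; rewrite up_cons // rev_cons => h; apply: pathlike_rcons => //; first exact: h1.
apply/allP => l; rewrite mem_rev mem_up => hl; case: l hl => // l hl.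
by apply/eqP/h2; lia.
Qed.

Lemma pathlike_rev_cons_up c i j : pathlike ty (rev (up i j)) ->
  a c i != 0 -> (forall k, (i < k)%N -> a k c = 0) -> pathlike ty (rev (c :: up i j)).
Proof.
move=> h hc hk; rewrite rev_cons; have [ij|ij] := leqP i j; last by rewrite up_nil.
move: h; rewrite up_cons // rev_cons => h; apply: pathlike_rcons => //.
by apply/allP => l; rewrite mem_rev mem_up => /andP[hl _]; rewrite hk.
Qed.

Lemma pathlike_up i j :
  (forall k, (i <= k)%N -> a k.+1 k != 0) ->
  (forall k l, (i <= k)%N -> (k.+1 < l)%N -> a k l = 0) -> pathlike ty (up i j).
Proof.
have [k] := ubnP (j.+1 - i); elim: k i => // k IH i hk h1 h2.
have [ij|ij] := leqP i j; last by rewrite up_nil.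
rewrite up_cons //=; have -> : pathlike ty (up i.+1 j).
  by apply: IH => [|l hl|l l' hl hl']; [lia | apply: h1; lia | apply: h2; lia].
have [ij'|ij'] := leqP i.+1 j; last by rewrite up_nil.
rewrite up_cons // h1 // andbT; apply/allP => l; rewrite mem_up => hl.
by apply/eqP/h2; lia.
Qed.

Lemma pathlike_cons_up c i j :
  a i c != 0 -> (forall l, (i < l)%N -> a c l = 0) -> pathlike ty (up i j) ->
  pathlike ty (c :: up i j).
Proof.
move=> h1 h2 h3 /=; rewrite h3 andbT.
have [ij|ij] := leqP i j; last by rewrite up_nil.
rewrite up_cons // h1 /=; apply/allP => l; rewrite mem_up => hl.
by apply/eqP/h2; lia.
Qed.

End Segments.

Lemma chain_adjS i : chain_adj i i.+1.
Proof. by rewrite /chain_adj eqxx. Qed.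

(** * Types A, B and C: linear diagrams *)

Section LinearDiagrams.
Variable ty : classical_type.
Hypothesis linear : ty <> typeD.
Local Notation a := (cartan ty).

Lemma cartan_up k : a k k.+1 != 0.
Proof.
have h := chain_adjS k; have n1 : k != k.+1 by rewrite neq_ltn leqnn.
case: ty linear => // _; rewrite ?(cartanA n1) ?(cartanB n1) ?(cartanC n1) h //.
by case: (k == 0%N).
Qed.

Lemma cartan_far k l : (k.+1 < l)%N -> a k l = 0 /\ a l k = 0.
Proof.
move=> hk; have n1 : k != l by rewrite neq_ltn; lia.
have n2 : l != k by rewrite eq_sym.
have h1 : chain_adj k l = false by rewrite /chain_adj; lia.
have h2 : chain_adj l k = false by rewrite /chain_adj; lia.
case: ty linear => // _; rewrite ?(cartanA n1) ?(cartanB n1) ?(cartanC n1)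
 ?(cartanA n2) ?(cartanB n2) ?(cartanC n2) h1 h2 //.
Qed.

Lemma cartan_down k : a k.+1 k != 0.
Proof.
apply/eqP => h; have := cartan_up k.
have n1 : k.+1 != k by rewrite neq_ltn leqnn orbT.
by rewrite (cartan_eq0 n1 h) eqxx.
Qed.

Lemma linear_rev_up i j : pathlike ty (rev (up i j)).
Proof.
apply: pathlike_rev_up => [k _|k l hl]; first exact: cartan_up.
by have [|] := @cartan_far l k.+1; first lia.
Qed.

Lemma linear_up i j : pathlike ty (up i j).
Proof.
apply: pathlike_up => [k _|k l _ hl]; first exact: cartan_down.
by have [] := cartan_far hl.
Qed.

Lemma linear_chain_node m : (0 < m)%N -> chain_node ty m.
Proof.
move=> m0; have n1 : m != m.+1 by rewrite neq_ltn leqnn.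
have n2 : m.+1 != m by rewrite eq_sym.
have h1 := chain_adjS m; have h2 : chain_adj m.+1 m by rewrite /chain_adj eqxx orbT.
have m0' : (m == 0%N) = false by lia.
split=> [||l l1 l2 l3].
- by case: ty linear => // _; rewrite ?(cartanA n1) ?(cartanB n1) ?(cartanC n1) h1 ?m0'.
- by case: ty linear => // _; rewrite ?(cartanA n2) ?(cartanB n2) ?(cartanC n2) h2 ?m0'.
have [hl|hl] := ltnP l m; first by have [|] := @cartan_far l m.+1.
by have [|] := @cartan_far m.+1 l; first lia.
Qed.

Variables (n : nat) (S : qsetup ty n).
Implicit Types (u v x y : S) (g h : seq nat) (k l : nat).
Local Notation D k := (@der _ _ S (ix n k)).
Local Notation E k := (@gen _ _ S (ix n k)).
Local Notation W := (W n).
Local Notation Ps := (@Psi _ _ S).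

Lemma root_vector_up i j : (i <= j <= n)%N ->
  is_root_vector (@cbasis _ _ S) (@form _ _ S) Ps (W (up i j)) (wd (W (up i j))).
Proof.
move=> /andP[ij jn].
have [g e hall] := up_last ij.
rewrite e; apply: root_vector_chain; rewrite // -e.
- exact: small_up.
- exact: uniq_up.
exact: linear_rev_up.
Qed.

(** * Words turning at the node 0 *)

(** Beyond node 1 all bonds are simple, so the excluded endings concern only the letter before the
    last. *)
Lemma turn_isword h m : small_letters n (rcons h 0%N) -> (m < n)%N ->
  (exists u, isword (S := S) (rcons h 0%N ++ [:: 1%N]) u) ->
  exists u, isword (S := S) (rcons h 0%N ++ up 1 m.+1) u.
Proof.
move=> hs + h1; elim: m => [//|m IH] mn.
have [am am' _] := linear_chain_node (ltn0Sn m).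
rewrite up_rcons // -rcons_cat.
have [x hx] := IH (ltnW mn).
have e : rcons h 0%N ++ up 1 m.+1 = rcons (rcons h 0%N ++ up 1 m) m.+1.
  by rewrite up_rcons // rcons_cat.
rewrite e in hx *.
have lst l : (0 < l)%N -> l != m -> forall h', rcons h 0%N ++ up 1 m <> h' ++ [:: l].
  move=> l0 lm h'; case: m lm {IH mn am am' hx e} => [|m] lm;
    rewrite ?cats0 ?up_rcons // -?rcons_cat cats1.
    by move=> /rcons_inj [_ l00]; rewrite -l00 in l0.
  by move=> /rcons_inj [_ l00]; rewrite -l00 eqxx in lm.
apply: word_append_adj => //; last by exists x.
- by rewrite -e small_cat hs; apply: small_up; apply: ltnW.
- by rewrite neq_ltn leqnn.
- by rewrite /slen am /=; apply: lst; rewrite // neq_ltn leqnn orbT.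
by rewrite /slen am' /=; apply: lst; rewrite // neq_ltn; lia.
Qed.

Lemma turn_dualvec (s : Qq) h m u : small_letters n (rcons h 0%N) -> (m <= n)%N ->
  (forall u, isword (rcons h 0%N) u -> exists C, dualvec (s *: u) C) ->
  isword (rcons h 0%N ++ up 1 m) u -> exists C, dualvec (s *: u) C.
Proof.
move=> hs + h1; elim: m u => [|m IH] u mn; first by rewrite cats0; apply: h1.
rewrite up_rcons // -rcons_cat => hu.
have [C hC] := IH _ (ltnW mn) (isword_D hu).
apply: (@dualvec_sole _ _ S _ C m.+1) => //.
- by move=> l hl lm; rewrite derZ (isword_sole mn hu) // scaler0.
- by rewrite cfZ (isword_nil_cf hu) mulr0.
- rewrite !derZ; case: m hu {IH} mn {hC} => [|m] hu mn.
    rewrite cats0 in hu; rewrite (isword_D2 mn _ _ hu) ?scaler0 //.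
  rewrite up_rcons // -rcons_cat in hu.
  rewrite (isword_D2 mn _ _ hu) ?scaler0 //; first exact: ltnW.
  by rewrite neq_ltn leqnn.
by rewrite derZ.
Qed.

Lemma turn_rcons h m : rcons h 0%N ++ up 1 m.+1 = rcons (rcons h 0%N ++ up 1 m) m.+1.
Proof. by rewrite up_rcons // rcons_cat. Qed.

Lemma turn_descends h m u : small_letters n (rcons h 0%N) -> (m < n)%N ->
  (forall u, isword (rcons h 0%N ++ [:: 1%N]) u -> descends (rcons h 0%N ++ [:: 1%N]) u 1) ->
  isword (rcons h 0%N ++ up 1 m.+1) u -> descends (rcons h 0%N ++ up 1 m.+1) u m.+1.
Proof.
move=> hs + h1; elim: m u => [|m IH] u mn; first exact: h1.
rewrite turn_rcons => hu; apply: descendsS => //.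
- exact: linear_chain_node.
- by rewrite size_cat size_rcons.
- exact: isword_nil_cf hu.
- exact: isword_sole hu.
by apply: IH (isword_D hu); apply: ltnW.
Qed.

(** The ascending part is the same in types B and C. The hypotheses isolate what depends on the
    double bond: existence and uniqueness up to the letter 1 after the turn, and duality up to 0. *)
Lemma turn_root_vector (s : Qq) h k : s <> 0 -> small_letters n (rcons h 0%N) ->
  (k < n)%N -> all (fun l => l <= k)%N h ->
  (exists u, isword (S := S) (rcons h 0%N ++ [:: 1%N]) u) ->
  (forall u, isword (rcons h 0%N) u -> exists C, dualvec (s *: u) C) ->
  (forall u, isword (rcons h 0%N ++ [:: 1%N]) u -> descends (rcons h 0%N ++ [:: 1%N]) u 1) ->
  is_root_vector (@cbasis _ _ S) (@form _ _ S) Ps (W (rcons h 0%N ++ up 1 k.+1))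
    (s *: wd (W (rcons h 0%N ++ up 1 k.+1))).
Proof.
move=> s0 hs kn hk h1 h2 h3.
have [u hu] := turn_isword hs kn h1.
have -> : s *: wd (W (rcons h 0%N ++ up 1 k.+1)) = Ps (s *: u).
  apply: coefwP => t; rewrite -/(cf _ _) cfZ hu /coefw mcoeffZ -/(coefw _ _) coefw_wd.
  by rewrite eq_sym.
have hd := turn_descends hs kn h3 hu.
have [C hC] := turn_dualvec hs kn h2 hu.
have hm := is_min_isword s0 hu; have hw := isword_wt hu.
have hs' : small_letters n (rcons (rcons h 0%N ++ up 1 k) k.+1).
  by rewrite -turn_rcons small_cat hs; apply: small_up.
have hall : all (fun l => l < k.+1)%N (rcons h 0%N ++ up 1 k).
  rewrite all_cat all_rcons /= hk /=.
  by apply/allP => l; rewrite mem_up => /andP[].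
move: hd hm hw; rewrite turn_rcons => hd hm hw.
apply: (root_vector_last hs' hall hC _ hm).
  exact: wtUZ hw.
have hs2 : small_letters n (rcons h 0%N ++ up 1 k).
  by move: hs'; rewrite small_rcons => /andP[].
move=> v hv sv; have [c ->] := descends_root kn hs2 hall hd hv sv.
by exists (c / s); rewrite scalerA mulfVK //; apply/eqP.
Qed.

End LinearDiagrams.

(** * Commutation relations *)

Section Commutation.
Variables (ty : classical_type) (n : nat) (S : qsetup ty n).
Implicit Types (u v x y p w : S) (g h s : seq nat) (k l : nat).
Local Notation D k := (@der _ _ S (ix n k)).
Local Notation E k := (@gen _ _ S (ix n k)).
Local Notation ft k := (ftilde ty (@gen _ _ S) (@der _ _ S) (ix n k)).
Local Notation W := (W n).
Local Notation small_letters := (small_letters n).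

Definition wpair k s : int := \sum_(l <- s) sform ty k l.

Lemma wpair_W k s : (k <= n)%N -> small_letters s ->
  \sum_(l <- W s) sform ty (ix n k) l = wpair k s.
Proof.
move=> hk hs; rewrite /wpair big_map; apply: eq_big_seq => l hl.
by rewrite !ixK //; apply: (allP hs).
Qed.

Lemma D_genM k l x : (k <= n)%N -> (l <= n)%N ->
  D k (E l * x) = (k == l)%:R *: x + q ^ (- sform ty k l) *: (E l * D k x).
Proof. by move=> hk hl; rewrite der_genM ix_eq // !ixK. Qed.

Lemma D_Mgen s k l x : (k <= n)%N -> (l <= n)%N -> small_letters s -> wtU (W s) x ->
  D k (x * E l) = D k x * E l + (k == l)%:R *: (q ^ (- wpair k s) *: x).
Proof. by move=> hk hl hs hx; rewrite (der_Mgen _ _ hx) ix_eq // wpair_W. Qed.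

Lemma isword_gen k : (k <= n)%N -> isword [:: k] (E k * 1).
Proof.
move=> hk; apply: (@isword_cons _ _ _ [::]) => //.
- by rewrite D_genM // eqxx scale1r der1 mulr0 scaler0 addr0; apply: isword_nil.
- exact: cf_gen_mul_nil.
by move=> l hl lk; rewrite D_genM // (negPf lk) scale0r der1 mulr0 scaler0 addr0.
Qed.

Lemma wtU_rem k s x : wtU (W s) x -> k \in s -> wtU (W (rem k s)) (D k x).
Proof.
move=> hx ks; apply: wtU_D; apply: wtU_perm hx.
exact: perm_map (perm_to_rem ks).
Qed.

Lemma gen_comm k s x : (k <= n)%N -> small_letters s -> k \notin s ->
  (forall l, l \in s -> sform ty k l = 0) -> wtU (W s) x -> E k * x = x * E k.
Proof.
move=> hk; have [m] := ubnP (size s); elim: m s x => // m IH s x hm hs ks hc hx.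
apply: D_inj => [|l hl]; first by rewrite cf_gen_mul_nil cf_Mgen_nil.
rewrite D_genM // (D_Mgen hl hk hs hx).
have [->|lk] := eqVneq l k.
  rewrite (wtU_D_notin hk hs ks hx) mulr0 mul0r scaler0 addr0 add0r.
  suff -> : wpair k s = 0 by rewrite oppr0 expr0z !scale1r.
  by apply: big1_seq => l' /andP[_ hl']; apply: hc.
rewrite !scale0r add0r addr0; case: (boolP (l \in s)) => ls; last first.
  by rewrite (wtU_D_notin hl hs ls hx) mulr0 mul0r scaler0.
rewrite sform_sym hc // oppr0 expr0z scale1r; apply: (IH (rem l s)).
- by rewrite size_rem //; case: (s) hm ls.
- by apply/allP => l' /mem_rem; apply: (allP hs).
- by apply: contra ks => /mem_rem.
- by move=> l' /mem_rem; apply: hc.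
exact: wtU_rem.
Qed.

(** [p - e_k w = q^4 p - q^2 w e_k]. *)
Lemma dsmall_twist p w k s : (k <= n)%N -> qint ty (ix n k) 2 = q + q^-1 ->
  small_letters s -> k \notin s -> (forall l, count_mem l s <= 2)%N ->
  wtU (W s) w -> dreg w -> dreg p ->
  E k * w - q ^+ 2 *: (w * E k) = (1 - q ^+ 4) *: p ->
  dsmall ((qint ty (ix n k) 2 - 1) *: (p - E k * w)).
Proof.
move=> hk q2 hs ks hc hw rw rp he.
have -> : p - E k * w = q ^+ 4 *: p + (- q ^+ 2) *: (w * E k).
  move: he => /eqP; rewrite subr_eq => /eqP ->; rewrite scalerBl scale1r.
  by rewrite opprD opprB addrA [p + _]addrC subrK scaleNr.
have qV : q * q^-1 = 1 by apply: mulfV; apply: q_neq0.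
have e2 : (q + q^-1 - 1) * q ^+ 2 = q * (q ^+ 2 + 1 - q).
  rewrite mulrBl mulrDl !exprS expr0 !mulr1 mul1r (mulrA q^-1) (mulrC q^-1) qV mul1r.
  by rewrite !mulrDr mulrN mulr1.
(* The simple pole of [2] at q = 0 is outweighed by q^2. *)
have s2 : small ((q + q^-1 - 1) * q ^+ 2).
  exists (q ^+ 2 + 1 - q) => //; apply: regB; last exact: regq1.
  by apply: regD; [apply: regX; apply: regq1 | apply: reg1].
rewrite q2 scalerDr !scalerA mulrN; apply: dsmallD; apply: dsmallZ => //.
- rewrite -[4%N]/(2 + 2)%N exprD mulrA; apply: smallMr s2 _; apply: regX; exact: regq1.
- exact: smallN.
apply: (dreg_Mgen rw hw); last by rewrite mem_W.
apply: forall_ix => l hl; rewrite count_W //; exact: hc.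
Qed.

Lemma dualvec_double u p w C0 C1 C2 k : (k <= n)%N -> sole u k -> cf u [::] = 0 ->
  dualvec p C1 -> dualvec w C0 -> D k u = qint ty (ix n k) 2 *: p -> D k p = w -> D k w = 0 ->
  dsmall ((qint ty (ix n k) 2 - 1) *: (p - E k * w)) -> ft k C1 C2 -> dualvec u C2.
Proof.
move=> hk hs h0 hp [_ hw _] du dp dw hsm hft; apply: dualvec_step => //; apply: forall_ix => l hl.
have [->|lk] := eqVneq l k; last by constructor 1; apply: hs.
by apply: (DualvecDouble hp du dp dw hw hsm hft); rewrite subrr; apply: qL0.
Qed.

End Commutation.

Lemma sform_far (ty : classical_type) k l : ty <> typeD -> (k.+1 < l)%N ->
  sform ty k l = 0 /\ sform ty l k = 0.
Proof.
move=> hty kl; have n1 : (k == l) = false by lia.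
have n2 : (l == k) = false by lia.
have h1 : chain_adj k l = false by rewrite /chain_adj; lia.
have h2 : chain_adj l k = false by rewrite /chain_adj; lia.
by case: ty hty => //; rewrite /sform n1 n2 h1 h2.
Qed.

(** * Root vectors of types B and C turning at 0 *)

Section TurningWords.
Variables (ty : classical_type) (n : nat) (S : qsetup ty n).
Hypothesis linear : ty <> typeD.
Implicit Types (u v x y p w : S) (g h s : seq nat) (k l j : nat).
Local Notation D k := (@der _ _ S (ix n k)).
Local Notation E k := (@gen _ _ S (ix n k)).
Local Notation W := (W n).
Local Notation a := (cartan ty).
Local Notation small_letters := (small_letters n).

Lemma sole_after_1 x : (0 < n)%N -> sole x 1 -> D 1 (D 1 x) = 0 ->
  ((1 < n)%N -> D 2 (D 1 x) = 0) -> sole (D 1 x) 0.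
Proof.
move=> n0 xs x2 xp l hl l0; have [->//|l1] := eqVneq l 1%N.
have [l2|l2] := eqVneq l 2%N; first by rewrite l2 xp //; rewrite l2 in hl.
have [c1 c2] : a l 1 = 0 /\ a 1 l = 0 by have [|h1 h2] := @cartan_far ty linear 1 l; first lia.
by rewrite D_comm // xs // linear0.
Qed.

Lemma down_isword i j : (j <= n)%N -> exists u, isword (S := S) (down j i) u.
Proof.
move=> jn; apply: pathlike_isword; first exact: small_up.
  exact: uniq_up.
exact: linear_up.
Qed.

Lemma turn_small j : (j <= n)%N -> small_letters (rcons (down j 1) 0%N).
Proof. by move=> jn; rewrite small_rcons /=; apply: small_down. Qed.

Lemma turn_base j u : (0 < n)%N -> (j <= n)%N -> isword (rcons (down j 0) 1%N) u ->
  descends (rcons (down j 0) 1%N) u 1.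
Proof.
move=> n0 jn hu x hx xs x2 xp.
have x1s := sole_after_1 n0 xs x2 xp.
have [||c hc] := pathlike_prop _ (uniq_up 0 j) (linear_up linear 0 j) (isword_D hu) (wtU_Dr hx).
- exact: small_up.
- by rewrite up_cons.
exists c; apply: prop_sole hc => //.
- exact: isword_nil_cf hu.
- by apply: wtU_nil hx _; rewrite W_rcons size_rcons.
exact: isword_sole hu.
Qed.

End TurningWords.

Section TypeC.
Variables (n : nat) (S : qsetup typeC n).
Local Notation W := (W n).
Local Notation Ps := (@Psi _ _ S).

Lemma root_vector_C2 j k : (1 <= j)%N -> (j < k <= n)%N ->
  is_root_vector (@cbasis _ _ S) (@form _ _ S) Ps (W (down j 1 ++ [:: 0%N] ++ up 1 k))
    (wd (W (down j 1 ++ [:: 0%N] ++ up 1 k))).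
Proof.
move=> j1 /andP[jk kn]; rewrite catA cats1 -[wd _]scale1r.
have jn : (j <= n)%N by apply: leq_trans kn; apply: ltnW.
have n0 : (0 < n)%N by apply: leq_trans jn.
have lin : typeC <> typeD by [].
have e0 : rcons (down j 1) 0%N = down j 0 by rewrite -down_rcons.
case: k jk kn => // k jk kn; apply: turn_root_vector => //.
- exact/eqP/oner_neq0.
- exact: turn_small.
- by apply/allP => l; rewrite mem_rev mem_up => /andP[_ h]; apply: leq_trans h _.
- rewrite cats1; apply: word_append_adj => //; last by rewrite e0; apply: down_isword.
  + exact: turn_small.
  + move=> h; rewrite /slen cartanC //= cats1 => hh.
    have : 0%N \in down j 1 by rewrite hh mem_rcons mem_head.
    by rewrite mem_rev mem_up.
  (* Here a_10 = -2, so the excluded ending has two letters 1 before the 0. *)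
  move=> h; rewrite /slen cartanC //= => hh.
  by have := uniq_up 1 j; rewrite -rev_uniq -/(down j 1) hh cat_uniq => /and3P[_ _].
- move=> u; rewrite e0 scale1r => hu; eexists; apply: isword_dualvec_uniq hu.
    exact: small_down.
  by rewrite rev_uniq uniq_up.
by move=> u; rewrite cats1 e0; apply: turn_base.
Qed.

End TypeC.

Section TypeB.
Variables (n : nat) (S : qsetup typeB n).
Implicit Types (u v x y p w : S) (g h s : seq nat) (k l j : nat).
Local Notation D k := (@der _ _ S (ix n k)).
Local Notation E k := (@gen _ _ S (ix n k)).
Local Notation W := (W n).
Local Notation Ps := (@Psi _ _ S).
Let lin : typeB <> typeD. Proof. by []. Qed.

Lemma ix0 m : val (ix m 0) = 0%N. Proof. exact: ixK. Qed.

Lemma qint2_B : qint typeB (ix n 0) 2 = q + q^-1.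
Proof. by rewrite qint2 ix0 /qi /dsym /= expr1z. Qed.

(** Both sides have the same derivatives. At 0 the weight of [w] contributes q^2, which makes 1 -
    q^4; at 1 the twist q^2 of the first term matches the coefficient of the second, as e_0 commutes
    with what is left of [w]. *)
Lemma twist_B j v w : (0 < j <= n)%N -> isword (down j 0) v -> isword (down j 1) w ->
  E 0 * w - q ^+ 2 *: (w * E 0) = (1 - q ^+ 4) *: v.
Proof.
move=> /andP[j0 jn] hv hw.
have n0 : (0 < n)%N by apply: leq_trans jn.
have hs i : small_letters n (down j i) by apply: small_down.
have hww := isword_wt hw.
have w0 : D 0 w = 0 by apply: (wtU_D_notin _ (hs 1%N) _ hww); rewrite // mem_rev mem_up.
have ev : D 0 v = w by apply: isword_uniq (isword_D _) hw; rewrite -down_rcons.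
have vs : sole v 0 by apply: (@isword_sole _ _ _ (down j 1)); rewrite -?down_rcons.
have ws : sole w 1 by apply: (@isword_sole _ _ _ (down j 2)); rewrite -?down_rcons.
apply: D_inj => [|l hl].
  rewrite cfB !cfZ cf_gen_mul_nil cf_Mgen_nil mulr0 subrr.
  rewrite (isword_nil_cf (g := down j 1) (k := 0%N)) ?mulr0 // -down_rcons //.
rewrite linearB !derZ D_genM // (D_Mgen hl _ (hs 1%N) hww) //.
have [->|l0] := eqVneq l 0%N.
  rewrite w0 ev mulr0 mul0r scaler0 addr0 add0r !scale1r scalerA.
  have -> : wpair typeB 0 (down j 1) = -2.
    rewrite down_rcons // /wpair -cats1 big_cat big_seq1 big1_seq //= => l'.
    by rewrite mem_rev mem_up => /andP[h _]; have [] := @sform_far typeB 0 l' lin h.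
  by rewrite -exprnP -exprD scalerBl scale1r.
rewrite vs // scaler0 scale0r add0r /= scale0r addr0.
have [->|l1] := eqVneq l 1%N; last by rewrite ws // mulr0 mul0r !scaler0 subrr.
have h2 : wtU (W (down j 2)) (D 1 w) by apply: wtU_Dr; rewrite -down_rcons.
rewrite (gen_comm _ (hs 2%N) _ _ h2) //= ?subrr // ?mem_rev ?mem_up //.
by move=> l'; rewrite mem_rev mem_up => /andP[h _]; have [] := @sform_far typeB 0 l' lin h.
Qed.

Lemma turn_dualvec_B j u : (j <= n)%N -> isword (rcons (down j 0) 0%N) u ->
  exists C, dualvec (qint typeB 0 2 *: u) C.
Proof.
move=> jn hu; set U := _ *: u.
have hs i : small_letters n (down j i) by apply: small_down.
have us i : uniq (down j i) by rewrite rev_uniq uniq_up.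
have hp := isword_D hu; set p := D 0 u in hp.
have q20 : qint typeB 0 2 = qint typeB (ix n 0) 2 by rewrite ix0.
have hw : isword (down j 1) (D 0 p) by apply: isword_D; rewrite -down_rcons.
have dp := isword_dualvec_uniq (hs 0%N) (us 0%N) hp.
have dw := isword_dualvec_uniq (hs 1%N) (us 1%N) hw.
have w0 : D 0 (D 0 p) = 0.
  by apply: (wtU_D_notin _ (hs 1%N) _ (isword_wt hw)); rewrite // mem_rev mem_up.
have [C hC] := ftilde_total (ix n 0) (mon S (W (rev (down j 0)))).
exists C; apply: (dualvec_double _ _ _ dp dw _ _ w0 _ hC) => //.
- by move=> l hl l0; rewrite derZ (isword_sole _ hu) // scaler0.
- by rewrite cfZ (isword_nil_cf hu) mulr0.
- by rewrite derZ q20.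
(* For j = 0 the vector [p] is e_0 itself and [D 0 p] is 1, so the difference is exactly 0. *)
have [j0|j0] := posnP j.
  have p1 : D 0 p = 1 by apply: isword_uniq hw _; rewrite j0; apply: isword_nil.
  have -> : p = E 0 * 1.
    by apply: (isword_uniq hp); rewrite j0; apply: isword_gen.
  rewrite D_genM // der1 mulr0 scaler0 addr0 eqxx scale1r subrr scaler0; exact: dsmall0.
apply: (dsmall_twist _ qint2_B (hs 1%N) _ _ (isword_wt hw)) => //.
- by rewrite mem_rev mem_up.
- by move=> l; rewrite count_uniq_mem //; case: (_ \in _).
- by case: dw => /nice_dreg.
- by case: dp => /nice_dreg.
by apply: twist_B hp hw; rewrite j0.
Qed.

Lemma root_vector_B2 j k : (j < k <= n)%N ->
  is_root_vector (@cbasis _ _ S) (@form _ _ S) Ps (W (down j 0 ++ up 0 k))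
    (qint typeB 0 2 *: wd (W (down j 0 ++ up 0 k))).
Proof.
move=> /andP[jk kn]; rewrite (up_cons (leq0n k)) -cat_rcons.
have jn : (j <= n)%N by apply: leq_trans kn; apply: ltnW.
have n0 : (0 < n)%N by apply: leq_trans kn; case: (k) jk.
case: k jk kn => // k jk kn.
have e0 : rcons (down j 1) 0%N = down j 0 by rewrite -down_rcons.
have hsm : small_letters n (rcons (down j 0) 0%N) by rewrite small_rcons /= small_down.
have cnt : count_mem 0%N (down j 0) = 1%N.
  by rewrite count_uniq_mem ?rev_uniq ?uniq_up // mem_rev mem_up.
apply: turn_root_vector => //.
- rewrite -(ix0 n); exact/eqP/qint_neq0.
- by apply/allP => l; rewrite mem_rev mem_up => /andP[_ h]; apply: leq_trans h _.
- rewrite cats1; apply: word_append_adj => //.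
  + move=> h; rewrite /slen cartanB //= => hh.
    by move: cnt; rewrite hh count_cat /= addnC.
  + move=> h; rewrite /slen cartanB //= -e0 cats1 => /rcons_inj [].
    by [].
  apply: word_append => //.
  + exact: small_down.
  + move=> l h hl l0; rewrite -e0 -(prednK (slen_gt0 _ l0)) => /last_rcons_cat [l00].
    by rewrite -l00 eqxx in l0.
  (* For l = 1 one has a_01 = -2, and the excluded endings contain two letters 0 against one in the
     word; the other l commute with 0 and would have to be the last letter. *)
  + move=> l i h hl l0 hi hh; have l0' : 0%N != l by rewrite eq_sym.
    have := congr1 (count_mem 0%N) hh; rewrite cnt !count_cat /= !count_nseq /= (negPf l0).
    case: (slenE typeB l0') => -[ha hsl]; move: hi hh; rewrite hsl; try lia.
    * case: i => // _; rewrite /= -e0 cats1 => /rcons_inj [_ l00].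
      by rewrite l00 eqxx in l0.
    * by move: ha; rewrite cartanB //; case: chain_adj.
  exact: down_isword.
- by move=> u; apply: turn_dualvec_B.
move=> u; rewrite cats1 => hu x hx xs x2 xp.
have x1s := sole_after_1 lin n0 xs x2 xp.
have hu1 := isword_D hu; have hu0 := isword_D hu1.
have hx1 := wtU_Dr hx; have hx0 := wtU_Dr hx1.
(* After 1 and 0 only 0 can follow: 1 is excluded by the cubic relation, as a_10 = -1, and larger
   letters commute with 0. *)
have hy : sole (D 0 (D 1 x)) 0.
  move=> l hl l0; have [->|l1] := eqVneq l 1%N.
    have a10 : cartan typeB 1 0 = -1 by rewrite cartanB.
    have := D_serre1 x n0 (leq0n n) (isT : 1%N != 0%N) a10.
    rewrite (xs 0%N) // x2 !linear0 addr0 => /esym/eqP.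
    by rewrite scaler_eq0 (negPf (qint_neq0 _ _ 1)) => /eqP.
  have [c1 c2] : cartan typeB l 0 = 0 /\ cartan typeB 0 l = 0.
    by have [|h1 h2] := @cartan_far typeB lin 0 l; first lia.
  by rewrite D_comm // x1s // linear0.
have [||c hc] := pathlike_prop _ (uniq_up 0 j) (linear_up lin 0 j) hu0 hx0.
- exact: small_up.
- by rewrite up_cons.
have hc1 : D 1 x = c *: D 1 u.
  apply: prop_sole hc => //.
  - exact: isword_nil_cf hu1.
  - by apply: wtU_nil hx1 _; rewrite W_rcons size_rcons.
  exact: isword_sole hu1.
exists c; apply: prop_sole hc1 => //.
- exact: isword_nil_cf hu.
- by apply: wtU_nil hx _; rewrite W_rcons size_rcons.
exact: isword_sole hu.
Qed.

End TypeB.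

(** * Type D *)

Lemma fork_adj_sym k l : fork_adj k l = fork_adj l k.
Proof. by apply/idP/idP; rewrite /fork_adj /chain_adj; lia. Qed.

Lemma cartanD_eq0 k l : k != l -> ~~ fork_adj k l -> cartan typeD k l = 0.
Proof. by move=> kl h; rewrite cartanD // (negPf h). Qed.

Lemma cartanD_adj k l : k != l -> fork_adj k l -> cartan typeD k l = -1.
Proof. by move=> kl h; rewrite cartanD // h. Qed.

Lemma fork_rev_up i j : (1 <= i)%N -> pathlike typeD (rev (up i j)).
Proof.
move=> i1; apply: pathlike_rev_up => [k ik|k l hl].
  by rewrite cartanD_adj // /fork_adj /chain_adj; lia.
by rewrite cartanD_eq0 // /fork_adj /chain_adj; lia.
Qed.

Lemma fork_up i j : (1 <= i)%N -> pathlike typeD (up i j).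
Proof.
move=> i1; apply: pathlike_up => [k ik|k l ik hl].
  by rewrite cartanD_adj // /fork_adj /chain_adj; lia.
by rewrite cartanD_eq0 // /fork_adj /chain_adj; lia.
Qed.

Lemma fork_cons_rev_up j : pathlike typeD (rev (0%N :: up 2 j)).
Proof.
apply: pathlike_rev_cons_up; first exact: fork_rev_up.
  by rewrite cartanD_adj.
by move=> k hk; rewrite cartanD_eq0 // /fork_adj /chain_adj; lia.
Qed.

Lemma fork_cons_up j : pathlike typeD (0%N :: up 2 j).
Proof.
apply: pathlike_cons_up; last exact: fork_up.
  by rewrite cartanD_adj.
by move=> k hk; rewrite cartanD_eq0 // /fork_adj /chain_adj; lia.
Qed.

Lemma fork_chain_node m : (1 < m)%N -> chain_node typeD m.
Proof.
move=> m1; split=> [||l l1 l2 l3].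
- by rewrite cartanD_adj // /fork_adj /chain_adj; lia.
- by rewrite cartanD_adj // /fork_adj /chain_adj; lia.
by rewrite cartanD_eq0 // /fork_adj /chain_adj; lia.
Qed.

Lemma rlt_cat (p s t : seq nat) : rlt (p ++ s) (p ++ t) = rlt s t.
Proof. by elim: p => //= k p ->; rewrite ltnn eqxx. Qed.

Section TypeD.
Variables (n : nat) (S : qsetup typeD n).
Implicit Types (u v x y w : S) (g h : seq nat) (k l j b c m : nat).
Local Notation D k := (@der _ _ S (ix n k)).
Local Notation E k := (@gen _ _ S (ix n k)).
Local Notation W := (W n).
Local Notation Ps := (@Psi _ _ S).
Local Notation small_letters := (small_letters n).

Lemma root_vector_D0 : is_root_vector (@cbasis _ _ S) (@form _ _ S) Ps (W [:: 0%N]) (wd (W [:: 0%N])).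
Proof. exact: (@root_vector_chain _ _ S [::] 0%N). Qed.

Lemma root_vector_D_chain i j : (1 <= i)%N -> (i <= j <= n)%N ->
  is_root_vector (@cbasis _ _ S) (@form _ _ S) Ps (W (up i j)) (wd (W (up i j))).
Proof.
move=> i1 /andP[ij jn]; have [g e hall] := up_last ij.
rewrite e; apply: root_vector_chain; rewrite // -e.
- exact: small_up.
- exact: uniq_up.
exact: fork_rev_up.
Qed.

Lemma root_vector_D_cons j : (2 <= j <= n)%N ->
  is_root_vector (@cbasis _ _ S) (@form _ _ S) Ps (W (0%N :: up 2 j)) (wd (W (0%N :: up 2 j))).
Proof.
move=> /andP[j2 jn]; have [g e hall] := up_last j2.
have e' : 0%N :: up 2 j = rcons (0%N :: g) j by rewrite e.
rewrite e'; apply: root_vector_chain; rewrite -?e' //=.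
- exact: small_up.
- by rewrite hall andbT; apply: leq_trans j2.
- by rewrite uniq_up mem_up.
exact: fork_cons_rev_up.
Qed.

Lemma append_D x b g : (b <= n)%N -> wtU (W g) x -> D b x = 0 ->
  (forall l, (l <= n)%N -> l != b ->
     [/\ D l (D l x) = 0, D b (D l x) = 0 & ~~ fork_adj l b -> D l x = 0]) ->
  exists y, [/\ cf y [::] = 0, sole y b & D b y = x].
Proof.
move=> hb xg xb hx.
have len l l' : (l <= n)%N -> (l' <= n)%N -> l != l' ->
    serre_len typeD (ix n l) (ix n l') = if fork_adj l l' then 2%N else 1%N.
  by move=> hl hl' ll'; rewrite /serre_len !ixK // cartanD //; case: fork_adj.
have [|i k|y [y0 yo yd]] := @append1 _ _ S (size (W g)) x (ix n b) (fun t => @wtU_size _ _ S _ _ t xg).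
- apply: forall_ix => l hl; rewrite ix_eq // => lb; have [h1 _ h2] := hx l hl lb.
  by rewrite len //; case: ifP => [_ //|/negbT/h2].
- move: i; apply: forall_ix => l hl; rewrite ix_eq // => lb; have [h1 h3 h2] := hx l hl lb.
  rewrite len // 1?eq_sym // fork_adj_sym; case: ifP => [_|/negbT/h2 h0]; last by case: k.
  by case: k => [|[|k]] //= _; rewrite ?xb ?linear0.
by exists y; split=> // l hl lb; apply: yo; rewrite ix_eq.
Qed.

Definition isword2 g h u : Prop := forall s, cf u s = (s == W g)%:R + (s == W h)%:R.

Lemma nil_W_rcons g k : ([::] == W (rcons g k)) = false.
Proof. by rewrite W_rcons; case: (W g). Qed.

Lemma isword2_D g h k u : isword2 (rcons g k) (rcons h k) u -> isword2 g h (D k u).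
Proof. by move=> hu s; rewrite cf_der hu !W_rcons !eqseq_rcons eqxx !andbT. Qed.

Lemma isword2_sole g h k u : (k <= n)%N -> isword2 (rcons g k) (rcons h k) u -> sole u k.
Proof.
move=> hk hu l hl lk; apply: cf_inj => s.
by rewrite cf_der hu !W_rcons !eqseq_rcons ix_eq // (negPf lk) !andbF cf0 addr0.
Qed.

Lemma isword2_D_swap g h k l u c : (k <= n)%N -> (l <= n)%N -> (c <= n)%N ->
  isword2 (rcons g k) (rcons h l) u ->
  forall s, cf (D c u) s = ((s == W g) && (c == k))%:R + ((s == W h) && (c == l))%:R.
Proof. by move=> hk hl hc hu s; rewrite cf_der hu !W_rcons !eqseq_rcons !ix_eq. Qed.

(** For j = 1 the descending part is empty, so both families with a fork are instances; for m = 1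
    the ascending part is empty, which starts the inductions. *)
Definition fork1 j m := down j 2 ++ [:: 1%N; 0%N] ++ up 2 m.
Definition fork2 j m := down j 2 ++ [:: 0%N; 1%N] ++ up 2 m.
Definition forked j m u := isword2 (fork1 j m) (fork2 j m) u.

Lemma fork1S j m : (1 <= m)%N -> fork1 j m.+1 = rcons (fork1 j m) m.+1.
Proof. by move=> hm; rewrite /fork1 up_rcons // -!rcons_cat. Qed.

Lemma fork2S j m : (1 <= m)%N -> fork2 j m.+1 = rcons (fork2 j m) m.+1.
Proof. by move=> hm; rewrite /fork2 up_rcons // -!rcons_cat. Qed.

Lemma fork11 j : fork1 j 1 = rcons (rcons (down j 2) 1%N) 0%N.
Proof. by rewrite /fork1 -!cats1 -catA. Qed.

Lemma fork21 j : fork2 j 1 = rcons (rcons (down j 2) 0%N) 1%N.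
Proof. by rewrite /fork2 -!cats1 -catA. Qed.

Lemma perm_fork j m : perm_eq (fork2 j m) (fork1 j m).
Proof. by rewrite /fork1 /fork2 perm_cat2l perm_cat2r; apply: (perm_catC [:: 0%N] [:: 1%N]). Qed.

Lemma forked_wt j m u : forked j m u -> wtU (W (fork1 j m)) u.
Proof.
move=> hu t ht; rewrite hu; case: eqP ht => [->|_ ht]; first by rewrite perm_refl.
case: eqP ht => [->|_ _]; last by rewrite addr0.
by rewrite perm_map // perm_fork.
Qed.

Lemma forked_nil j m u : forked j m u -> cf u [::] = 0.
Proof.
by move=> /forked_wt hu; apply: wtU_nil hu _; rewrite size_map /fork1 !size_cat /= addnC.
Qed.

Lemma forkedS j m u : (1 <= m < n)%N -> forked j m.+1 u -> sole u m.+1 /\ forked j m (D m.+1 u).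
Proof.
move=> /andP[m1 mn]; rewrite /forked fork1S // fork2S // => hu; split.
  exact: isword2_sole hu.
exact: isword2_D.
Qed.

Lemma forked1 j u : (1 < n)%N -> forked j 1 u ->
  [/\ isword (rcons (down j 2) 1%N) (D 0 u), isword (rcons (down j 2) 0%N) (D 1 u) &
      forall l, (1 < l <= n)%N -> D l u = 0].
Proof.
rewrite /forked fork11 fork21 => n1 hu; have n0 := ltnW n1.
have h := isword2_D_swap (leq0n n) n0 _ hu.
split=> [s|s|l /andP[l1 ln]].
- by rewrite h // andbT andbF addr0.
- by rewrite h // andbT andbF add0r.
apply: cf_inj => s; rewrite h // cf0.
have -> : (l == 0%N) = false by lia.
have -> : (l == 1%N) = false by lia.
by rewrite !andbF addr0.
Qed.

Lemma forked_above j m u l : (1 < n)%N -> (1 <= m < l)%N -> (l <= n)%N -> forked j m u -> D l u = 0.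
Proof.
move=> n1 /andP[m1 ml] ln; case: m m1 ml => // m _ ml; case: m ml => [|m] ml hu.
  by have [_ _] := forked1 n1 hu; apply; rewrite ml.
by have [|hs _] := forkedS _ hu; [lia | apply: hs => //; lia].
Qed.

Lemma down1_eq j : (1 <= j)%N -> rcons (down j 2) 1%N = down j 1.
Proof. by move=> j1; rewrite -down_rcons. Qed.

Lemma down0_eq j : rcons (down j 2) 0%N = rev (0%N :: up 2 j).
Proof. by rewrite rev_cons. Qed.

Lemma fork_left j : (1 <= j <= n)%N -> exists w, isword (S := S) (rcons (down j 2) 1%N) w.
Proof.
move=> /andP[j1 jn]; rewrite down1_eq //.
by apply: pathlike_isword; [exact: small_up | exact: uniq_up | exact: fork_up].
Qed.

Lemma fork_right j : (1 <= j <= n)%N -> exists w, isword (S := S) (rcons (down j 2) 0%N) w.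
Proof.
move=> /andP[j1 jn]; rewrite down0_eq; apply: pathlike_isword.
- exact: small_up.
- by rewrite /= uniq_up mem_up.
exact: fork_cons_up.
Qed.

Lemma forked1_intro j u w w' : (1 < n)%N -> isword (rcons (down j 2) 1%N) w ->
  isword (rcons (down j 2) 0%N) w' -> cf u [::] = 0 -> D 0 u = w -> D 1 u = w' ->
  (forall l, (1 < l <= n)%N -> D l u = 0) -> forked j 1 u.
Proof.
move=> n1 hw hw' u0 d0 d1 dl; have n0 := ltnW n1.
rewrite /forked fork11 fork21 => s; case/lastP: s => [|s i].
  by rewrite u0 !nil_W_rcons addr0.
rewrite [in RHS]W_rcons [X in _ + (_ == X)%:R]W_rcons !eqseq_rcons -cf_der.
move: i; apply: forall_ix => l hl; rewrite !ix_eq //.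
have [->|l0] := eqVneq l 0%N; first by rewrite d0 hw andbT andbF addr0.
have [->|l1] := eqVneq l 1%N; first by rewrite d1 hw' andbT andbF add0r.
by rewrite !andbF addr0 dl ?cf0 //; lia.
Qed.

(** The prescribed derivatives at 0 and 1 are the words [j..2,1] and [j..2,0]. The only relation
    with nonzero terms is the commutation of e_0' and e_1', and both orders give [j..2]. *)
Lemma forked1_exists j : (1 <= j <= n)%N -> (1 < n)%N -> exists u, forked j 1 u.
Proof.
move=> hj n1; have n0 := ltnW n1; have [w hw] := fork_left hj; have [w' hw'] := fork_right hj.
have sw := isword_sole n0 hw; have sw' := isword_sole (leq0n n) hw'.
have comm : D 1 w = D 0 w' by apply: isword_uniq (isword_D hw) (isword_D hw').
pose f (i : 'I_n.+1) := if i == 0%N :> nat then w else if i == 1%N :> nat then w' else 0.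
have f0 : f (ix n 0) = w by rewrite /f ixK.
have f1 : f (ix n 1) = w' by rewrite /f ixK.
have fl l : (1 < l <= n)%N -> f (ix n l) = 0.
  move=> hl; have l0 : (l == 0%N) = false by lia.
  have l1 : (l == 1%N) = false by lia.
  by rewrite /f ixK ?l0 ?l1 //; case/andP: hl.
have dff l : (l <= n)%N -> D l (f (ix n l)) = 0.
  move=> hl; have [->|l0] := eqVneq l 0%N; first by rewrite f0 sw.
  have [->|l1] := eqVneq l 1%N; first by rewrite f1 sw'.
  by rewrite fl ?linear0 //; lia.
have df l l' : (l <= n)%N -> (l' <= n)%N -> l != l' -> ~~ ((l < 2) && (l' < 2))%N ->
    D l (f (ix n l')) = 0.
  move=> hl hl' ll' h; have [e|l0] := eqVneq l' 0%N.
    by rewrite e f0 sw //; apply/eqP; lia.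
  have [e|l1] := eqVneq l' 1%N; first by rewrite e f1 sw' //; apply/eqP; lia.
  by rewrite fl ?linear0 //; lia.
have [|i k|u [u0 hu]] := @extend _ _ S (size (W (rcons (down j 2) 1%N))) f.
- apply: forall_ix => l hl s hs; have [->|l0] := eqVneq l 0%N.
    by rewrite f0 (wtU_size (isword_wt hw)).
  have [->|l1] := eqVneq l 1%N.
    by rewrite f1 (wtU_size (isword_wt hw')) //; rewrite !W_rcons !size_rcons in hs *.
  by rewrite fl ?cf0 //; lia.
- move: i k; apply: forall_ix => l hl; apply: forall_ix => l' hl'; rewrite ix_eq // => ll'.
  rewrite /serre_len !ixK // cartanD //.
  case: (boolP ((l < 2) && (l' < 2))%N) => h.
    have -> : fork_adj l l' = false by rewrite /fork_adj /chain_adj; lia.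
    rewrite !big_ord_recl big_ord0 /serre_term /= /serre_coef /= addr0.
    rewrite -[qfact _ _ (1 - _)]/(qfact _ _ 1) -[qfact _ _ (1 - _)]/(qfact _ _ 0).
    rewrite qfact0 qfact1 expr0 expr1 invr1 !mulr1 scale1r scaleN1r.
    have [[-> ->]|[-> ->]] : (l = 0 /\ l' = 1)%N \/ (l = 1 /\ l' = 0)%N by lia.
      by rewrite f0 f1 comm subrr.
    by rewrite f0 f1 comm subrr.
  have h' : ~~ ((l' < 2) && (l < 2))%N by rewrite andbC.
  have ll'' : l' != l by rewrite eq_sym.
  case: ifP => _; apply: big1 => -[p hp] _; rewrite /serre_term /=.
    case: p hp => [|[|[|p]]] //= hp; rewrite ?dff // ?df // ?linear0 ?scaler0 //.
  case: p hp => [|[|p]] //= hp; rewrite ?df // ?scaler0 //.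
exists u; apply: (forked1_intro n1 hw hw') => //.
- by rewrite hu.
- by rewrite hu.
by move=> l hl; rewrite hu fl.
Qed.

Lemma forked_exists j m : (1 <= j <= n)%N -> (1 < n)%N -> (m < n)%N -> exists u, forked j m.+1 u.
Proof.
move=> hj n1; have n0 := ltnW n1; elim: m => [_|m IH mn]; first exact: forked1_exists.
have [x hx] := IH (ltnW mn).
have above l : (m.+1 < l <= n)%N -> D l x = 0.
  by move=> /andP[ml ln]; apply: (forked_above n1 _ ln hx); rewrite ml.
have [|l hl lb|y [y0 ys yd]] := @append_D x m.+2 (fork1 j m.+1) mn (forked_wt hx).
- by apply: above; rewrite ltnSn.
- case: m mn {IH} hx lb above => [|m] mn hx lb above.
    have [d0 d1 dl] := forked1 n1 hx.
    have [e|l0] := eqVneq l 0%N.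
      rewrite e; split; last by [].
        by apply: (isword_sole _ d0).
      by apply: (isword_sole _ d0).
    have [e|l1] := eqVneq l 1%N.
      rewrite e; split; last by [].
        by apply: (isword_sole _ d1).
      by apply: (isword_sole _ d1).
    by rewrite dl ?linear0; [split | lia].
  have [|hs hd] := forkedS _ hx; first lia.
  have [e|lm] := eqVneq l m.+2; last by rewrite hs // !linear0.
  rewrite e; split.
  + by apply: (forked_above n1 _ _ hd); lia.
  + by apply: (forked_above n1 _ _ hd); lia.
  by rewrite /fork_adj /chain_adj; lia.
exists y; rewrite /forked fork1S // fork2S // => s; case/lastP: s => [|s i].
  by rewrite y0 !nil_W_rcons addr0.
rewrite [in RHS]W_rcons [X in _ + (_ == X)%:R]W_rcons !eqseq_rcons -cf_der.
move: i; apply: forall_ix => l hl; rewrite !ix_eq //.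
have [->|lm] := eqVneq l m.+2; first by rewrite yd hx !andbT.
by rewrite ys // cf0 !andbF addr0.
Qed.

(** The derivatives at 0 and 1 have the witnesses e_1 M and e_0 M. Since e_0 and e_1 commute, f_0
    and f_1 lead from them to one common witness. *)
Lemma forked1_dualvec j u : (1 <= j <= n)%N -> (1 < n)%N -> forked j 1 u -> exists C, dualvec u C.
Proof.
move=> /andP[j1 jn] n1 hu; have n0 := ltnW n1.
have [d0 d1 dl] := forked1 n1 hu.
have s0 := isword_sole n0 d0; have s1 := isword_sole (leq0n n) d1.
have hM : small_letters (up 2 j) by apply: small_up.
pose M := mon S (W (up 2 j)).
have e0 : dualvec (D 0 u) (E 1 * M).
  rewrite -[E 1 * M]/(E 1 * mon S (W (up 2 j))) -mon_cons -[_ :: _]/(W (1%N :: up 2 j)).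
  rewrite down1_eq // in d0; rewrite -up_cons // -[up 1 j]revK.
  by apply: isword_dualvec_uniq d0; [apply: small_down | rewrite rev_uniq uniq_up].
have e1 : dualvec (D 1 u) (E 0 * M).
  rewrite -[E 0 * M]/(E 0 * mon S (W (up 2 j))) -mon_cons -[_ :: _]/(W (0%N :: up 2 j)).
  rewrite down0_eq in d1; rewrite -[0%N :: _]revK.
  apply: isword_dualvec_uniq d1; first by rewrite small_rev.
  by rewrite rev_uniq /= uniq_up mem_up.
have MD k : (k < 2)%N -> D k M = 0.
  by move=> k2; apply: (wtU_D_notin _ hM _ (@wtU_mon _ _ S _)); rewrite ?mem_up; lia.
exists (E 0 * (E 1 * M)); apply: dualvec_step; first exact: forked_nil hu.
apply: forall_ix => l hl.
have [->|l0] := eqVneq l 0%N.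
  apply: (DualvecSimple e0 (s0 _ _ _) (ftilde_gen _)) => //; last by rewrite subrr; apply: qL0.
  by rewrite D_genM // MD // mulr0 !scaler0 addr0 scale0r.
have [->|l1] := eqVneq l 1%N.
  have ft1 : D 1 (E 0 * M) = 0 by rewrite D_genM // MD // mulr0 !scaler0 addr0 scale0r.
  apply: (DualvecSimple e1 (s1 _ _ _) (ftilde_gen ft1)) => //.
  rewrite !mulrA serreU0 ?subrr; first exact: qL0.
    by rewrite ix_eq.
  by rewrite /= !ixK // cartanD.
by constructor 1; apply: dl; lia.
Qed.

Lemma forked_dualvec j m u : (1 <= j <= n)%N -> (1 < n)%N -> (m < n)%N -> forked j m.+1 u ->
  exists C, dualvec u C.
Proof.
move=> hj n1; elim: m u => [u _|m IH u mn hu]; first exact: forked1_dualvec.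
have [|hs hd] := forkedS _ hu; first by rewrite mn.
have [C hC] := IH _ (ltnW mn) hd.
apply: (dualvec_sole mn hs (forked_nil hu) _ hC).
by apply: (forked_above n1 _ mn hd); rewrite ltnSn.
Qed.

(** Stripping 2 leaves 0 and 1 as possible last letters. Each branch is a chain and determines its
    derivative up to a scalar; it remains to see that the two scalars agree. *)
Lemma forked2_descends j u : (1 <= j <= n)%N -> (1 < n)%N -> forked j 2 u ->
  descends (fork1 j 2) u 2.
Proof.
move=> /andP[j1 jn] n1 hu x hx xs x2 xp; have n0 := ltnW n1.
have [|us hd] := forkedS _ hu; first by rewrite n1.
set u' := D 2 u in hd; have [d0 d1 dl] := forked1 n1 hd.
have x0 : D 0 x = 0 by apply: xs.
have x1 : D 1 x = 0 by apply: xs.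
set x' := D 2 x.
have hx' : wtU (W (fork1 j 1)) x' by apply: wtU_Dr; rewrite -fork1S.
have x'l l : (1 < l <= n)%N -> D l x' = 0.
  move=> /andP[l1 ln]; have [->//|l2] := eqVneq l 2%N.
  have [l3|l3] := eqVneq l 3%N; first by rewrite l3 xp // -l3.
  rewrite /x' D_comm ?xs ?linear0 // cartanD_eq0 // /fork_adj /chain_adj; lia.
have two_k k : (k < 2)%N -> D k (D k x') = 0 /\ D 2 (D k x') = 0.
  move=> k2; have kn : (k <= n)%N by apply: leq_trans n1; apply: ltnW.
  have k2n : k != 2%N by lia.
  have kx : D k x = 0 by apply: xs.
  have a1 : cartan typeD k 2 = -1 by rewrite cartanD_adj // /fork_adj /chain_adj; lia.
  have a2 : cartan typeD 2 k = -1 by rewrite cartanD_adj 1?eq_sym // /fork_adj /chain_adj; lia.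
  split.
    by have := D_serre1 x kn n1 k2n a1; rewrite kx !linear0 addr0.
  have k2n' : 2%N != k by rewrite eq_sym.
  have := D_serre1 x n1 kn k2n' a2; rewrite kx x2 !linear0 addr0 => /esym/eqP.
  by rewrite scaler_eq0 (negPf (qint_neq0 _ _ 1)) => /eqP.
have comm01 v : D 0 (D 1 v) = D 1 (D 0 v) by apply: D_comm; rewrite // cartanD_eq0.
have soleD k k' : (k < 2)%N -> (k' < 2)%N -> k != k' -> sole (D k x') k'.
  move=> hk hk' kk' l hl lk'; have [->|lk] := eqVneq l k; first by have [] := two_k k hk.
  have [->|l2] := eqVneq l 2%N; first by have [] := two_k k hk.
  rewrite D_comm ?x'l ?linear0 //; try lia.
  by rewrite cartanD_eq0 // /fork_adj /chain_adj; lia.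
have hx1 : wtU (W (fork2 j 1)) x'.
  by apply: wtU_perm hx'; apply: perm_map; rewrite perm_sym perm_fork.
rewrite fork11 in hx'; rewrite fork21 in hx1.
have w0 := wtU_Dr hx'; have w1 := wtU_Dr hx1.
have [c0 hc0] : exists c : Qq, D 0 x' = c *: D 0 u'.
  rewrite down1_eq // in d0 w0; apply: (pathlike_prop _ (uniq_up 1 j) (fork_up j (leqnn 1)) d0 w0).
    exact: small_up.
  by rewrite up_cons //; apply: soleD.
have [c1 hc1] : exists c : Qq, D 1 x' = c *: D 1 u'.
  rewrite down0_eq in d1 w1; apply: (pathlike_prop _ _ (fork_cons_up j) d1 w1).
  - exact: small_up.
  - by rewrite /= uniq_up mem_up.
  exact: soleD.
(* Stripping 0 and 1 in either order must give the same multiple of the nonzero word [j..2]. *)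
have c01 : c1 = c0.
  have := comm01 x'; rewrite hc0 hc1 !derZ comm01 => /eqP.
  rewrite -subr_eq0 -scalerBl scaler_eq0 subr_eq0 => /orP[/eqP //|/eqP h].
  have := isword_D d0; rewrite h => /(_ (W (down j 2))); rewrite cf0 eqxx => /eqP.
  by rewrite eq_sym oner_eq0.
exists c0; apply: (prop_sole (k := 2%N)) => //.
- exact: forked_nil hu.
- by apply: wtU_nil hx _; rewrite size_map fork1S // size_rcons.
apply: D_inj => [|l hl].
  by rewrite cfZ (forked_nil hd) mulr0; apply: wtU_nil hx' _; rewrite W_rcons size_rcons.
rewrite derZ; have [->//|l0] := eqVneq l 0%N.
have [->|l1] := eqVneq l 1%N; first by rewrite -/x' hc1 c01.
by rewrite -/x' x'l ?dl ?scaler0 //; lia.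
Qed.

Lemma forked_descends j m u : (1 <= j <= n)%N -> (m.+1 < n)%N -> forked j m.+2 u ->
  descends (fork1 j m.+2) u m.+2.
Proof.
move=> hj; elim: m u => [|m IH] u mn hu; first exact: forked2_descends.
have n1 : (1 < n)%N by apply: leq_trans mn.
have [|us hd] := forkedS _ hu; first by rewrite mn.
rewrite fork1S //; apply: descendsS => //.
- exact: fork_chain_node.
- by rewrite fork1S // size_rcons.
- exact: forked_nil hu.
by apply: IH => //; apply: ltnW.
Qed.

Lemma forked_min j m u : (1 <= j <= n)%N -> (m <= n)%N -> (0 < n)%N -> forked j m u ->
  is_min (Ps u) (W (fork1 j m)).
Proof.
move=> /andP[j1 jn] mn n0 hu.
have small h : perm_eq h (fork1 j m) -> small_letters h.
  by move=> hp; rewrite (small_perm _ hp) /fork1 !small_cat small_down // small_up //= n0.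
have s1 := small _ (perm_refl _); have s2 := small _ (perm_fork j m).
(* Read from the right, the two words first differ before the common segment from 2 to m, where one
   has 0 and the other 1. *)
have lt12 : word_lt (W (fork1 j m)) (W (fork2 j m)).
  rewrite /word_lt !map_val_W // /fork1 /fork2 !rev_cat -!catA rlt_cat.
  by rewrite /rev /=.
have ne : W (fork1 j m) <> W (fork2 j m).
  by move=> e; move: lt12; rewrite e /word_lt (negPf (rlt_irr _)).
split.
  rewrite -/(cf _ _) hu eqxx; case: (_ =P W (fork2 j m)) => // _; rewrite addr0; exact: oner_neq0.
move=> s; rewrite -/(cf _ _) hu; case: (s =P W (fork1 j m)) => [->|_]; first by left.
case: (s =P W (fork2 j m)) => [->|_]; first by right.
by rewrite addr0 eqxx.
Qed.

Lemma root_vector_fork j k : (1 <= j)%N -> (j < k <= n)%N -> (2 <= k)%N ->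
  is_root_vector (@cbasis _ _ S) (@form _ _ S) Ps (W (fork1 j k))
    (wd (W (fork1 j k)) + wd (W (fork2 j k))).
Proof.
move=> j1 /andP[jk kn] k2; case: k jk kn k2 => [|[|k]] // jk kn _.
have n1 : (1 < n)%N by apply: leq_trans kn.
have n0 := ltnW n1.
have hj : (1 <= j <= n)%N by rewrite j1; apply: leq_trans kn; apply: ltnW.
have jn : (j <= n)%N by case/andP: hj.
have [u hu] := forked_exists hj n1 kn.
have -> : wd (W (fork1 j k.+2)) + wd (W (fork2 j k.+2)) = Ps u.
  apply: coefwP => s; rewrite -/(cf u s) hu /coefw mcoeffD -!/(coefw _ _) !coefw_wd.
  by rewrite (eq_sym s) (eq_sym s (W (fork2 _ _))).
have [C hC] := forked_dualvec hj n1 kn hu.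
have hm := forked_min hj kn n0 hu; have hw := forked_wt hu; have hd := forked_descends hj kn hu.
rewrite fork1S // in hm hw hd *.
have hs' : small_letters (fork1 j k.+1).
  by rewrite /fork1 !small_cat small_down // small_up //= ?n0 // ltnW.
have hall : all (fun l => l < k.+2)%N (fork1 j k.+1).
  rewrite /fork1 !all_cat /=; apply/andP; split; apply/allP => l.
    by rewrite mem_rev mem_up => /andP[_ h]; apply: leq_ltn_trans h _.
  by rewrite mem_up => /andP[_ h].
apply: (root_vector_last _ hall hC hw hm); first by rewrite small_rcons kn.
by move=> v hv sv; apply: (descends_root kn hs' hall hd hv sv).
Qed.

End TypeD.

(** * Products *)

Section Products.
Variables (ty : classical_type) (n : nat) (S : qsetup ty n).
Implicit Types (u v x y z : S) (s t : seq 'I_n.+1) (k l m : nat).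
Local Notation d := (@der _ _ S).
Local Notation e := (@gen _ _ S).
Local Notation D k := (@der _ _ S (ix n k)).

Lemma cf_mul_nil x y : cf (x * y) [::] = cf x [::] * cf y [::].
Proof.
move: x; apply: (@linear_monP _ _ S Qq^o (fun x => cf (x * y) [::]) (fun x => cf x [::] * cf y [::])).
- by move=> c u v; rewrite mulrDl -scalerAl cfD cfZ.
- by move=> c u v; rewrite cfD cfZ mulrDl -mulrA.
case=> [|i s]; first by rewrite mon_nil mul1r cf1 mul1r.
by rewrite mon_cons -mulrA !cf_gen_mul_nil mul0r.
Qed.

Lemma wtU_mul s t x y : wtU s x -> wtU t y -> wtU (s ++ t) (x * y).
Proof.
have [m] := ubnP (size (s ++ t)); elim: m s t x y => // m IH s t x y hm hx hy.
have nilx s' x' : wtU s' x' -> s' != [::] -> cf x' [::] = 0.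
  by move=> h hs; apply: (wtU_size h); case: (s') hs.
apply: wtU_intro.
- move=> hst; rewrite cf_mul_nil; case: s hst hx {hm} => [|i s] hst hx.
    by rewrite (nilx _ _ hy hst) mulr0.
  by rewrite (nilx _ _ hx) // mul0r.
- case: s hx {hm} => // hx; case: t hy => // hy _ i.
  rewrite (der_wtM _ _ hx) !(wtU_der_notin _ hx) // (wtU_der_notin _ hy) //.
  by rewrite mul0r mulr0 scaler0 addr0.
- move=> i; rewrite mem_cat negb_or => /andP[his hit].
  by rewrite (der_wtM _ _ hx) (wtU_der_notin his hx) (wtU_der_notin hit hy) mul0r mulr0 scaler0 addr0.
move=> i r hr; rewrite (der_wtM _ _ hx); apply: wtUD; last apply: wtUZ.
  case: (boolP (i \in s)) => his; last by rewrite (wtU_der_notin his hx) mul0r; apply: wtU0.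
  have hs := perm_to_rem his; apply: (@wtU_perm _ _ _ (rem i s ++ t)).
    rewrite -(perm_cons i) -cat_cons; apply: perm_trans (_ : perm_eq (s ++ t) _).
      by rewrite perm_cat2r perm_sym.
    by rewrite perm_sym.
  apply: IH => //; last by apply: wtU_der; apply: wtU_perm hx.
  by move: hm; rewrite !size_cat (perm_size hs).
case: (boolP (i \in t)) => hit; last by rewrite (wtU_der_notin hit hy) mulr0; apply: wtU0.
have ht := perm_to_rem hit; apply: (@wtU_perm _ _ _ (s ++ rem i t)).
  rewrite -(perm_cons i) perm_sym; apply: perm_trans hr _.
  by rewrite -[i :: _]cat1s perm_sym perm_catCA perm_cat2l perm_sym.
apply: IH => //; last by apply: wtU_der; apply: wtU_perm hy.
by move: hm; rewrite !size_cat (perm_size ht) addnS.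
Qed.

Lemma cf_serre z a b i j : i != j -> \sum_(k < (serre_len ty i j).+1)
  serre_coef ty i (serre_len ty i j) k * cf z (rev (a ++ serre_word i j (serre_len ty i j) k ++ b)) = 0.
Proof.
move=> ij; have h := congr1 (fun x => @form _ _ S z (mon S a * x * mon S b)) (serre_mon S ij).
rewrite /= mulr0 mul0r K0r mulr_sumr mulr_suml Ksumr in h.
rewrite -[RHS]h; apply: eq_bigr => k _.
by rewrite -K_mon !mon_cat -scalerAr -scalerAl KZr mulrA.
Qed.

(** Concatenation of the letter 0 with [z]. It is no product of U_q, so its existence has to be
    proved, see [front_exists]. *)
Definition front z u : Prop :=
  forall s, cf u s = if s is i :: s' then (i == ix n 0)%:R * cf z s' else 0.

Lemma front_uniq z u v : front z u -> front z v -> u = v.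
Proof. by move=> hu hv; apply: cf_inj => s; rewrite hu hv. Qed.

Lemma frontZ c z u : front z u -> front (c *: z) (c *: u).
Proof. by move=> hu [|i s]; rewrite cfZ hu ?mulr0 // cfZ mulrCA. Qed.

Lemma front0 : front 0 0.
Proof. by case=> [|i s]; rewrite !cf0 ?mulr0. Qed.

Lemma front_D z u i : cf z [::] = 0 -> front z u -> front (d i z) (d i u).
Proof. by move=> z0 hu [|j s]; rewrite cf_der hu /= ?z0 ?mulr0 // cf_der. Qed.

Lemma front_wt z u s : front z u -> wtU s z -> wtU (ix n 0 :: s) u.
Proof.
move=> hu hz [|i t] ht; rewrite hu //.
have [e|_] := eqVneq i (ix n 0); last by rewrite mul0r.
by rewrite hz ?mulr0 // -(perm_cons i) {2}e.
Qed.

End Products.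

(** Relations away from the first letter hold already in [z]. At the front, a word starting with 0
    is followed by 1,1,1 (for the relation with a_10 = -2), by a letter other than 1, or by another
    0 later on; [z] has none of these, so every term vanishes. *)
Lemma front_exists n (S : qsetup typeC n) (N : nat) (z : S) : (0 < n)%N ->
  (forall s, size s != N -> cf z s = 0) -> (forall s, ix n 0 \in s -> cf z s = 0) ->
  (forall i s, i != ix n 1 -> cf z (i :: s) = 0) ->
  (forall s, cf z [:: ix n 1, ix n 1, ix n 1 & s] = 0) -> exists u, front z u.
Proof.
move=> n0 zN z0 z1 z3.
have [||u hu] := @realize _ _ S N.+1 (fun s => if s is i :: s' then (i == ix n 0)%:R * cf z s' else 0);
  last by exists u.
- by case=> [|i s] //= hs; rewrite zN ?mulr0.
move=> a b i j ij; case/lastP: b => [|b c]; last first.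
  transitivity ((c == ix n 0)%:R * \sum_(k < (serre_len typeC i j).+1)
    serre_coef typeC i (serre_len typeC i j) k *
    cf z (rev (a ++ serre_word i j (serre_len typeC i j) k ++ b))); last first.
    by rewrite cf_serre // mulr0.
  rewrite mulr_sumr; apply: eq_bigr => k _.
  by rewrite catA -rcons_cat rev_rcons -catA mulrCA.
have rs m k : rev (a ++ serre_word i j m k ++ [::]) = nseq k i ++ j :: nseq (m - k) i ++ rev a.
  rewrite cats0 rev_cat /serre_word rev_cat rev_cons !rev_nseq -cats1 -!catA.
  by [].
apply: big1 => -[k hk] _; rewrite rs /=; case: k hk => [|k] hk /=.
  have [j0|_] := eqVneq j (ix n 0); last by rewrite mul0r mulr0.
  rewrite subn0 mul1r j0 /serre_len !ixK //.
  have [i1|i1] := eqVneq i (ix n 1).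
    by rewrite i1 ixK // cartanC //= z3 mulr0.
  have i0 : (i : nat) != 0%N by apply: contra ij => /eqP e; rewrite j0 -(inj_eq val_inj) /= ixK // e.
  have i1' : (i : nat) != 1%N.
    by apply: contra i1 => /eqP e; rewrite -(inj_eq val_inj) /= ixK // e.
  rewrite cartanC //; have -> : chain_adj i 0 = false by rewrite /chain_adj; lia.
  by rewrite /= z1 ?mulr0.
have [i0|_] := eqVneq i (ix n 0); last by rewrite mul0r mulr0.
rewrite mul1r; case: k hk => [|k] hk; last by rewrite z0 ?mulr0 // i0 inE eqxx.
case hm: (serre_len typeC i j - 1)%N => [|m]; last first.
  by rewrite z0 ?mulr0 //= i0 !inE eqxx orbT.
rewrite /= z1 ?mulr0 //; apply: contraTneq hk => j1.
by move: hm; rewrite /serre_len i0 j1 !ixK // cartanC.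
Qed.

(** * Long roots of type C *)

Lemma sformC k l : (0 < k)%N -> (0 < l)%N ->
  sform typeC k l = if k == l then 2 else if chain_adj k l then -1 else 0.
Proof. by case: k => // k; case: l => // l _ _; rewrite /sform /= orbF. Qed.

Lemma wpair_rcons ty k s l : wpair ty k (rcons s l) = wpair ty k s + sform ty k l.
Proof. by rewrite /wpair -cats1 big_cat big_seq1. Qed.

Lemma wpair_cat ty k s t : wpair ty k (s ++ t) = wpair ty k s + wpair ty k t.
Proof. exact: big_cat. Qed.

Lemma wpair_cons ty k l s : wpair ty k (l :: s) = sform ty k l + wpair ty k s.
Proof. exact: big_cons. Qed.

Lemma wpair_lt a b : (a < b)%N ->
  wpair typeC b (up 1 a) = if (0 < a)%N && (b == a.+1) then -1 else 0.
Proof.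
elim: a => [|a IH] ab; first by rewrite up_nil // /wpair big_nil.
have ne : (b == a.+1) = false by lia.
rewrite up_rcons // wpair_rcons (IH (ltnW ab)) sformC //; last by case: (b) ab.
rewrite ne andbF add0r /chain_adj /=; congr (if _ then _ else _); lia.
Qed.

Lemma wpair_diag b : (0 < b)%N -> wpair typeC b (up 1 b) = if b == 1%N then 2 else 1.
Proof.
case: b => // b _; rewrite up_rcons // wpair_rcons wpair_lt // sformC // eqxx andbT eqSS.
by case: b.
Qed.

Lemma wpair_gt a b : (0 < a < b)%N -> wpair typeC a (up 1 b) = if a == 1%N then 1 else 0.
Proof.
elim: b => [|b IH] /andP[a0 ab]; first by [].
have ne : (a == b.+1) = false by lia.
rewrite up_rcons // wpair_rcons sformC // ne.
move: ab; rewrite ltnS leq_eqVlt => /orP[/eqP e|ab].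
  by rewrite e wpair_diag -?e // /chain_adj eqxx; case: (a == 1%N).
rewrite IH ?a0 //; have -> : chain_adj a b.+1 = false by rewrite /chain_adj; lia.
by rewrite addr0.
Qed.

Lemma finite_choice (T : Type) (t0 : T) (R : nat -> T -> Prop) (n : nat) :
  (forall a, (a <= n)%N -> exists u, R a u) -> exists f, forall a, (a <= n)%N -> R a (f a).
Proof.
elim: n => [|n IH] h.
  have [u hu] := h 0%N (leqnn 0); exists (fun=> u) => a; rewrite leqn0 => /eqP -> //.
have [|f hf] := IH; first by move=> a an; apply: h; apply: leqW.
have [u hu] := h n.+1 (leqnn _); exists (fun a => if a == n.+1 then u else f a) => a an.
by have [->//|ne] := eqVneq a n.+1; apply: hf; rewrite -ltnS ltn_neqAle ne.
Qed.

Section LongRoots.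
Variables (n : nat) (S : qsetup typeC n).
Hypothesis n0 : (0 < n)%N.
Implicit Types (u v x y z : S) (k l a b : nat).
Local Notation D k := (@der _ _ S (ix n k)).
Local Notation E k := (@gen _ _ S (ix n k)).
Local Notation W := (W n).
Local Notation ft k := (ftilde typeC (@gen _ _ S) (@der _ _ S) (ix n k)).
Let lin : typeC <> typeD. Proof. by []. Qed.

Section Shuffles.
Variable y : nat -> S.
Hypothesis hy : forall a, (a <= n)%N -> isword (up 1 a) (y a).
Local Notation q2 := (q + q^-1).

Lemma seg0 : y 0 = 1.
Proof. by apply: isword_uniq (hy (leq0n n)) _; apply: isword_nil. Qed.

Lemma segD l a : (l <= n)%N -> (a <= n)%N -> D l (y a) = if (0 < a)%N && (l == a) then y a.-1 else 0.
Proof.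
move=> ln; case: a => [|a] an /=; first by rewrite seg0 der1.
have h := hy an; rewrite up_rcons // in h.
case: eqP => [->|/eqP la]; last by apply: (isword_sole an h).
by apply: isword_uniq (isword_D h) (hy (ltnW an)).
Qed.

Lemma seg_wt a : (a <= n)%N -> wtU (W (up 1 a)) (y a).
Proof. by move=> an; apply: isword_wt; apply: hy. Qed.

Lemma segM_D l a b : (l <= n)%N -> (a <= n)%N -> (b <= n)%N ->
  D l (y a * y b) = D l (y a) * y b + q ^ (- wpair typeC l (up 1 a)) *: (y a * D l (y b)).
Proof.
by move=> ln an bn; rewrite (der_wtM _ _ (seg_wt an)) wpair_W //; apply: small_up.
Qed.

Lemma segM_nil a b : (a <= n)%N -> (b <= n)%N -> (0 < b)%N -> cf (y a * y b) [::] = 0.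
Proof.
by move=> an bn b0; rewrite cf_mul_nil (wtU_nil (seg_wt bn)) ?mulr0 // size_map size_iota subSS subn0.
Qed.

(** Comparison of derivatives. The Leibniz twists supply the factor q^-1 at the ends, a = 1 and b =
    a + 1; otherwise stripping leads to the induction hypothesis. *)
Lemma seg_comm a b : (0 < a < b)%N -> (b <= n)%N -> y b * y a = q^-1 *: (y a * y b).
Proof.
have [m] := ubnP (a + b); elim: m a b => // m IH a b hm /andP[a0 ab] bn.
have an : (a <= n)%N by apply: leq_trans bn; apply: ltnW.
have b0 : (0 < b)%N by apply: leq_ltn_trans ab.
apply: D_inj => [|l hl]; first by rewrite cfZ !segM_nil // mulr0.
rewrite derZ !segM_D // !segD // a0 b0 /=.
have [->|lb] := eqVneq l b.
  have ba : (b == a) = false by lia.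
  rewrite ba mulr0 mul0r scaler0 addr0 add0r scalerA (wpair_lt ab) a0 /=.
  have [e|ne] := eqVneq b a.+1.
    by rewrite e /= opprK expr1z mulVf ?scale1r //; apply: q_neq0.
  rewrite oppr0 expr0z mulr1; apply: IH; rewrite -?subn1; lia.
have [->|la] := eqVneq l a; last by rewrite !mulr0 !mul0r !scaler0 addr0 scaler0.
rewrite mul0r add0r mulr0 scaler0 addr0 wpair_gt ?a0 //.
have [e|ne] := eqVneq a 1%N.
  by rewrite e /= seg0 mulr1 mul1r -exprN1.
rewrite oppr0 expr0z scale1r; apply: IH; rewrite -?subn1; lia.
Qed.

Lemma segM_wt a b : (a <= n)%N -> (b <= n)%N -> wtU (W (up 1 a ++ up 1 b)) (y a * y b).
Proof. by move=> an bn; rewrite W_cat; apply: wtU_mul; apply: seg_wt. Qed.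

Lemma segM_head a b (i : 'I_n.+1) (s : seq 'I_n.+1) : (a <= n)%N -> (b <= n)%N -> i != ix n 1 ->
  cf (y a * y b) (i :: s) = 0.
Proof.
move=> + + hi; elim/last_ind: s a b => [|s k IH] a b an bn.
  apply: (segM_wt an bn); apply: contra hi => hp.
  have := perm_size hp; rewrite size_map size_cat !size_iota !subSS !subn0 /= => hs.
  have := perm_mem hp i; rewrite mem_head => /esym/mapP[l + ->].
  by rewrite mem_cat !mem_up => hl; apply/eqP; congr ix; lia.
rewrite -rcons_cons -cf_der; move: k; apply: forall_ix => l hl.
rewrite segM_D // cfD cfZ !segD //.
have -> : cf ((if (0 < a)%N && (l == a) then y a.-1 else 0) * y b) (i :: s) = 0.
  case: ifP => _; last by rewrite mul0r cf0.
  by apply: IH => //; lia.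
rewrite add0r; case: ifP => _; last by rewrite mulr0 cf0 mulr0.
by rewrite IH ?mulr0 //; lia.
Qed.

Lemma pair_exists a b : (a <= n)%N -> (b <= n)%N -> exists u, front (y a * y b) u.
Proof.
move=> an bn; have hw := segM_wt an bn.
have hs : small_letters n (up 1 a ++ up 1 b) by rewrite small_cat !small_up.
apply: (@front_exists _ _ (size (W (up 1 a ++ up 1 b)))) => //.
- by move=> s; apply: wtU_size hw.
- move=> s h0; apply: hw; apply: contraL h0 => /perm_mem ->.
  by rewrite mem_W // mem_cat !mem_up.
- by move=> i s hi; apply: segM_head.
move=> s; apply: hw; apply/negP => /permP /(_ (pred1 (ix n 1))).
rewrite count_W // count_cat /= eqxx.
rewrite (count_uniq_mem _ (uniq_up 1 a)) (count_uniq_mem _ (uniq_up 1 b)).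
by have := leq_b1 (1%N \in up 1 a); have := leq_b1 (1%N \in up 1 b); lia.
Qed.

End Shuffles.

Local Notation q2 := (q + q^-1).

(** [V a b] is [0] times the shuffle of [1..a] and [1..b], with the factor [q]
    when [a = b > 0]. *)
Record pairs (V : nat -> nat -> S) : Prop := Pairs {
  pairs00 : isword [:: 0%N] (V 0 0);
  pairs_wt a b : (a <= n)%N -> (b <= n)%N -> wtU (W (0%N :: up 1 a ++ up 1 b)) (V a b);
  pairs_r a b : (a < b <= n)%N -> D b (V a b) = V a b.-1;
  pairs_l a b : (0 < a < b)%N -> (b <= n)%N -> D a (V a b) = V a.-1 b;
  pairs_d b : (0 < b <= n)%N -> D b (V b b) = q2 *: V b.-1 b;
  pairs_o l a b : (a <= n)%N -> (0 < b <= n)%N -> (l <= n)%N -> l != b -> (l != a) || (a == 0%N) ->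
    D l (V a b) = 0 }.

Lemma pairs_exist : exists V, pairs V /\ forall j, (0 < j <= n)%N -> exists2 u,
  isword (up 1 j) u & front (q *: (u * u)) (V j j).
Proof.
have [y hy] : exists y : nat -> S, forall a, (a <= n)%N -> isword (up 1 a) (y a).
  apply: (@finite_choice S 0 (fun a u => isword (up 1 a) u)) => a an.
  rewrite -[up 1 a]revK; apply: pathlike_isword.
  - by rewrite small_rev; apply: small_up.
  - by rewrite rev_uniq uniq_up.
  exact: linear_rev_up.
have [P hP] : exists P : nat -> nat -> S, forall a, (a <= n)%N ->
    forall b, (b <= n)%N -> front (y a * y b) (P a b).
  apply: (@finite_choice (nat -> S) (fun=> 0)
    (fun a f => forall b, (b <= n)%N -> front (y a * y b) (f b))) => a an.
  apply: (@finite_choice S 0 (fun b u => front (y a * y b) u)) => b bn.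
  exact: pair_exists.
have DP l a b : (l <= n)%N -> (a <= n)%N -> (0 < b <= n)%N -> front (D l (y a * y b)) (D l (P a b)).
  by move=> ln an /andP[b0 bn]; apply: front_D; [apply: (segM_nil hy) | apply: hP].
exists (fun a b => if (a == b) && (0 < a)%N then q *: P a b else P a b).
split; last first.
  move=> j /andP[j0 jn]; exists (y j); first exact: hy.
  by rewrite eqxx j0; apply: frontZ; apply: hP.
split.
- rewrite /= => s; rewrite (hP 0%N _ 0%N) // (seg0 hy) mulr1.
  by case: s => [|i s] //; rewrite cf1 eqseq_cons -natrM mulnb.
- move=> a b an bn; have h := front_wt (hP a an b bn) (segM_wt hy an bn).
  by case: ifP => _ //; apply: wtUZ.
- move=> a b /andP[ab bn]; have an : (a <= n)%N by apply: leq_trans bn; apply: ltnW.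
  have b0 : (0 < b)%N by apply: leq_ltn_trans ab.
  have bn' : (b.-1 <= n)%N by apply: leq_trans bn; apply: leq_pred.
  have ne : (a == b) = false by lia.
  rewrite ne /=; have := DP b a b bn an; rewrite b0 bn => /(_ isT).
  rewrite (segM_D hy) // !(segD hy) // b0 eqxx (eq_sym b) ne andbF mul0r add0r (wpair_lt ab) /= => h.
  apply: (front_uniq h).
  (* Just above the diagonal the Leibniz rule produces a factor q, the one built into the diagonal
     vectors. *)
  have -> : (a == b.-1) && (0 < a)%N = (0 < a)%N && (b == a.+1) by lia.
  case: ifP => _; first by rewrite opprK expr1z; apply: frontZ; apply: hP.
  by rewrite oppr0 expr0z scale1r; apply: hP.
- move=> a b /andP[a0 ab] bn; have an : (a <= n)%N by apply: leq_trans bn; apply: ltnW.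
  have b0 : (0 < b)%N by apply: leq_ltn_trans ab.
  have an' : (a.-1 <= n)%N by apply: leq_trans an; apply: leq_pred.
  have ne : (a == b) = false by lia.
  have ne' : (a.-1 == b) = false by lia.
  rewrite ne ne' /=; have := DP a a b an an; rewrite b0 bn => /(_ isT).
  rewrite (segM_D hy) // !(segD hy) // a0 eqxx ne andbF mulr0 scaler0 addr0 /= => h.
  exact: (front_uniq h (hP _ _ _ _)).
- move=> b /andP[b0 bn]; have ne : (b.-1 == b) = false by lia.
  have bn' : (b.-1 <= n)%N by apply: leq_trans bn; apply: leq_pred.
  rewrite eqxx b0 ne /= derZ; have := DP b b b bn bn; rewrite b0 bn => /(_ isT).
  rewrite (segM_D hy) // !(segD hy) // b0 eqxx wpair_diag //= => h.
  (* Both factors contribute; after exchange their coefficients add up to 1 + q^-2, and the factor q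
     of the diagonal vector turns this into q + q^-1. *)
  have hc : y b.-1 * y b + q ^ (- (if b == 1%N then 2 else 1)) *: (y b * y b.-1)
    = (1 + q ^ (-2)) *: (y b.-1 * y b).
    rewrite scalerDl scale1r; congr (_ + _); have [e|ne1] := eqVneq b 1%N.
      by rewrite e /= (seg0 hy) mulr1 mul1r.
    rewrite (seg_comm hy) ?scalerA //; last lia.
    by rewrite -exprN1 -expfzDr ?q_neq0.
  rewrite hc in h; apply: (front_uniq (frontZ q h)).
  rewrite scalerA mulrDr mulr1.
  have -> : q * q ^ (-2) = q^-1 by rewrite -{1}[q]expr1z -expfzDr ?q_neq0 // exprN1.
  by apply: frontZ; apply: hP.
move=> l a b an /andP[b0 bn] ln lb la.
have hz : D l (P a b) = 0.
  have := DP l a b ln an; rewrite b0 bn => /(_ isT) h; apply: (front_uniq h).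
  rewrite (segM_D hy) // !(segD hy) // (negPf lb) andbF mulr0 scaler0 addr0.
  have -> : (0 < a)%N && (l == a) = false by lia.
  by rewrite mul0r; apply: front0.
by case: ifP => _; rewrite ?derZ hz ?scaler0.
Qed.

End LongRoots.

Lemma cancel_sum (V : zmodType) (a b w r : V) : a + (w + r - (b + w)) - r = a - b.
Proof. by rewrite [w + r]addrC [b + w]addrC addrKA addrA [X in X = _]addrAC addrK. Qed.

Lemma twist_const (F : fieldType) (x : F) : x != 0 ->
  1 - x ^+ 4 = x * (x + x^-1) * (1 - x ^+ 2).
Proof. by move=> x0; field. Qed.

(** The smallest word ends in the smallest letter that can be stripped, and continues with the
    smallest word of that derivative. *)
Lemma is_min_rcons ty n (S : qsetup ty n) (v : S) g (k : nat) : (k <= n)%N -> cf v [::] = 0 ->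
  (forall l, (l < k)%N -> der S (ix n l) v = 0) -> is_min (@Psi _ _ S (der S (ix n k) v)) (W n g) ->
  is_min (@Psi _ _ S v) (W n (rcons g k)).
Proof.
move=> kn v0 hl [h1 h2]; split; first by rewrite -/(cf v _) W_rcons -cf_der.
move=> s; case/lastP: s => [|s i]; first by rewrite -/(cf v _) v0 eqxx.
rewrite -/(cf v _) -cf_der; move: i; apply: forall_ix => l ln.
have [lk|kl|->] := ltngtP l k.
- by rewrite hl // cf0 eqxx.
- by move=> _; right; rewrite /word_lt W_rcons !map_rcons !rev_rcons /= !ixK // kl.
move=> /h2 [->|lt]; first by left; rewrite W_rcons.
by right; move: lt; rewrite /word_lt W_rcons !map_rcons !rev_rcons /= ltnn eqxx.
Qed.

Lemma is_minZ ty n (S : qsetup ty n) (v : S) (c : Qq) g : c <> 0 -> is_min (@Psi _ _ S v) g ->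
  is_min (@Psi _ _ S (c *: v)) g.
Proof.
move=> c0 [h1 h2]; have e s : (coefw (@Psi _ _ S (c *: v)) s != 0) = (coefw (@Psi _ _ S v) s != 0).
  by rewrite -/(cf _ _) -/(cf v s) cfZ mulf_eq0; move/eqP/negPf: c0 => ->.
by split=> [|s]; rewrite e //; apply: h2.
Qed.

Section Monomials.
Variables (ty : classical_type) (n : nat) (S : qsetup ty n).
Implicit Types (u v x y z : S) (g : seq nat) (k l a b : nat).
Local Notation D k := (@der _ _ S (ix n k)).
Local Notation E k := (@gen _ _ S (ix n k)).
Local Notation W := (W n).
Local Notation crystal := (crystal_elt ty (@gen _ _ S) (@der _ _ S)).

Lemma D_mon_mul g l x : (l <= n)%N -> small_letters n g -> l \notin g ->
  D l (mon S (W g) * x) = q ^ (- wpair ty l g) *: (mon S (W g) * D l x).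
Proof.
move=> ln; elim: g => [|k g IH] /=.
  by move=> _ _; rewrite mon_nil !mul1r /wpair big_nil oppr0 expr0z scale1r.
move=> /andP[kn hg]; rewrite inE negb_or => /andP[lk lg].
rewrite mon_cons -mulrA D_genM // (negPf lk) scale0r add0r IH // -scalerAr scalerA -mulrA.
by rewrite wpair_cons opprD expfzDr // q_neq0.
Qed.

Lemma D_mon_mul0 g l x : (l <= n)%N -> small_letters n g -> l \notin g -> D l x = 0 ->
  D l (mon S (W g) * x) = 0.
Proof. by move=> ln hg lg hx; rewrite D_mon_mul // hx mulr0 scaler0. Qed.

Lemma crystal_mon g c : small_letters n g -> uniq g -> (forall l, l \in g -> D l c = 0) ->
  crystal c -> crystal (mon S (W g) * c).
Proof.
elim: g => [|k g IH] /=; first by rewrite mon_nil mul1r.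
move=> /andP[kn hg] /andP[kg ug] hD hc; rewrite mon_cons -mulrA.
apply: crystalS (ftilde_gen _).
  by apply: IH => // l lg; apply: hD; rewrite inE lg orbT.
by apply: D_mon_mul0 => //; apply: hD; rewrite mem_head.
Qed.

End Monomials.

(** * Long roots of type C: duality, minimal words and uniqueness *)

Section LongRootVectors.
Variables (n : nat) (S : qsetup typeC n).
Hypothesis n0 : (0 < n)%N.
Implicit Types (u v x y z : S) (k l a b c j m : nat).
Local Notation D k := (@der _ _ S (ix n k)).
Local Notation E k := (@gen _ _ S (ix n k)).
Local Notation W := (W n).
Local Notation ft k := (ftilde typeC (@gen _ _ S) (@der _ _ S) (ix n k)).
Local Notation crystal := (crystal_elt typeC (@gen _ _ S) (@der _ _ S)).
Local Notation q2 := (q + q^-1).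
Let lin : typeC <> typeD. Proof. by []. Qed.

Variable V : nat -> nat -> S.
Hypothesis hV : pairs V.

Definition pw a b : seq nat := 0%N :: up 1 a ++ up 1 b.

Lemma pw_small a b : (a <= n)%N -> (b <= n)%N -> small_letters n (pw a b).
Proof. by move=> an bn; rewrite /pw /= -/(small_letters n _) small_cat !small_up. Qed.

Lemma mem_pw l a b : (l \in pw a b) = (l <= maxn a b)%N.
Proof. by rewrite inE mem_cat !mem_up; lia. Qed.

Lemma pairs_nil a b : (a <= n)%N -> (b <= n)%N -> cf (V a b) [::] = 0.
Proof. by move=> an bn; apply: wtU_nil (pairs_wt hV an bn) _. Qed.

Lemma pairs_above l a b : (a <= n)%N -> (b <= n)%N -> (l <= n)%N -> (maxn a b < l)%N -> D l (V a b) = 0.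
Proof.
move=> an bn ln hl; apply: (wtU_D_notin ln (pw_small an bn) _ (pairs_wt hV an bn)).
by rewrite mem_pw; lia.
Qed.

Lemma sformC_far k l : (k.+1 < l)%N -> sform typeC l k = 0.
Proof. by move=> h; have [] := sform_far lin h. Qed.

Lemma twist_D l b s x (c : Qq) : (l <= n)%N -> (b <= n)%N -> small_letters n s -> wtU (W s) x ->
  D l (E b * x - c *: (x * E b)) =
  (l == b)%:R *: (x - c *: (q ^ (- wpair typeC b s) *: x))
  + (q ^ (- sform typeC l b) *: (E b * D l x) - c *: (D l x * E b)).
Proof.
move=> ln bn hs hx; rewrite linearB derZ D_genM // (D_Mgen ln bn hs hx) [c *: (_ + _)]scalerDr opprD.
have [->|_] := eqVneq l b; last by rewrite !scale0r scaler0 subr0 add0r add0r.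
by rewrite !scale1r [- _ - _]addrC addrACA.
Qed.

Lemma far_comm a c b : (a <= n)%N -> (c <= n)%N -> (b <= n)%N -> ((maxn a c).+1 < b)%N ->
  E b * V a c = V a c * E b.
Proof.
move=> an cn bn h; apply: (gen_comm bn (pw_small an cn) _ _ (pairs_wt hV an cn)).
  by rewrite mem_pw; lia.
by move=> l; rewrite mem_pw => hl; apply: sformC_far; lia.
Qed.

(** Induction on a by comparing derivatives: e_a' lowers a, e_(c+1)' produces 1 - q^2, and e_c'
    leaves a vector commuting with e_(c+1). *)
Lemma pair_twist a c : (a < c)%N -> (c < n)%N ->
  E c.+1 * V a c - q *: (V a c * E c.+1) = (1 - q ^+ 2) *: V a c.+1.
Proof.
have [m] := ubnP a; elim: m a => // m IH a am ac cn; set b := c.+1.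
have cn' := ltnW cn; have an : (a <= n)%N by apply: leq_trans cn'; apply: ltnW.
have c0 : (0 < c)%N by apply: leq_ltn_trans ac.
have hw := pairs_wt hV an cn'.
apply: D_inj => [|l hl].
  by rewrite cfB !cfZ cf_gen_mul_nil cf_Mgen_nil pairs_nil // !mulr0 subrr.
rewrite (twist_D _ hl cn (pw_small an cn') hw) derZ.
have [->|lb] := eqVneq l b.
  rewrite pairs_above //; last by rewrite /b; lia.
  rewrite mulr0 mul0r !scaler0 subrr addr0 scale1r (pairs_r hV); last by rewrite /b cn; lia.
  have -> : wpair typeC b (pw a c) = -1.
    rewrite wpair_cons wpair_cat sformC_far; last by rewrite /b; lia.
    rewrite (wpair_lt (ltnSn c)) (@wpair_lt a b); last by rewrite /b; lia.
    have -> : (0 < a)%N && (b == a.+1) = false by rewrite /b; lia.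
    by rewrite eqxx c0.
  by rewrite opprK expr1z scalerA -expr2 scalerBl scale1r.
rewrite scale0r add0r; have [->|lc] := eqVneq l c.
  rewrite (pairs_r hV) ?ac // (pairs_o hV) ?scaler0 //; try (rewrite /b; lia).
  have -> : sform typeC c b = -1.
    rewrite sformC // /b /chain_adj eqxx; have -> : (c == c.+1) = false by lia.
    by [].
  by rewrite opprK expr1z far_comm ?subrr //; rewrite /b; lia.
have [->|la] := eqVneq l a; last first.
  by rewrite !(pairs_o hV) ?la ?c0 // mulr0 mul0r !scaler0 subrr.
have [a0|a0] := posnP a.
  by rewrite !(pairs_o hV) ?a0 ?c0 ?eqxx ?orbT // ?mulr0 ?mul0r ?scaler0 ?subrr //; rewrite /b; lia.
rewrite !(pairs_l hV) ?a0 ?ac //; last by rewrite /b; lia.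
rewrite sform_sym sformC_far ?oppr0 ?expr0z ?scale1r //.
by apply: IH => //; lia.
Qed.

(** The derivative at c reduces to [pair_twist] with a factor q [2], which fits because 1 - q^4 = q
    [2] (1 - q^2). *)
Lemma long_twist c : (c < n)%N ->
  E c.+1 * V c c - q ^+ 2 *: (V c c * E c.+1) = (1 - q ^+ 4) *: V c c.+1.
Proof.
move=> cn; have cn' := ltnW cn; set b := c.+1.
have hw := pairs_wt hV cn' cn'.
apply: D_inj => [|l hl].
  by rewrite cfB !cfZ cf_gen_mul_nil cf_Mgen_nil pairs_nil // !mulr0 subrr.
rewrite (twist_D _ hl cn (pw_small cn' cn') hw) derZ.
have [->|lb] := eqVneq l b.
  rewrite pairs_above //; last by rewrite /b maxnn.
  rewrite mulr0 mul0r !scaler0 subrr addr0 scale1r (pairs_r hV); last by rewrite /b cn ltnSn.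
  have -> : wpair typeC b (pw c c) = -2.
    rewrite wpair_cons wpair_cat (wpair_lt (ltnSn c)) eqxx andbT /b; by case: (c).
  by rewrite opprK -exprnP scalerA -exprD scalerBl scale1r.
rewrite scale0r add0r; have [->|lc] := eqVneq l c; last first.
  have oV : D l (V c b) = 0 by apply: (pairs_o hV); rewrite ?lc // /b; lia.
  have -> : D l (V c c) = 0.
    have [c0|c0] := posnP c; last by apply: (pairs_o hV); rewrite ?lc ?c0.
    have h := pairs00 hV; rewrite c0 in lc *; exact: (@isword_sole _ _ _ [::] 0%N _ _ h).
  by rewrite oV mulr0 mul0r !scaler0 subrr.
have [c0|c0] := posnP c.
  have -> : D c (V c c) = 1.
    have h := pairs00 hV; rewrite c0; apply: isword_uniq (isword_nil S).
    exact: (@isword_D _ _ _ [::] 0%N).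
  have -> : D c (V c b) = 0 by apply: (pairs_o hV); rewrite ?c0 /b //; lia.
  by rewrite /b c0 mulr1 mul1r scaler0 -[q ^ _]/(q ^+ 2) subrr.
rewrite (pairs_d hV) ?c0 // (pairs_l hV) ?c0 ?ltnSn //.
have -> : sform typeC c b = -1.
  rewrite sformC // /b /chain_adj eqxx; have -> : (c == c.+1) = false by lia.
  by [].
have h : E b * V c.-1 c - q *: (V c.-1 c * E b) = (1 - q ^+ 2) *: V c.-1 b.
  by apply: pair_twist => //; rewrite prednK.
rewrite -/b (twist_const q_neq0) -[RHS]scalerA -h opprK expr1z scalerBr -scalerAr -scalerAl !scalerA.
by congr (_ - _ *: _); rewrite [RHS]mulrAC.
Qed.

(** The crystal element e_a^(2) ... e_1^(2) e_0, witness for [V a a]; [Cp a b] below is the witness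
    for [V a b]. *)
Fixpoint Cu a : S :=
  if a is a'.+1 then divpow typeC (ix n a) (E a) 2 * Cu a' else mon S (W [:: 0%N]).

Definition Cp a b : S := mon S (W (down b a.+1)) * Cu a.

Lemma Cp_diag a : Cp a a = Cu a.
Proof. by rewrite /Cp /down up_nil // mon_nil mul1r. Qed.

Lemma CpS a b : (a <= b)%N -> Cp a b.+1 = E b.+1 * Cp a b.
Proof. by move=> ab; rewrite /Cp /down up_rcons // rev_rcons /= mon_cons mulrA. Qed.

Lemma qint2_C k : (0 < k <= n)%N -> qint typeC (ix n k) 2 = q2.
Proof.
move=> /andP[k0 kn]; rewrite qint2 ixK //; case: k k0 kn => // k _ _.
by rewrite /qi; have -> : dsym typeC k.+1 = 1 by [rewrite /dsym /sform eqxx]; rewrite expr1z.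
Qed.

Lemma divpow2_mul k x : divpow typeC (ix n k) (E k) 2 * x =
  (qint typeC (ix n k) 2)^-1 *: (E k * (E k * x)).
Proof. by rewrite divpow2 -scalerAl mulrA. Qed.

Lemma D_Cu l a : (a < l <= n)%N -> D l (Cu a) = 0.
Proof.
elim: a => [|a IH] /andP[al ln] /=.
  apply: (@wtU_der_notin _ _ S _ (W [:: 0%N])); last exact: wtU_mon.
  by rewrite mem_seq1 ix_eq // neq_ltn al orbT.
have an : (a.+1 <= n)%N by apply: leq_trans ln; apply: ltnW.
have ne : (l == a.+1) = false by lia.
rewrite divpow2_mul derZ !D_genM // ne !scale0r !add0r IH ?ln ?andbT; last exact: ltnW.
by rewrite !(mulr0, scaler0).
Qed.

Lemma D_Cp l a b : (a <= b)%N -> (b < l <= n)%N -> D l (Cp a b) = 0.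
Proof.
move=> ab /andP[bl ln]; apply: D_mon_mul0 => //.
- by apply: small_down; apply: leq_trans ln; apply: ltnW.
- by rewrite mem_rev mem_up; lia.
by apply: D_Cu; rewrite ln (leq_ltn_trans ab).
Qed.

Lemma crystal_Cu a : (a <= n)%N -> crystal (Cu a).
Proof.
elim: a => [|a IH] an /=.
  rewrite -[mon S _]mulr1; apply: (@crystal_mon _ _ S [:: 0%N]) => //; last exact: crystal1.
  by move=> l _; apply: der1.
have D0 : D a.+1 (Cu a) = 0 by apply: D_Cu; rewrite ltnSn.
apply: crystalS (ftilde_gen2 D0); apply: crystalS (ftilde_gen D0); apply: IH; exact: ltnW.
Qed.

(** The difference is [(q - q^2)] times an element of the crystal, by the Serre
    relation [e_a e_(a+1) e_a = e_a^(2) e_(a+1) + e_(a+1) e_a^(2)]. *)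
Lemma ft_Cp a b : (a.+1 < b <= n)%N -> exists2 C, ft a.+1 (Cp a b) C & qL (C - Cp a.+1 b).
Proof.
move=> /andP[ab bn]; set m := a.+1.
have mn : (m < n)%N by apply: leq_trans bn.
have mn' := ltnW mn.
set X := mon S (W (down b m.+1)); set C := Cu a.
have eX : Cp a b = X * (E m * C).
  by rewrite /Cp down_rcons 1?ltnW // W_rcons -cats1 mon_cat mon_cons mon_nil mulr1 mulrA.
have hg : small_letters n (down b m.+1) by apply: small_down.
have mg : m \notin down b m.+1 by rewrite mem_rev mem_up ltnn.
have DC : D m C = 0 by apply: D_Cu; rewrite ltnSn.
have DXC : D m (X * C) = 0 by apply: D_mon_mul0.
have wX : wpair typeC m (down b m.+1) = -1.
  rewrite down_rcons // wpair_rcons sformC // /chain_adj eqxx.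
  have -> : (m == m.+1) = false by lia.
  rewrite /wpair big1_seq ?add0r // => l; rewrite mem_rev mem_up => /andP[_ hl].
  by rewrite sform_sym sformC_far //; lia.
have Dv : D m (X * (E m * C)) = q *: (X * C).
  by rewrite D_mon_mul // wX opprK expr1z D_genM // eqxx scale1r DC mulr0 scaler0 addr0.
(* Since e_m' maps v = X e_m C to q X C, the vector [x0] is killed by e_m' and v = x0 + e_m (q X C)
   is the string decomposition. *)
pose x0 := X * (E m * C) - q *: (E m * (X * C)).
have Dx0 : D m x0 = 0.
  by rewrite linearB derZ Dv D_genM // eqxx scale1r DXC mulr0 scaler0 addr0 subrr.
pose w := divpow typeC (ix n m) (E m) 2 * (X * C).
have hft := ftilde_lin q (ftilde_gen2 DXC) (ftilde_gen Dx0).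
exists (q *: w + E m * x0).
  by rewrite eX; move: hft; rewrite /x0 addrC subrK.
have q2m : qint typeC (ix n m) 2 = q2 by apply: qint2_C.
have EE z : E m * (E m * z) = q2 *: (divpow typeC (ix n m) (E m) 2 * z).
  rewrite divpow2_mul q2m scalerA mulfV ?scale1r // -q2m; exact: qint_neq0.
have comm z : E m * (X * (E m * z)) =
    divpow typeC (ix n m) (E m) 2 * (X * z) + X * (divpow typeC (ix n m) (E m) 2 * z).
  rewrite !divpow2_mul -scalerAr; apply: (scalerI (qint_neq0 typeC (ix n m) 1)).
  rewrite scalerDr !scalerA mulfV ?qint_neq0 // !scale1r.
  have hX : X = mon S (W (down b m.+2)) * E m.+1.
    by rewrite /X down_rcons // W_rcons -cats1 mon_cat mon_cons mon_nil mulr1.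
  set X' := mon S (W (down b m.+2)) in hX.
  have cX : E m * X' = X' * E m.
    apply: (@gen_comm _ _ S m (down b m.+2)) => //.
    - exact: small_down.
    - by rewrite mem_rev mem_up; lia.
    - by move=> l; rewrite mem_rev mem_up => /andP[hl _]; rewrite sform_sym sformC_far.
    exact: wtU_mon.
  have [am _ _] := @linear_chain_node typeC lin m (ltn0Sn a).
  have mm : ix n m != ix n m.+1 by rewrite ix_eq // neq_ltn ltnSn.
  have := serreU1 S mm; rewrite !ixK // am => /(_ erefl) hs.
  have -> : qint typeC m 2 *: (E m * (X * (E m * z))) =
      X' * ((qint typeC m 2 *: (E m * E m.+1 * E m)) * z).
    by rewrite hX -scalerAl -scalerAr !mulrA cX.
  have c2 t : E m * (X' * t) = X' * (E m * t) by rewrite mulrA cX mulrA.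
  by rewrite -hs mulrDl mulrDr hX -!mulrA !c2.
suff -> : q *: w + E m * x0 - Cp m b = (q - q ^+ 2) *: w.
  apply: qL_small; last first.
    apply: lattice_crystal; rewrite /w; apply: crystalS (ftilde_gen2 DXC).
    apply: crystalS (ftilde_gen DXC); apply: crystal_mon => //.
    - by rewrite rev_uniq uniq_up.
    - move=> l; rewrite mem_rev mem_up => /andP[ml lb]; apply: D_Cu; lia.
    by apply: crystal_Cu; apply: ltnW.
  by apply: smallB; [apply: small_q | rewrite expr2; apply: smallMr small_q regq1].
rewrite /x0 mulrBr -scalerAr EE comm /Cp /= -/w scalerA -/X -/C.
have -> : q * q2 = q ^+ 2 + 1 by rewrite mulrDr mulfV ?q_neq0 // expr2.
rewrite !scalerBl scalerDl scale1r; exact: cancel_sum.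
Qed.

Lemma pairs_sole00 : sole (V 0 0) 0.
Proof. exact: (@isword_sole _ _ _ [::] 0%N _ (leq0n n) (pairs00 hV)). Qed.

Lemma pairs_sole b : (b <= n)%N -> sole (V b b) b.
Proof.
case: b => [|b] bn l ln lb; first exact: pairs_sole00.
by apply: (pairs_o hV); rewrite ?lb.
Qed.

(** On the diagonal the derivative is [2] V (a-1) a, and [long_twist] applies. Off the diagonal the
    letters a and b can both be stripped, and f_a and f_b must lead to the same class: exactly for
    b, by [ft_Cp] for a. *)
Lemma pairs_dualvec a b : (a <= b <= n)%N -> dualvec (V a b) (Cp a b).
Proof.
have [m] := ubnP (a + b); elim: m a b => // m IH a b hm /andP[ab bn].
have an : (a <= n)%N by apply: leq_trans bn.
move: ab; rewrite leq_eqVlt => /orP[/eqP e|ab].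
  rewrite -{}e in bn hm *; rewrite Cp_diag; case: a hm {bn} an => [|a] hm an.
    exact: (@isword_dualvec_uniq _ _ S [:: 0%N] (V 0 0) isT isT (pairs00 hV)).
  have an' := ltnW an; have ka : (0 < a.+1 <= n)%N by [].
  have hp : dualvec (V a a.+1) (Cp a a.+1) by apply: IH; [lia | rewrite leqnSn].
  have hw : dualvec (V a a) (Cu a).
    by rewrite -[X in dualvec _ X]Cp_diag; apply: IH; [lia | rewrite leqnn].
  have D0 : D a.+1 (Cu a) = 0 by apply: D_Cu; rewrite ltnSn.
  have q2a := qint2_C ka.
  rewrite CpS // Cp_diag in hp.
  apply: (dualvec_double an (pairs_sole an) (pairs_nil an an) hp hw) (ftilde_gen2 D0).
  - by rewrite q2a (pairs_d hV).
  - by rewrite (pairs_r hV) // ltnSn.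
  - by apply: pairs_above; rewrite ?maxnn.
  apply: (dsmall_twist an q2a (pw_small an' an') _ _ (pairs_wt hV an' an')).
  - by rewrite mem_pw maxnn ltnn.
  - move=> l; rewrite /pw /= count_cat !(count_uniq_mem _ (uniq_up 1 a)) mem_up.
    have [<-|l0] := eqVneq 0%N l; last by case: (_ && _).
    by [].
  - by case: hw => /nice_dreg.
  - by case: hp => /nice_dreg.
  exact: long_twist.
have b0 : (0 < b)%N by apply: leq_ltn_trans ab.
have ab' : (a <= b.-1)%N by lia.
have bn' : (b.-1 <= n)%N by apply: leq_trans bn; apply: leq_pred.
apply: dualvec_step; first exact: pairs_nil.
apply: forall_ix => l ln; have [->|lb] := eqVneq l b.
  have hd : D b (V a b) = V a b.-1 by rewrite (pairs_r hV) // ab.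
  have h : dualvec (D b (V a b)) (Cp a b.-1) by rewrite hd; apply: IH; [lia | rewrite ab'].
  have hC : D b (Cp a b.-1) = 0 by apply: D_Cp => //; rewrite bn; lia.
  apply: (DualvecSimple h _ (ftilde_gen hC)).
    by rewrite hd pairs_above //; lia.
  have e : E b * Cp a b.-1 = Cp a b by have := CpS ab'; rewrite prednK.
  by rewrite e subrr; apply: qL0.
have [la|la] := eqVneq l a; last by constructor 1; apply: (pairs_o hV); rewrite ?la ?b0.
rewrite {}la in lb ln *.
case: a lb ln hm an ab ab' => [|a] lb ln hm an ab ab'.
  by constructor 1; apply: (pairs_o hV); rewrite ?b0.
have hd : D a.+1 (V a.+1 b) = V a b by rewrite (pairs_l hV) // ab.
have h : dualvec (D a.+1 (V a.+1 b)) (Cp a b).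
  by rewrite hd; apply: IH; [lia | rewrite bn andbT; lia].
have [|C hC hq] := @ft_Cp a b; first by rewrite ab.
apply: (DualvecSimple h _ hC hq).
by rewrite hd (pairs_o hV) // ?b0 //; lia.
Qed.

Lemma pairs_min a b : (a <= b <= n)%N ->
  is_min (@Psi _ _ S (V a b)) (W (0%N :: up 1 b ++ up 1 a)).
Proof.
have q20 : q2 <> 0 by rewrite -(@qint2_C 1) //; apply/eqP/qint_neq0.
have [m] := ubnP (a + b); elim: m a b => // m IH a b hm /andP[ab bn].
have an : (a <= n)%N by apply: leq_trans bn.
have v0 := pairs_nil an bn.
have [a0|a0] := posnP a.
  rewrite {}a0 in hm ab an v0 *; rewrite cats0.
  have [b0|b0] := posnP b.
    by rewrite b0 -[V 0 0]scale1r; apply: is_min_isword (pairs00 hV); apply/eqP/oner_neq0.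
  have e : 0%N :: up 1 b = rcons (0%N :: up 1 b.-1) b by case: (b) b0 => // b' _; rewrite up_rcons.
  rewrite e; apply: is_min_rcons => //.
    by move=> l lb; apply: (pairs_o hV); rewrite ?b0 ?orbT //; lia.
  rewrite (pairs_r hV) ?b0 //; have := IH 0%N b.-1; rewrite cats0; apply; first lia.
  by apply: leq_trans (leq_pred _) bn.
have b0 : (0 < b)%N by apply: leq_trans ab.
have e : 0%N :: up 1 b ++ up 1 a = rcons (0%N :: up 1 b ++ up 1 a.-1) a.
  by case: (a) a0 => // a' _; rewrite (up_rcons (ltn0Sn _)) /= rcons_cat.
rewrite e; apply: is_min_rcons => //.
  by move=> l la; apply: (pairs_o hV); rewrite ?b0 //; lia.
have bn' : (b.-1 <= n)%N by apply: leq_trans bn; apply: leq_pred.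
move: ab; rewrite leq_eqVlt => /orP[/eqP ab|ab].
  rewrite ab (pairs_d hV) ?b0 //; apply: is_minZ => //; apply: IH; first lia.
  by rewrite leq_pred.
by rewrite (pairs_l hV) ?a0 //; apply: IH; [lia | rewrite bn andbT; lia].
Qed.

(** A left factor ending below j is smaller at once. The only other one is [0..j]; read from the
    right it agrees with the word on j..1, and then its 0 meets j. *)
Lemma long_lyndon j : (0 < j <= n)%N -> lyndon (W (up 0 j ++ up 1 j)).
Proof.
move=> /andP[j0 jn]; set G := up 0 j ++ up 1 j.
have hG : small_letters n G by rewrite small_cat !small_up.
split; first by rewrite /G up_cons.
move=> u v u0 v0 huv.
have hG' : G = map val u ++ map val v by rewrite -map_cat -huv map_val_W.
rewrite /word_lt map_val_W //; move: hG'; set u' := map val u; set v' := map val v.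
have {u0} : u' <> [::] by rewrite /u'; case: (u) u0.
have {v0 huv} : v' <> [::] by rewrite /v'; case: (v) v0.
move: u' v' => u' v'; case/lastP: u' => // u' c v0 _ hG'.
have rG : rev G = j :: rev (up 0 j ++ up 1 j.-1).
  by rewrite /G; case: (j) j0 => // j' _; rewrite [up 1 j'.+1]up_rcons // -rcons_cat rev_rcons.
have hc : c = nth 0%N G (size u') by rewrite hG' cat_rcons nth_cat ltnn subnn.
have hs : (size u' + 1 + size v' = j.+1 + j)%N.
  have := congr1 size hG'; rewrite /G !size_cat size_rcons !size_iota => h; lia.
have sv : (0 < size v')%N by case: (v') v0.
have [cj|cj] := ltnP c j; first by rewrite rG rev_rcons /= cj.
have su : size u' = j.
  move: cj; rewrite hc /G nth_cat size_iota subn0; case: ltnP => h; rewrite nth_iota; lia.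
have eu : rcons u' c = up 0 j.
  have := congr1 (take j.+1) hG'; rewrite /G !take_size_cat ?size_rcons ?su //.
  by rewrite size_iota subn0.
rewrite eu /G rev_cat {1}(up_cons (leq0n j)) rev_cons -cats1 rlt_cat.
by case: (j) j0 => // j' _; rewrite up_rcons // rev_rcons.
Qed.

Definition Dw (g : seq nat) x : S := foldr (fun k => D k) x g.

Lemma cf_Dw g x (t : seq 'I_n.+1) : cf (Dw g x) t = cf x (t ++ W g).
Proof.
elim: g t => [|k g IH] t /=; first by rewrite cats0.
by rewrite cf_der IH cat_rcons.
Qed.

Lemma Dw_rcons g k x : Dw (rcons g k) x = Dw g (D k x).
Proof. exact: foldr_rcons. Qed.

Lemma DwZ g (c : Qq) x : Dw g (c *: x) = c *: Dw g x.
Proof. by apply: cf_inj => t; rewrite cfZ !cf_Dw cfZ. Qed.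

Lemma DwB g x y : Dw g (x - y) = Dw g x - Dw g y.
Proof. by apply: cf_inj => t; rewrite cfB !cf_Dw cfB. Qed.

Lemma Dw_comm g k x : (forall l z, l \in g -> D l (D k z) = D k (D l z)) -> Dw g (D k x) = D k (Dw g x).
Proof.
elim: g => //= l g IH h; rewrite IH; first by rewrite h ?mem_head.
by move=> l' z hl; apply: h; rewrite inE hl orbT.
Qed.

Lemma Dw_pairs a b : (a < b <= n)%N -> Dw (up 0 a) (V a b) = 0.
Proof.
elim: a => [|a IH] /andP[ab bn].
  by apply: (pairs_o hV); rewrite ?orbT ?ab //; lia.
rewrite up_rcons // Dw_rcons (pairs_l hV) ?ab //; apply: IH; rewrite bn andbT; exact: ltnW.
Qed.

Lemma sole_eq0 (s : seq nat) x m : wtU (W s) x -> (0 < size s)%N -> sole x m -> D m x = 0 -> x = 0.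
Proof.
move=> hx hs sx h; apply: (D_inj_sole (k := m)) => //.
- by rewrite cf0; apply: wtU_nil hx _; rewrite size_map.
- by move=> l _ _; rewrite linear0.
by rewrite h linear0.
Qed.

Lemma wtU_Drem k (s : seq nat) x : (k <= n)%N -> small_letters n s -> wtU (W s) x ->
  wtU (W (rem k s)) (D k x).
Proof.
move=> kn hs hx; case: (boolP (k \in s)) => ks; first exact: wtU_rem.
by rewrite (wtU_D_notin kn hs ks hx); apply: wtU0.
Qed.

(** By the argument of [descendsS] the letters m, m-1, ..., 0 are the only ones that can be stripped
    in turn, so a nonzero x would survive all of them. The bound on the size keeps the weights
    nonempty on the way. *)
Lemma descend_eq0 m (s : seq nat) x : (m <= n)%N -> small_letters n s -> (m < size s)%N ->
  wtU (W s) x -> sole x m -> D m (D m x) = 0 -> ((m < n)%N -> D m.+1 (D m x) = 0) ->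
  Dw (up 0 m) x = 0 -> x = 0.
Proof.
elim: m s x => [|m IH] s x mn hs ms hx xs x2 xp; first exact: sole_eq0 hx ms xs.
rewrite up_rcons // Dw_rcons => xw; have mn' := ltnW mn.
apply: (sole_eq0 hx _ xs); first exact: leq_ltn_trans ms.
have hx' := wtU_Drem mn hs hx.
have hs' : small_letters n (rem m.+1 s) by apply/allP => l /mem_rem; apply: (allP hs).
have ms' : (m < size (rem m.+1 s))%N.
  case: (boolP (m.+1 \in s)) => h; last by rewrite rem_id // ltnW.
  by rewrite size_rem //; move: ms; case: (size s).
case: m IH mn ms xs x2 xp xw mn' hx' hs' ms' => [|m] IH mn ms xs x2 xp xw mn' hx' hs' ms'.
  have xs' := sole_after_1 lin n0 xs x2 xp.
  exact: (sole_eq0 hx' ms' xs').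
set k := m.+1 in IH mn ms xs x2 xp xw mn' hx' hs' ms' *.
have [am am' an] := @linear_chain_node typeC lin k (ltn0Sn m).
have mm : k != k.+1 by rewrite neq_ltn leqnn.
have mm' : k.+1 != k by rewrite eq_sym.
have xm : D k x = 0 by apply: xs.
apply: (IH (rem k.+1 s)) => //.
- move=> l hl lm; have [->//|lm1] := eqVneq l k.+1.
  have [lm2|lm2] := eqVneq l k.+2; first by rewrite lm2 xp // -lm2.
  by rewrite -(D_comm _ mn hl) 1?eq_sym ?an // xs // linear0.
- by have := D_serre1 x mn' mn mm am; rewrite xm !linear0 addr0.
move=> _; have := D_serre1 x mn mn' mm' am'; rewrite xm x2 !linear0 addr0 => /esym/eqP.
by rewrite scaler_eq0 (negPf (qint_neq0 typeC _ 1)) => /eqP.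
Qed.

Lemma perm_pwS j : perm_eq (pw j.+1 j.+1) (rcons (rcons (pw j j) j.+1) j.+1).
Proof.
rewrite /pw up_rcons // -!cats1 -!catA /= perm_cons -!catA perm_cat2l.
by apply/permPl; apply: (perm_catCA [:: j.+1] (up 1 j) [:: j.+1]).
Qed.

(** Induction applies to e_j'^2 v, and e_j'^2 maps [V j j] to [2] times its predecessor. Subtracting
    the matching multiple leaves a vector with e_j'^2 = 0, to which [descend_eq0] applies. The
    hypothesis on [Dw] excludes words ending in [0..j]. *)
Lemma long_prop j v : (j <= n)%N -> wtU (W (pw j j)) v -> sole v j ->
  ((0 < j)%N -> Dw (up 0 j) v = 0) -> exists c : Qq, v = c *: V j j.
Proof.
elim: j v => [|j IH] v jn hv sv hw.
  have h1 : D 0 (V 0 0) = 1.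
    by apply: isword_uniq (isword_nil S); exact: (@isword_D _ _ _ [::] 0%N _ (pairs00 hV)).
  exists (cf (D 0 v) [::]); apply: (prop_sole (k := 0%N)) => //.
  - exact: pairs_nil.
  - by apply: wtU_nil hv _.
  - exact: pairs_sole00.
  by rewrite h1; apply: wtU_nilE; apply: (@wtU_Dr _ _ _ [::]).
have jn' := ltnW jn; set z := D j.+1 (D j.+1 v).
have wz : wtU (W (pw j j)) z.
  by apply: wtU_Dr; apply: wtU_Dr; apply: wtU_perm hv; apply: perm_map; apply: perm_pwS.
have zl l : (j < l)%N -> (l <= n)%N -> D l z = 0.
  by move=> jl ln; apply: (wtU_D_notin ln (pw_small jn' jn') _ wz); rewrite mem_pw maxnn -ltnNge.
have far l x : (l.+1 < j.+1)%N -> D l (D j.+1 x) = D j.+1 (D l x).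
  by move=> hl; apply: D_comm; [lia | | lia | have [] := @cartan_far typeC lin l j.+1 hl].
have [||c hc] := IH z jn' wz.
- move=> l ln lj; have [jl|lj'] := ltnP j l; first exact: zl.
  have l1 : (l.+1 < j.+1)%N by lia.
  by rewrite /z !far // sv ?linear0 //; lia.
(* The cubic relation moves the next lower letter past one of the two stripped letters, and smaller
   letters commute with the other; so the hypothesis on [Dw] passes to [z]. *)
- case: j IH jn hv sv hw jn' @z wz zl far => // j IH jn hv sv hw jn' z wz zl far _.
  have [_ am' _] := @linear_chain_node typeC lin j.+1 (ltn0Sn j).
  have mm' : j.+2 != j.+1 by rewrite neq_ltn ltnSn orbT.
  have := D_serre1 v jn jn' mm' am'; rewrite (sv j.+1) 1?eq_sym // !linear0 add0r -/z => hz.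
  rewrite up_rcons // Dw_rcons hz DwZ Dw_comm; last first.
    by move=> l x; rewrite mem_up => hl; apply: far; lia.
  have := hw isT; rewrite up_rcons // Dw_rcons up_rcons // Dw_rcons => ->.
  by rewrite linear0 scaler0.
have q20 : q2 != 0 by rewrite -(@qint2_C 1) //; apply: qint_neq0.
exists (c / q2); apply/eqP; rewrite -subr_eq0; apply/eqP.
have DV : D j.+1 (V j.+1 j.+1) = q2 *: V j j.+1 by rewrite (pairs_d hV).
have DV' : D j.+1 (V j j.+1) = V j j by rewrite (pairs_r hV) // ltnSn.
set v' := v - _; have wv' : wtU (W (pw j.+1 j.+1)) v'.
  by apply: wtUB => //; apply: wtUZ; apply: (pairs_wt hV).
have hs := pw_small jn jn.
apply: (descend_eq0 jn hs _ wv') => //.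
- by rewrite /pw /= size_cat !size_iota; lia.
- by move=> l ln lj; rewrite linearB derZ sv // pairs_sole // scaler0 subrr.
- by rewrite !linearB !derZ -/z hc DV derZ DV' scalerA divfK // subrr.
- move=> jn2; have hp := perm_pwS j.
  have h : wtU (W (rcons (pw j j) j.+1)) (D j.+1 v').
    by apply: wtU_Dr; apply: wtU_perm wv'; apply: perm_map.
  apply: (wtU_D_notin jn2 _ _ h); first by rewrite small_rcons jn pw_small.
  by rewrite mem_rcons inE mem_pw maxnn; lia.
by rewrite DwB DwZ hw // up_rcons // Dw_rcons DV DwZ Dw_pairs ?ltnSn // !scaler0 subrr.
Qed.

End LongRootVectors.

Lemma coefw_mull r (i : 'I_r) f s :
  coefw (wd [:: i] * f) s = if s is j :: t then (j == i)%:R * coefw f t else 0.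
Proof.
apply: (@linear_wordP r Qq^o (fun f => coefw (wd [:: i] * f) s)
  (fun f => if s is j :: t then (j == i)%:R * coefw f t else 0)).
- move=> c x y; rewrite mulrDr malg_scaleAr coefwD coefwZ //.
- by move=> c x y; case: s => [|j t]; rewrite ?scaler0 ?addr0 // coefwD coefwZ mulrDr mulrCA.
move=> t; rewrite wdM coefw_wd; case: s => [|j s] //=.
by rewrite coefw_wd eqseq_cons eq_sym -natrM mulnb.
Qed.

Lemma root_vector_C3 n (S : qsetup typeC n) j : (1 <= j <= n)%N ->
  is_root_vector (@cbasis _ _ S) (@form _ _ S) (@Psi _ _ S) (W n (up 0 j ++ up 1 j))
    (q *: (wd (W n [:: 0%N]) * qshuffle typeC (wd (W n (up 1 j))) (wd (W n (up 1 j))))).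
Proof.
move=> hj; have /andP[j0 jn] := hj; have n0 : (0 < n)%N by apply: leq_trans jn.
have [V [hV hs]] := pairs_exist S n0; have [u hu hf] := hs j hj.
have eu : @Psi _ _ S u = wd (W n (up 1 j)).
  by apply: coefwP => s; rewrite coefw_wd -/(cf u s) hu eq_sym.
have [_ _ PsiM _] := Psi_ok S.
have -> : q *: (wd (W n [:: 0%N]) * qshuffle typeC (wd (W n (up 1 j))) (wd (W n (up 1 j)))) =
    @Psi _ _ S (V j j).
  apply: coefwP => s; rewrite -/(cf (V j j) s) hf -eu -PsiM coefwZ coefw_mull.
  by case: s => [|i s]; rewrite ?mulr0 // cfZ mulrCA.
have jj : (j <= j <= n)%N by rewrite leqnn.
have hm := pairs_min n0 hV jj; rewrite -[_ :: _ ++ _]/((0%N :: up 1 j) ++ up 1 j) -up_cons // in hm.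
have hw := pairs_wt hV jn jn.
have eg : 0%N :: up 1 j ++ up 1 j = up 0 j ++ up 1 j by rewrite [up 0 j]up_cons.
rewrite eg in hw.
apply: (root_vector_intro (pairs_dualvec n0 hV jj) hw hm (long_lyndon n0 hj)) => v hv hvm.
apply: (long_prop n0 hV jn); first by rewrite /pw eg.
  have e : up 0 j ++ up 1 j = rcons (up 0 j ++ up 1 j.-1) j.
    by case: (j) j0 => // j' _; rewrite [up 1 j'.+1]up_rcons // rcons_cat.
  rewrite e in hv hvm; apply: (min_sole _ _ hv hvm).
    by rewrite -e small_cat !small_up.
  by rewrite all_cat; apply/andP; split; apply/allP => l; rewrite mem_up; lia.
(* A word ending in [0..j] lies below the minimal one: read from the right both start with j..1, and
   then 0 meets j. *)
move=> _; apply: cf_inj => t; rewrite cf_Dw cf0; apply/eqP.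
case: (cf v (t ++ W n (up 0 j)) =P 0) => // /eqP h.
have rg : rev (map val (W n (up 0 j ++ up 1 j))) = rev (up 1 j) ++ rev (up 0 j).
  by rewrite map_val_W ?rev_cat // small_cat !small_up.
have rt : rev (map val (t ++ W n (up 0 j))) = rev (up 1 j) ++ 0%N :: rev (map val t).
  by rewrite map_cat map_val_W ?small_up // rev_cat (up_cons (leq0n j)) rev_cons cat_rcons.
have rj : rev (up 0 j) = j :: rev (up 0 j.-1).
  by case: (j) j0 => // j' _; rewrite up_rcons // rev_rcons.
have [_ /(_ _ h) [e|]] := hvm; last first.
  by rewrite /word_lt rg rt rlt_cat rj /=; case: (j) j0.
have := rlt_irr (rev (map val (t ++ W n (up 0 j)))).
by rewrite {2}e rg rt rlt_cat rj /= j0.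
Qed.

(** * Assembling the four types *)

Lemma lettersE n s : small_letters n s -> letters n.+1 s = W n s.
Proof.
elim: s => // k s IH /andP[kn hs]; rewrite /letters /= insubT /= -/(letters n.+1 s) IH //.
by congr (_ :: _); apply: val_inj; rewrite /= ixK.
Qed.

Theorem proposition5p1p2 (ty : classical_type) (r : nat)
    (r_ok : valid_rank ty r)
    (U : algType Qq) (e : 'I_r -> U) (U_ok : is_Uq ty e)
    (Psi : {linear U -> freeAlg r}) (Psi_ok : is_Psi ty e Psi)
    (d : 'I_r -> {linear U -> U}) (d_ok : is_qderiv ty e d)
    (K : U -> U -> Qq) (K_ok : is_formK e d K)
    (bar : {rmorphism U -> U}) (bar_ok : is_bar e bar)
    (G : U -> Prop) (G_ok : is_canonical_basis ty e d bar G) :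
  let W (s : seq nat) : seq 'I_r := letters r s in
  let F (s : seq nat) : freeAlg r := wd (W s) in
  let bstar (s : seq nat) (w : freeAlg r) : Prop :=
    is_root_vector G K Psi (W s) w in
  match ty with
  | typeA =>
      forall i j, (i <= j < r)%N -> bstar (up i j) (F (up i j))
  | typeB =>
      (forall i j, (i <= j < r)%N -> bstar (up i j) (F (up i j))) /\
      (forall j k, (j < k < r)%N ->
         bstar (down j 0 ++ up 0 k)
           (qint typeB 0 2 *: F (down j 0 ++ up 0 k)))
  | typeC =>
      [/\ forall i j, (i <= j < r)%N -> bstar (up i j) (F (up i j)),
          forall j k, (1 <= j)%N -> (j < k < r)%N ->
            bstar (down j 1 ++ [:: 0%N] ++ up 1 k)
              (F (down j 1 ++ [:: 0%N] ++ up 1 k)) &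
          forall j, (1 <= j < r)%N ->
            bstar (up 0 j ++ up 1 j)
              (q *: (F [:: 0%N] * qshuffle typeC (F (up 1 j)) (F (up 1 j))))]
  | typeD =>
      [/\ bstar [:: 0%N] (F [:: 0%N]),
          forall i, (2 <= i < r)%N ->
            bstar (0%N :: up 2 i) (F (0%N :: up 2 i)),
          forall i j, (1 <= i)%N -> (i <= j < r)%N ->
            bstar (up i j) (F (up i j)),
          forall j, (2 <= j < r)%N ->
            bstar ([:: 1%N; 0%N] ++ up 2 j)
              (F ([:: 1%N; 0%N] ++ up 2 j) + F ([:: 0%N; 1%N] ++ up 2 j)) &
          forall j k, (2 <= j)%N -> (j < k < r)%N ->
            bstar (down j 2 ++ [:: 1%N; 0%N] ++ up 2 k)
              (F (down j 2 ++ [:: 1%N; 0%N] ++ up 2 k)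
               + F (down j 2 ++ [:: 0%N; 1%N] ++ up 2 k))]
  end.
Proof.
have : (0 < r)%N by move: r_ok; case: (ty) => /=; case: (r).
case: r => // n in r_ok e U_ok Psi Psi_ok d d_ok K K_ok bar bar_ok G G_ok *.
move=> _ Wr F bstar; rewrite {}/bstar {}/F {}/Wr.
pose S := QSetup U_ok Psi_ok d_ok K_ok bar_ok G_ok.
have smalls j i : (i <= n)%N -> small_letters n (up j i) by apply: small_up.
have smalld j i : (i <= n)%N -> small_letters n (down i j) by apply: small_down.
case: ty r_ok U_ok Psi_ok d_ok K_ok G_ok @S => r_ok U_ok Psi_ok d_ok K_ok G_ok S.
- move=> i j /andP[ij jn]; rewrite !lettersE ?smalls //.
  by apply: (@root_vector_up typeA _ _ S) => //; rewrite ij.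
- split=> [i j /andP[ij jn]|j k /andP[jk kn]].
    rewrite !lettersE ?smalls //; by apply: (@root_vector_up typeB _ _ S) => //; rewrite ij.
  have jn : (j <= n)%N by apply: leq_trans (ltnW jk) _.
  rewrite !lettersE ?small_cat ?smalls ?smalld //.
  by apply: (@root_vector_B2 _ S); rewrite jk.
- split=> [i j /andP[ij jn]|j k j1 /andP[jk kn]|j /andP[j0 jn]].
  + rewrite !lettersE ?smalls //; by apply: (@root_vector_up typeC _ _ S) => //; rewrite ij.
  + have jn : (j <= n)%N by apply: leq_trans (ltnW jk) _.
    rewrite !lettersE ?small_cat /= ?smalls ?smalld //.
    by apply: (@root_vector_C2 _ S) => //; rewrite jk.
  rewrite !lettersE ?small_cat ?smalls //.
  by apply: (@root_vector_C3 _ S); rewrite j0.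
have n1 : (1 < n)%N by [].
have n0 := ltnW n1.
split=> [|i /andP[i2 ilt]|i j i1 /andP[ij jn]|j /andP[j2 jn]|j k j2 /andP[jk kn]].
- rewrite !lettersE //; exact: (@root_vector_D0 _ S).
- rewrite !lettersE; try exact: smalls.
  by apply: (@root_vector_D_cons _ S); rewrite i2.
- by rewrite !lettersE ?smalls //; apply: (@root_vector_D_chain _ S) => //; rewrite ij.
- rewrite !lettersE ?small_cat /= ?n0 ?smalls //.
  (* With descending segment from 1 to 2, which is empty, the fork stands at the start of the
     word. *)
  by apply: (@root_vector_fork _ S 1 j); rewrite // j2.
have jn : (j <= n)%N by apply: leq_trans (ltnW jk) _.
rewrite !lettersE ?small_cat /= ?n0 ?smalls ?smalld //.
apply: (@root_vector_fork _ S j k); first exact: ltnW.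
  by rewrite jk.
by apply: leq_trans (ltnW jk).
Qed.
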